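(* Let $\alpha\in(0,1)$ and $\lambda>0$. For every $f\in C^{\alpha}_H(X)$, the unique solution $u\in D(L)$ of $\lambda u - Lu = f$ (that is, $u=R(\lambda,L)f$) belongs to $C^{2+\alpha}_H(X)$. Moreover, there exists $C=C(\lambda,\alpha)>0$, independent of $f$, such that $$\|u\|_{C^{2+\alpha}_H(X)}\le C\,\|f\|_{C^{\alpha}_H(X)}.$$
   Context: Let $X$ be a separable real Banach space endowed with a centered Gaussian measure $\gamma$. Let $H\subset X$ be the associated Cameron–Martin space, with norm $\|\cdot\|_H$. $C_b(X)$ is the space of bounded continuous functions $X\to\mathbb R$, with norm $\|f\|_\infty=\sup_X|f|$. The Ornstein–Uhlenbeck semigroup is $$T(t)f(x)=\int_X f\big(e^{-t}x+\sqrt{1-e^{-2t}}\,y\big)\,\gamma(dy),\qquad t\ge0,\ f\in C_b(X).$$ For $\lambda>0$ the operators $f\mapsto\int_0^\infty e^{-\lambda t}T(t)f(x)\,dt$ are injective bounded operators on $C_b(X)$ satisfying the resolvent identity. Hence there is a unique linear operator $L:D(L)\subset C_b(X)\to C_b(X)$ with $$R(\lambda,L)f(x)=(\lambda-L)^{-1}f(x)=\int_0^\infty e^{-\lambda t}T(t)f(x)\,dt\quad\text{for all }\lambda>0 .$$ $H$-differentiability. Let $Y$ be a Banach space. A map $F:X\to Y$ is $H$-differentiable at $x$ if there is a bounded linear $\ell:H\to Y$ with $\|F(x+h)-F(x)-\ell(h)\|_Y/\|h\|_H\to0$ as $\|h\|_H\to0$. - For $F=f$ real-valued, write $\ell=D_Hf(x)$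 and $D_Hf(x)(h)=\langle\nabla_Hf(x),h\rangle_H$. - Higher derivatives are defined iteratively: $D^2_Hf(x)\in\mathcal L^{(2)}(H)$ and $D^3_Hf(x)\in\mathcal L^{(3)}(H)$, where $\mathcal L^{(j)}(H)$ is the space of bounded $j$-linear forms on $H$. Function spaces. - $C^k_H(X)$ is the set of $f\in C_b(X)$ that are $k$ times $H$-differentiable at every point, with $D^j_Hf$ bounded and continuous into $\mathcal L^{(j)}(H)$ for $j\le k$. Its norm is $\|f\|_{C^k_H}=\|f\|_\infty+\sum_{j=1}^k\sup_x\|D^j_Hf(x)\|_{\mathcal L^{(j)}(H)}$. - For $\alpha\in(0,1)$ and a Banach space $Y$, $C^\alpha_H(X,Y)$ is the set of bounded continuous $F:X\to Y$ with $[F]_\alpha:=\sup_{x\in X,\,h\in H\setminus\{0\}}\|F(x+h)-F(x)\|_Y/\|h\|_H^\alpha<\infty$. Its norm is $\|F\|_\infty+[F]_\alpha$, and $C^\alpha_H(X):=C^\alpha_H(X,\mathbb R)$. - $C^{2+\alpha}_H(X)$ is the set of $f\in C^2_H(X)$ with $D^2_Hf\in C^\alpha_H(X,\mathcal L^{(2)}(H))$. Its norm is $\|f\|_{C^2_H}+[D^2_Hf]_\alpha$. *)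

(* Defs.v *)
From HB Require Import structures.
From mathcomp Require Import all_boot all_order all_algebra.
From mathcomp Require Import all_classical all_reals all_analysis.
Set Implicit Arguments. Unset Strict Implicit. Unset Printing Implicit Defensive.
Import Order.TTheory GRing.Theory Num.Theory.
Import numFieldNormedType.Exports.
Local Open Scope classical_set_scope.
Local Open Scope ring_scope.

Section Defs.
Context {R : realType} {X : completeNormedModType R}.

Definition borelX := g_sigma_algebraType (@open X).

Definition separable : Prop :=
  exists D : set X, countable D /\ closure D = [set: X].

Definition is_clf (l : X -> R) : Prop :=
  (forall (a : R) (x y : X), l (a *: x + y) = a * l x + l y) /\ continuous l.

Definition centered_gaussian (gamma : probability borelX R) : Prop :=
  forall l : X -> R, is_clf l ->
    (forall A : set R, measurable A -> gamma (l @^-1` A) = \d_(0 : R) A)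
    \/ (exists s : R, 0 < s /\
          forall A : set R, measurable A -> gamma (l @^-1` A) = normal_prob 0 s A).

Variable gamma : probability borelX R.

(** Cameron-Martin norm (Bogachev):
    |h|_H = sup { l h : l in X^*, int l^2 dgamma <= 1 }  (possibly +oo). *)
Definition cm_enorm (h : X) : \bar R :=
  ereal_sup [set (l h)%:E | l in
    [set l : X -> R | is_clf l /\ (\int[gamma]_x ((l x) ^+ 2)%:E <= 1)%E]].

Definition inH (h : X) : Prop := (cm_enorm h < +oo)%E.
Definition hnorm (h : X) : R := fine (cm_enorm h).

Definition supnorm (f : X -> R) : \bar R :=
  ereal_sup [set (`|f x|)%:E | x in [set: X]].

Definition opnorm1 (A : X -> R) : \bar R :=
  ereal_sup [set (`|A k|)%:E | k in [set k | inH k /\ hnorm k <= 1]].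

Definition opnorm2 (B : X -> X -> R) : \bar R :=
  ereal_sup [set r | exists k1 k2 : X, [/\ inH k1, hnorm k1 <= 1, inH k2,
                      hnorm k2 <= 1 & r = (`|B k1 k2|)%:E]].

Definition linear_onH (A : X -> R) : Prop :=
  forall (a : R) (h k : X), inH h -> inH k -> A (a *: h + k) = a * A h + A k.

Definition bounded_linear_onH (A : X -> R) : Prop :=
  linear_onH A /\ (opnorm1 A < +oo)%E.

Definition bounded_bilinear_onH (B : X -> X -> R) : Prop :=
  (forall h, inH h -> linear_onH (B h)) /\
  (forall k, inH k -> linear_onH (fun h => B h k)) /\
  (opnorm2 B < +oo)%E.

Definition H_diff_at (f : X -> R) (x : X) (D : X -> R) : Prop :=
  bounded_linear_onH D /\
  forall eps : R, 0 < eps -> exists delta : R, 0 < delta /\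
    forall h : X, inH h -> 0 < hnorm h < delta ->
      `|f (x + h) - f x - D h| <= eps * hnorm h.

(** F : X -> L(H) (F y k = F(y)(k)) is H-differentiable at x with derivative
    h |-> (k |-> D h k), a bounded linear map H -> L(H), identified with the
    bilinear form D in L^(2)(H). *)
Definition H_diff1_at (F : X -> X -> R) (x : X) (D : X -> X -> R) : Prop :=
  bounded_bilinear_onH D /\
  forall eps : R, 0 < eps -> exists delta : R, 0 < delta /\
    forall h : X, inH h -> 0 < hnorm h < delta ->
      (opnorm1 (fun k => (F (x + h) k - F x k - D h k)%R) <= (eps * hnorm h)%:E)%E.

(** alpha-Holder seminorm along H, for a map given through a distance d between
    its values at two points: sup_{x, h in H \ 0} d(x+h, x) / |h|_H^alpha *)
Definition holder_semi (alpha : R) (d : X -> X -> \bar R) : \bar R :=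
  ereal_sup [set r | exists x h : X, [/\ inH h, h != 0 &
                      r = (d (x + h)%R x * ((hnorm h `^ alpha)^-1)%:E)%E]].

Definition holder_real (alpha : R) (f : X -> R) : \bar R :=
  holder_semi alpha (fun y z => (`|f y - f z|)%:E).

Definition holder_bilin (alpha : R) (B : X -> X -> X -> R) : \bar R :=
  holder_semi alpha (fun y z => opnorm2 (fun k1 k2 => B y k1 k2 - B z k1 k2)).

Definition in_CalphaH (alpha : R) (f : X -> R) : Prop :=
  continuous f /\ (supnorm f < +oo)%E /\ (holder_real alpha f < +oo)%E.

Definition CalphaH_norm (alpha : R) (f : X -> R) : \bar R :=
  (supnorm f + holder_real alpha f)%E.

Definition C2H_with (u : X -> R) (D1 : X -> X -> R) (D2 : X -> X -> X -> R) : Prop :=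
  continuous u /\ (supnorm u < +oo)%E /\
  (forall x, H_diff_at u x (D1 x)) /\
  (forall x, H_diff1_at D1 x (D2 x)) /\
  (ereal_sup [set opnorm1 (D1 x) | x in [set: X]] < +oo)%E /\
  (ereal_sup [set opnorm2 (D2 x) | x in [set: X]] < +oo)%E /\
  (forall x eps, 0 < eps -> exists delta, 0 < delta /\ forall y, `|y - x| < delta ->
     (opnorm1 (fun k => (D1 y k - D1 x k)%R) <= eps%:E)%E) /\
  (forall x eps, 0 < eps -> exists delta, 0 < delta /\ forall y, `|y - x| < delta ->
     (opnorm2 (fun k1 k2 => (D2 y k1 k2 - D2 x k1 k2)%R) <= eps%:E)%E).

Definition C2alphaH_with (alpha : R) (u : X -> R) (D1 : X -> X -> R)
  (D2 : X -> X -> X -> R) : Prop :=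
  C2H_with u D1 D2 /\ (holder_bilin alpha D2 < +oo)%E.

Definition C2alphaH_norm (alpha : R) (u : X -> R) (D1 : X -> X -> R)
  (D2 : X -> X -> X -> R) : \bar R :=
  (supnorm u + ereal_sup [set opnorm1 (D1 x) | x in [set: X]]
   + ereal_sup [set opnorm2 (D2 x) | x in [set: X]] + holder_bilin alpha D2)%E.

Definition OU (t : R) (f : X -> R) (x : X) : R :=
  Rintegral gamma [set: borelX]
    (fun y : borelX => f (expR (- t) *: x + Num.sqrt (1 - expR (- (2 * t))) *: y)).

Definition OU_resolvent (lambda : R) (f : X -> R) (x : X) : R :=
  Rintegral (@lebesgue_measure R) `[0%R, +oo[%classic
    (fun t : R => expR (- (lambda * t)) * OU t f x).

End Defs.

(* Main.v *)
Require Import Defs.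
From HB Require Import structures.
From mathcomp Require Import all_boot all_order all_algebra.
From mathcomp Require Import all_classical all_reals all_analysis.
From mathcomp Require Import measurable_realfun.
From mathcomp Require Import ring lra.
Set Implicit Arguments. Unset Strict Implicit. Unset Printing Implicit Defensive.
Import Order.TTheory GRing.Theory Num.Theory.
Import numFieldNormedType.Exports.
Local Open Scope classical_set_scope.
Local Open Scope ring_scope.

(** By a Cameron-Martin factorization, [gamma] is the law of [Psi y + a k] with [k] a unit vector
    of [H] and [a] an independent standard Gaussian, so that moving [x] by [h] in
    [OU t f x = int f(e^{-t} x + s y) gamma(dy)], [s = sqrt(1 - e^{-2t})], amounts to translating a
    one-dimensional Gaussian by [c |h|_H] with [c = e^{-t} / s].  The explicit density gives a
    first-order expansion of [OU t f] along [H], and the semigroup law gives a second-order one;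
    if [f] is alpha-Holder along [H], subtracting a constant from [f] gains a factor [s^alpha].
    Hence [D_H OU(t) f] and [D_H^2 OU(t) f] are of size [t^{(alpha-1)/2}] and [t^{alpha/2-1}], both
    integrable at 0, and the derivatives of the resolvent are obtained under the integral sign.  The
    Holder bound on the second one comes from integrating the minimum of the two estimates
    [t^{alpha/2-1}] and [t^{alpha/2-3/2} |g|_H] of the increment of [D_H^2 OU(t) f] along [g],
    which yields [|g|_H^alpha]. *)

(** * Laws are determined by characteristic functions *)

(** Two obstacles shape the proof. The function [f] is merely continuous on [X], with Holder control
    along [H] only, so no uniform argument in [X] is available: continuity of the derivatives in
    operator norm rests on a mean-square modulus which does not depend on the direction and tends to
    0, at each time, by dominated convergence. And the quadratic Taylor remainders cost a factor
    [1/t] or worse, not integrable at 0; they are interpolated with Lipschitz bounds to an exponent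
    strictly between 1 and 2, small enough for the time integral to converge and large enough for
    differentiability. Moreover the Gaussian variable of the factorization is an almost everywhere
    limit of functionals, so the map [Psi] is known to be measurable only through functionals; laws
    are therefore compared by characteristic functions, and separability extends the comparison to
    bounded continuous integrands. *)

Section HahnBanach.
Context {R : realType} {X : completeNormedModType R}.

(** A partial functional is encoded by its graph, so that extension is inclusion and Zorn's lemma
    applies. Domination makes the relation single-valued: the difference of two values at one point
    is at most [|0|], in either order. *)
Definition dominated_graph (G : set (X * R)) : Prop :=
  (forall a p q, G p -> G q -> G (a *: p.1 + q.1, a * p.2 + q.2)) /\
  (forall p, G p -> p.2 <= `|p.1|).

(** The Hahn-Banach step: the triangle inequality puts every [q.2 - |q.1 - v|] below every
    [|q'.1 + v| - q'.2], so the supremum [c] of the former lies between them; dividing by [|t|]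
    reduces a general point to these two inequalities. *)
Lemma dominated_graph_ext (G : set (X * R)) (v : X) : G (0, 0) ->
  dominated_graph G ->
  exists c, dominated_graph
    [set p | exists t q, G q /\ p = (q.1 + t *: v, q.2 + t * c)].
Proof.
move=> G0 [Glin Gdom].
pose E := [set r | exists q, G q /\ r = q.2 - `|q.1 - v|].
have Eub q' : G q' -> ubound E (`|q'.1 + v| - q'.2).
  move=> Gq' _ [q [Gq ->]]; rewrite lerBlDr addrAC lerBrDr.
  have := Gdom _ (Glin 1 _ _ Gq Gq') => /=; rewrite scale1r mul1r => /le_trans; apply.
  have -> : q.1 + q'.1 = (q'.1 + v) + (q.1 - v) by rewrite addrACA subrr addr0 addrC.
  exact: ler_normD.
have E0 : E !=set0 by exists (0 - `|0 - v|), (0, 0).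
have Ehs : has_sup E by split=> //; exists (`|0 + v| - 0); exact: (Eub (0, 0)).
pose c := sup E.
have c1 q : G q -> q.2 - `|q.1 - v| <= c.
  by move=> Gq; apply: ub_le_sup; [case: Ehs|exists q].
have c2 q : G q -> c <= `|q.1 + v| - q.2 by move=> Gq; apply: ge_sup => //; exact: Eub.
have Gs a q : G q -> G (a *: q.1, a * q.2).
  by move=> Gq; have := Glin a _ _ Gq G0; rewrite /= !addr0.
exists c; split=> [a _ _ [t [q [Gq ->]]] [t' [q' [Gq' ->]]] | _ [t [q [Gq ->]]]] /=.
  exists (a * t + t'), (a *: q.1 + q'.1, a * q.2 + q'.2); split; first exact: Glin.
  congr (_, _) => /=; last by ring.
  by rewrite scalerDr scalerDl scalerA addrACA.
have [t0|t0|->] := ltgtP t 0; last by rewrite scale0r mul0r !addr0; exact: Gdom.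
  have := c1 _ (Gs (- t^-1) _ Gq) => /=.
  have -> : - t^-1 *: q.1 - v = (- t^-1) *: (q.1 + t *: v).
    by rewrite scalerDr scalerA mulNr mulVf ?lt_eqF// scaleN1r.
  rewrite normrZ normrN normfV ltr0_norm// => h.
  have : (- t) * (- t^-1 * q.2 - (- t)^-1 * `|q.1 + t *: v|) <= (- t) * c.
    by rewrite ler_wpM2l// oppr_ge0 ltW.
  rewrite mulrBr !mulrA mulrNN divff ?lt_eqF// divff ?oppr_eq0 ?lt_eqF// !mul1r.
  by rewrite lerBlDr mulNr -lerBlDl opprK.
have := c2 _ (Gs (t^-1) _ Gq) => /=.
have -> : t^-1 *: q.1 + v = (t^-1) *: (q.1 + t *: v).
  by rewrite scalerDr scalerA mulVf ?gt_eqF// scale1r.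
rewrite normrZ normfV gtr0_norm// => h.
have : t * c <= t * (t^-1 * `|q.1 + t *: v| - t^-1 * q.2) by rewrite ler_wpM2l// ltW.
by rewrite mulrBr !mulrA divff ?gt_eqF// !mul1r lerBrDl.
Qed.

Lemma hahn_banach_norming (x0 : X) :
  exists l : X -> R, [/\ is_clf l, l x0 = `|x0| & forall x, `|l x| <= `|x|].
Proof.
pose L0 := [set p : X * R | exists t, p = (t *: x0, t * `|x0|)].
have dL0 : dominated_graph L0.
  split=> [a _ _ [t ->] [t' ->]|_ [t ->]] /=.
    by exists (a * t + t'); rewrite scalerDl scalerA mulrDl mulrA.
  by rewrite normrZ ler_wpM2r// ler_norm.
(* Joining [L0] to every candidate, instead of demanding inclusion, keeps the empty union of the
   empty chain admissible. *)
have [F FP Ftot|A [QA Amax]] :=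
    @Zorn_bigcup _ [set A | dominated_graph (L0 `|` A)].
  have [->|/set0P[X0 FX0]] := eqVneq F set0; first by rewrite bigcup_set0 /= setU0.
  have cov p : (L0 `|` \bigcup_(Y in F) Y) p -> exists2 Y, F Y & (L0 `|` Y) p.
    by case=> [Lp|[Y FY Yp]]; [exists X0 => //; left|exists Y => //; right].
  have up Y : F Y -> L0 `|` Y `<=` L0 `|` \bigcup_(Y in F) Y.
    by move=> FY; apply: setUS; exact: bigcup_sup.
  split=> [a p q /cov[Y FY Yp] /cov[Z FZ Zq]|p /cov[Y FY Yp]].
    have [YZ|ZY] := Ftot _ _ FY FZ.
      by apply: (up _ FZ); apply: (proj1 (FP _ FZ)) => //; case: Yp => [?|/YZ ?]; [left|right].
    by apply: (up _ FY); apply: (proj1 (FP _ FY)) => //; case: Zq => [?|/ZY ?]; [left|right].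
  exact: (proj2 (FP _ FY)).
set G := L0 `|` A in QA.
have G0 : G (0, 0) by left; exists 0; rewrite scale0r mul0r.
have total v : exists r, G (v, r).
  apply: contrapT => nv.
  have [c dc] := dominated_graph_ext v G0 QA.
  set G' := [set p | _] in dc.
  have GG' : G `<=` G'.
    by move=> q Gq; exists 0, q; split=> //; rewrite scale0r mul0r !addr0; case: (q).
  apply: (Amax G').
    split=> [q Aq|]; first by apply: GG'; right.
    move/(_ (v, c)) => h; apply: nv; exists c; right; apply: h.
    by exists 1, (0, 0); split=> //; rewrite scale1r mul1r !add0r.
  by rewrite /= (setUidr _)// => p L0p; apply: GG'; left.
have [Glin Gdom] := QA.
have Guniq v r r' : G (v, r) -> G (v, r') -> r = r'.
  move=> h h'; have := Gdom _ (Glin (-1) _ _ h h').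
  have := Gdom _ (Glin (-1) _ _ h' h); rewrite /= !scaleN1r !mulN1r !addNr normr0; lra.
pose l v := projT1 (cid (total v)).
have Gl v : G (v, l v) by rewrite /l; case: cid.
have llin a x y : l (a *: x + y) = a * l x + l y.
  by apply: (@Guniq (a *: x + y)); [exact: Gl|exact: (Glin a _ _ (Gl x) (Gl y))].
have lb x : `|l x| <= `|x|.
  rewrite ler_norml (Gdom _ (Gl x)) andbT lerNl.
  have := Gdom _ (Glin (-1) _ _ (Gl x) G0); rewrite /= !addr0 scaleN1r mulN1r normrN.
  by [].
exists l; split=> //; last first.
  by apply: (@Guniq x0); [exact: Gl|left; exists 1; rewrite scale1r mul1r].
split=> // x; apply/cvgrPdist_le => e e0; near=> y.
have -> : l x - l y = l (x - y).
  by have := llin (-1) y x; rewrite scaleN1r mulN1r addrC [RHS]addrC => ->.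
apply: le_trans (lb _) _; near: y; exact: cvgr_dist_le.
Unshelve. all: by end_near. Qed.

End HahnBanach.

(** * Bounded functions generated by characters *)

Section TrigClosure.
Context {R : realType} {X : completeNormedModType R}.

Lemma clf_lin (a : R) (l m : X -> R) : is_clf l -> is_clf m ->
  is_clf (fun x => a * l x + m x).
Proof.
move=> [l1 l2] [m1 m2]; split=> [b x y|x]; first by rewrite l1 m1; ring.
by apply: cvgD; [apply: cvgM; [exact: cvg_cst|exact: l2]|exact: m2].
Qed.

Lemma clf_0 : is_clf (fun _ : X => 0 : R).
Proof. by split=> [a x y|x]; [rewrite mulr0 addr0|exact: cvg_cst]. Qed.

Lemma clf_scale (a : R) (l : X -> R) : is_clf l -> is_clf (fun x => a * l x).
Proof.
move=> hl; have := clf_lin a hl clf_0.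
by congr is_clf; apply/funext => x; rewrite addr0.
Qed.

Lemma clf_add (l m : X -> R) : is_clf l -> is_clf m -> is_clf (fun x => l x + m x).
Proof.
move=> hl hm; have := clf_lin 1 hl hm.
by congr is_clf; apply/funext => x; rewrite mul1r.
Qed.

Lemma clf_sub (l m : X -> R) : is_clf l -> is_clf m -> is_clf (fun x => l x - m x).
Proof.
move=> hl hm; have := clf_lin (-1) hm hl.
by congr is_clf; apply/funext => x; rewrite mulN1r addrC.
Qed.

Lemma clfD (l : X -> R) x y : is_clf l -> l (x + y) = l x + l y.
Proof. by move=> [h _]; have := h 1 x y; rewrite scale1r mul1r. Qed.

Lemma clf0 (l : X -> R) : is_clf l -> l 0 = 0.
Proof. by move=> hl; have := clfD 0 0 hl; rewrite addr0; lra. Qed.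

Lemma clfZ (l : X -> R) a x : is_clf l -> l (a *: x) = a * l x.
Proof. by move=> hl; have := hl.1 a x 0; rewrite clf0// !addr0. Qed.

Lemma clfN (l : X -> R) x : is_clf l -> l (- x) = - l x.
Proof. by move=> hl; rewrite -scaleN1r clfZ// mulN1r. Qed.

Lemma clfB (l : X -> R) x y : is_clf l -> l (x - y) = l x - l y.
Proof. by move=> hl; rewrite clfD// clfN. Qed.

(** The closure of the characters under linear combinations and bounded pointwise limits; on a
    separable space it contains every bounded continuous function, so that two laws with the same
    characteristic function integrate these alike. *)
Inductive trigcl : (X -> R) -> Prop :=
| trigcl_cos l c : is_clf l -> trigcl (fun x => cos (l x + c))
| trigcl_lin a f g : trigcl f -> trigcl g -> trigcl (fun x => a * f x + g x)
| trigcl_lim (F : nat -> X -> R) f M : (forall n, trigcl (F n)) ->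
    (forall n x, `|F n x| <= M) -> (forall x, F n x @[n --> \oo] --> f x) -> trigcl f.

Lemma trigcl_ext f g : f =1 g -> trigcl f -> trigcl g.
Proof. by move=> /funext ->. Qed.

Lemma trigcl_bounded f : trigcl f -> exists M, forall x, `|f x| <= M.
Proof.
elim=> [l c hl|a {}f g _ [M hM] _ [N hN]|F {}f M _ _ FM Ff].
- by exists 1 => x; rewrite ler_norml cos_geN1 cos_le1.
- exists (`|a| * M + N) => x; apply: le_trans (ler_normD _ _) _.
  by rewrite normrM lerD// ler_wpM2l.
- exists M => x; apply: cvgr_to_le (cvg_norm (Ff x)) _.
  by apply: nearW => n; exact: FM.
Qed.

Lemma trigcl_cst (a : R) : trigcl (fun=> a).
Proof.
have z : trigcl (fun=> 0).
  by have := trigcl_cos (pi / 2) clf_0; under eq_fun do rewrite add0r cos_pihalf.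
apply: trigcl_ext (trigcl_lin a (trigcl_cos 0 clf_0) z) => x.
by rewrite !addr0 cos0 mulr1.
Qed.

Lemma trigcl_scale a f : trigcl f -> trigcl (fun x => a * f x).
Proof.
by move=> hf; have := trigcl_lin a hf (trigcl_cst 0); under eq_fun do rewrite addr0.
Qed.

Lemma trigcl_sub f g : trigcl f -> trigcl g -> trigcl (fun x => f x - g x).
Proof.
move=> hf hg; have := trigcl_lin (-1) hg hf.
by under eq_fun do rewrite mulN1r addrC.
Qed.

(** The product-to-sum formula settles two cosines; the nested inductions carry it to combinations
    and limits, where boundedness of the other factor supplies the uniform bound. *)
Lemma trigcl_mul f g : trigcl f -> trigcl g -> trigcl (fun x => f x * g x).
Proof.
move=> hf; elim: hf g => [l c hl|a {}f f' _ IH _ IH'|F {}f M tF IH FM Ff] g hg.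
- elim: hg => [m d hm|a {}g g' _ IH _ IH'|G {}g M tG IH GM Gg].
  + apply: trigcl_ext (trigcl_scale (2^-1) (trigcl_lin 1 (trigcl_cos (c + d) (clf_add hl hm))
      (trigcl_cos (c - d) (clf_sub hl hm)))) => x.
    rewrite (_ : l x + m x + (c + d) = (l x + c) + (m x + d)); last by ring.
    rewrite (_ : l x - m x + (c - d) = (l x + c) - (m x + d)); last by ring.
    by rewrite cosD cosB; field.
  + by apply: trigcl_ext (trigcl_lin a IH IH') => x; ring.
  + apply: (trigcl_lim IH (M := M)) => [n x|x]; last by apply: cvgM; [exact: cvg_cst|].
    rewrite normrM -[M]mul1r ler_pM//.
    by rewrite ler_norml cos_geN1 cos_le1.
- by apply: trigcl_ext (trigcl_lin a (IH _ hg) (IH' _ hg)) => x; ring.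
- have [N hN] := trigcl_bounded hg.
  apply: (trigcl_lim (fun n => IH n _ hg) (M := M * N)) => [n x|x].
    by rewrite normrM ler_pM.
  by apply: cvgM; [exact: Ff|exact: cvg_cst].
Qed.

(** A polynomial whose iterates converge pointwise to the sign on [-1, 1]: it turns trigonometric
    polynomials into indicators of half-spaces. *)
Definition sgn_step (z : R) := (3 * z - z ^+ 3) / 2.

(** The factorization [1 - p(y) = (1 - y) (1 - (y + y^2)/2)] drives it: the iterates stay above [z],
    so each step contracts the distance to 1 by at least [1 - z/2]. *)
Lemma iter_sgn_step_pos (z : R) n : 0 < z <= 1 ->
  let y := iter n sgn_step z in (z <= y <= 1) /\ 1 - y <= (1 - z / 2) ^+ n.
Proof.
move=> /andP[z0 z1] /=; elim: n => [|n [/andP[zy y1] IH]].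
  by rewrite /= lexx z1 expr0; split=> //; rewrite gerBl ltW.
set y := iter n _ z in zy y1 IH *; rewrite iterS -/y.
have e : 1 - sgn_step y = (1 - y) * (1 - (y + y ^+ 2) / 2).
  by rewrite /sgn_step; field.
have y0 : 0 < y by exact: lt_le_trans zy.
have h : 0 <= 1 - (y + y ^+ 2) / 2.
  have : y ^+ 2 <= 1 by rewrite expr_le1// ltW.
  by lra.
have h' : 1 - (y + y ^+ 2) / 2 <= 1 - z / 2.
  by rewrite lerD2l lerN2 ler_wpM2r// (le_trans zy)// lerDl sqr_ge0.
split.
  rewrite -subr_ge0 -[sgn_step y <= 1]subr_ge0 e (_ : _ - z = y * (1 - y) * (1 + y) / 2 + (y - z)).
    apply/andP; split; last by rewrite mulr_ge0// subr_ge0.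
    by rewrite addr_ge0 ?subr_ge0// !mulr_ge0 ?subr_ge0 ?addr_ge0 ?invr_ge0 ?(ltW y0).
  by rewrite /sgn_step; field.
by rewrite e [leRHS]exprSr mulrC [leRHS]mulrC ler_pM// subr_ge0.
Qed.

Lemma iter_sgn_stepN (z : R) n : iter n sgn_step (- z) = - iter n sgn_step z.
Proof. by elim: n => // n IH; rewrite !iterS IH /sgn_step; field. Qed.

Lemma iter_sgn_step0 n : iter n sgn_step 0 = 0.
Proof. by elim: n => // n IH; rewrite !iterS IH /sgn_step; field. Qed.

Lemma iter_sgn_step_le1 (z : R) n : `|z| <= 1 -> `|iter n sgn_step z| <= 1.
Proof.
move=> z1; have [z0|z0|->] := ltgtP z 0; last by rewrite iter_sgn_step0 normr0.
  rewrite -normrN -iter_sgn_stepN.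
  have [|/andP[h h'] _] := @iter_sgn_step_pos (- z) n.
    by rewrite oppr_gt0 z0 -(ltr0_norm z0).
  by rewrite ger0_norm// (le_trans _ h)// oppr_ge0 ltW.
have [|/andP[h h'] _] := @iter_sgn_step_pos z n.
  by rewrite z0 -(gtr0_norm z0).
by rewrite ger0_norm// (le_trans _ h)// ltW.
Qed.

Lemma cvg_iter_sgn_step (z : R) : `|z| <= 1 ->
  iter n sgn_step z @[n --> \oo] --> Num.sg z.
Proof.
have pos (x : R) : 0 < x -> x <= 1 -> iter n sgn_step x @[n --> \oo] --> (1 : R).
  move=> x0 x1.
  have h n := @iter_sgn_step_pos x n (introT andP (conj x0 x1)).
  have c : 1 - (1 - x / 2) ^+ n @[n --> \oo] --> (1 : R).
    rewrite -[X in _ --> X]subr0; apply: cvgB; first exact: cvg_cst.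
    by apply: cvg_expr; rewrite ger0_norm; lra.
  apply: (squeeze_cvgr _ c (cvg_cst (1 : R))).
  by apply: nearW => n; case: (h n) => /andP[_ ->] h'; rewrite andbT; lra.
move=> z1; have [z0|z0|->] := ltgtP z 0.
- rewrite ltr0_sg// (_ : (fun n => _) = fun n => - iter n sgn_step (- z)); last first.
    by apply/funext => n; rewrite iter_sgn_stepN opprK.
  by apply: cvgN; apply: pos; rewrite ?oppr_gt0// -(ltr0_norm z0).
- by rewrite gtr0_sg//; apply: pos => //; rewrite -(gtr0_norm z0).
- by rewrite sgr0; under eq_fun do rewrite iter_sgn_step0; exact: cvg_cst.
Qed.

(** The sign iteration needs an argument in [-1, 1], and [l x - a] is unbounded. Its sine after
    division by [n.+1] is bounded and has the right sign as soon as [|l x - a| / n.+1 < pi], so a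
    second limit in [n] finishes. *)
Lemma trigcl_sg_clf (l : X -> R) (a : R) : is_clf l -> trigcl (fun x => Num.sg (l x - a)).
Proof.
move=> hl; pose s n x := sin ((l x - a) / n.+1%:R).
have ts n : trigcl (s n).
  apply: trigcl_ext (trigcl_cos (- (a / n.+1%:R) - pi / 2) (clf_scale (n.+1%:R^-1) hl)) => x.
  by rewrite addrA cosBpihalf /s; congr sin; ring.
have s1 n x : `|s n x| <= 1 by rewrite ler_norml sin_geN1 sin_le1.
have ti n m : trigcl (fun x => iter m sgn_step (s n x)).
  elim: m => [|m IH] //; first exact: ts.
  by apply: trigcl_ext (trigcl_lin (3 / 2) IH (trigcl_scale (- 2^-1) (trigcl_mul IH (trigcl_mul IH IH)))) => x; rewrite iterS /sgn_step; field.
have tg n : trigcl (fun x => Num.sg (s n x)).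
  apply: (trigcl_lim (ti n) (M := 1)) => [m x|x]; first exact: iter_sgn_step_le1.
  exact: cvg_iter_sgn_step.
apply: (trigcl_lim tg (M := 1)) => [n x|x].
  by rewrite normr_sg; case: (_ != _).
apply: cvg_near_cst; have pi0 := pi_gt0 R; near=> n.
set t := l x - a; set N := n.+1%:R : R.
have N0 : 0 < N by [].
have tN : `|t| / N < pi.
  rewrite ltr_pdivrMr// -ltr_pdivrMl// (@lt_trans _ _ n%:R)//; last by rewrite ltr_nat.
  by near: n; exact: nbhs_infty_gtr.
rewrite /s -/t -/N; have [t0|t0|t0] := ltgtP t 0.
- rewrite (ltr0_sg t0) ltr0_sg// -oppr_gt0 -sinN; apply: sin_gt0_pi.
  by rewrite -mulNr -(ltr0_norm t0) tN andbT divr_gt0// normr_gt0 lt_eqF.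
- rewrite (gtr0_sg t0) gtr0_sg//; apply: sin_gt0_pi.
  by rewrite -[t](gtr0_norm t0) tN andbT divr_gt0// normr_gt0 gt_eqF.
- by rewrite t0 mul0r sin0.
Unshelve. all: by end_near. Qed.

Definition trigset : set (set X) := [set A | trigcl (\1_A)].

Lemma trigset_gt (l : X -> R) (a : R) : is_clf l -> trigset [set x | a < l x].
Proof.
move=> hl; have ts := trigcl_sg_clf a hl.
(* For [s] in {-1, 0, 1}, [(s^2 + s) / 2] is 1 exactly when [s = 1]. *)
apply: trigcl_ext (trigcl_scale (2^-1) (trigcl_lin 1 (trigcl_mul ts ts) ts)) => x.
have -> : \1_[set y | a < l y] x = ((0 < l x - a)%R)%:R :> R.
  rewrite indicE subr_gt0; have [h|h] := boolP (a < l x); first by rewrite mem_set.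
  by rewrite memNset//; exact/negP.
have [h|h|<-] := ltgtP 0 (l x - a).
- by rewrite gtr0_sg// (_ : true%:R = 1 :> R)//; lra.
- by rewrite ltr0_sg// (_ : false%:R = 0 :> R)//; lra.
- by rewrite sgr0 (_ : false%:R = 0 :> R)//; lra.
Qed.

(** Closure under products gives finite intersections of complements; at each point the partial
    products are eventually constant, and they are bounded by 1, so their limit is admissible. *)
Lemma trigset_sigma_algebra : sigma_algebra setT trigset.
Proof.
have tC A : trigset A -> trigset (~` A).
  move=> tA; apply: trigcl_ext (trigcl_sub (trigcl_cst 1) tA) => x.
  by rewrite indicC indicE; case: (_ \in _) => /=; lra.
split.
- by rewrite /trigset /= indic0; exact: trigcl_cst.
- by move=> A /tC; rewrite setTD.
- move=> A tA; pose B n x : R := \prod_(k < n) (1 - \1_(A k) x).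
  have tB n : trigcl (B n).
    elim: n => [|n IH].
      apply: trigcl_ext (trigcl_cst 1) => x.
      by rewrite /B big_ord0.
    by apply: trigcl_ext (trigcl_mul IH (trigcl_sub (trigcl_cst 1) (tA n))) => x; rewrite /B big_ord_recr.
  suff h : trigcl (\1_(~` (\bigcup_k A k))) by have := tC _ h; rewrite setCK.
  apply: (trigcl_lim tB (M := 1)) => [n x|x].
    rewrite /B normr_prod; apply: prodr_ile1 => k _; rewrite normr_ge0 /= indicE.
    by case: (_ \in _); rewrite ?subrr ?normr0 ?subr0 ?normr1.
  apply: cvg_near_cst; have [[k _ Akx]|nA] := pselect ((\bigcup_k A k) x).
    exists k.+1 => // n /= kn; rewrite indicE memNset; last by move=> /(_ (ex_intro2 _ _ k I Akx)).
    rewrite /B (bigD1 (Ordinal kn))//= indicE mem_set// subrr mul0r //.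
  exists 0 => // n _; rewrite indicE mem_set//= /B big1// => i _.
  by rewrite indicE memNset ?subr0// => Aix; apply: nA; exists i.
Qed.

End TrigClosure.

(** * Open sets and continuous functions on a separable space *)

Section Separable.
Context {R : realType} {X : completeNormedModType R}.
Hypothesis hsep : @separable R X.

Lemma dense_sequence : exists e : nat -> X, forall x (r : R), 0 < r -> exists n, `|e n - x| < r.
Proof.
have [D [/countable_injP[f finj] clD]] := hsep.
(* Indices not hit by [f] receive the harmless default 0. *)
pose e n := xget (0 : X) [set d | D d /\ f d = n].
exists e => x r r0.
have : closure D x by rewrite clD.
move=> /(_ (ball x r) (nbhsx_ballx x r r0))[d [Dd]]; rewrite -ball_normE /= => xd.
exists (f d); suff -> : e (f d) = d by rewrite distrC.
rewrite /e; case: xgetP => [y _ [Dy fy]|/(_ d)]; last by case.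
by apply: finj; rewrite ?inE.
Qed.

(** Norming functionals at a dense sequence present each closed ball as a countable intersection of
    half-spaces, and an open set is a countable union of closed balls with centres [e n] and radii
    [m.+1%:R^-1]. *)
Lemma open_trigset (U : set X) : open U -> trigset U.
Proof.
move=> oU; have [e he] := dense_sequence.
have [s0 sD sU] := @trigset_sigma_algebra R X.
have sC (A : set X) : trigset A -> trigset (~` A) by move=> /sD; rewrite setTD.
have sI (A : nat -> set X) : (forall n, trigset (A n)) -> trigset (\bigcap_n A n).
  by move=> h; rewrite -[X in trigset X]setCK setC_bigcap; apply/sC/sU => n; exact/sC.
pose lf n := projT1 (cid (hahn_banach_norming (e n))).
have lfP n : [/\ is_clf (lf n), lf n (e n) = `|e n| & forall x, `|lf n x| <= `|x|].
  by rewrite /lf; case: cid.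
have tball (d : X) (r : R) : trigset [set x | `|x - d| <= r].
  have -> : [set x | `|x - d| <= r] = \bigcap_n ~` [set x | r + lf n d < lf n x].
    apply/seteqP; split=> [x /= xdr n _|x /= h].
      apply/negP; rewrite -leNgt -lerBlDr -clfB; last by case: (lfP n).
      by apply: le_trans xdr; apply: le_trans (ler_norm _) _; case: (lfP n).
    apply/ler_addgt0Pr => t t0.
    (* With [e n] within [t / 2] of [x - d], the functional norming [e n] almost norms [x - d]: one
       [t / 2] is lost on the norm, the other on the functional. *)
    have [n hn] := he (x - d) (t / 2) (divr_gt0 t0 (ltr0Sn _ 1)).
    have [ln1 ln2 ln3] := lfP n.
    have /negP := h n Logic.I; rewrite -leNgt -lerBlDr -clfB// => h1.
    have h2 : `|lf n (e n - (x - d))| <= t / 2 by rewrite (le_trans (ln3 _))// ltW.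
    have h3 : `|x - d| <= `|e n| + `|e n - (x - d)|.
      by rewrite -[X in `|X| <= _](subKr (e n)) ler_normB.
    rewrite clfB// ln2 in h2; move: h2; rewrite ler_norml => /andP[_ h2].
    by have := ltW hn; lra.
  by apply: sI => n; apply/sC/trigset_gt; case: (lfP n).
pose F n := if pselect ([set x | `|x - e n.1| <= n.2.+1%:R^-1] `<=` U)
  then [set x | `|x - e n.1| <= n.2.+1%:R^-1] else set0 : set X.
have tF n : trigset (F n) by rewrite /F; case: pselect => h; [exact: tball|exact: s0].
have -> : U = \bigcup_n \bigcup_m F (n, m).
  apply/seteqP; split=> [x Ux|x [n _ [m _]]]; last by rewrite /F; case: pselect => // h /h.
  have [r /= r0 hr] := (nbhs_ballP x U).1 (open_nbhs_nbhs (conj oU Ux)).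
  have r20 : 0 < r / 2 by rewrite divr_gt0.
  have [m _ /(_ m (leqnn m)) hm] := near_infty_natSinv_lt (PosNum r20).
  have {}hm : m.+1%:R^-1 < r / 2 by exact: hm.
  have m0 : 0 < m.+1%:R^-1 :> R by rewrite invr_gt0.
  have [n hn] := he x _ m0.
  exists n => //; exists m => //; rewrite /F; case: pselect => /= [_|[]].
    by rewrite distrC ltW.
  move=> y /= yen; apply: hr; rewrite -ball_normE /=.
  have := ler_distD (e n) x y; rewrite [`|e n - y|]distrC [`|x - e n|]distrC.
  move/le_lt_trans; apply; rewrite [r]splitr ltrD//; first exact: lt_trans hn hm.
  exact: le_lt_trans yen hm.
by apply: (sU) => n; apply: (sU) => m.
Qed.

(** The sum counts the integers [1 <= j < y], of which there are [ceil y - 1] when [y > 0]; it is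
    the staircase of the layer-cake approximation below. *)
Lemma sum_lt_nat (y : R) n : 0 <= y <= n%:R ->
  y - 1 <= \sum_(k < n) ((k.+1%:R < y)%R)%:R <= y.
Proof.
elim: n y => [|n IH] y /andP[y0 yn].
  by rewrite big_ord0; apply/andP; split => //; lra.
have -> : \sum_(k < n.+1) ((k.+1%:R < y)%R)%:R = \sum_(k < n) ((k.+1%:R < y)%R)%:R :> R.
  by rewrite big_ord_recr /= [(_ < y)%R]ltNge yn addr0.
have [yn'|ny] := lerP y n%:R; first by apply: IH; rewrite y0.
rewrite (eq_bigr (fun=> 1)) => [|k _]; last first.
  by rewrite (le_lt_trans _ ny)// ler_nat.
rewrite sumr_const card_ord -mulr_natr mul1r (ltW ny) andbT.
by rewrite lerBlDr -natr1 in yn *.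
Qed.

(** After rescaling to [0, 1], the average of the indicators of [n.+1] superlevel sets, which are
    open, approximates the function uniformly within [n.+1%:R^-1]. *)
Lemma continuous_trigcl (f : X -> R) (M : R) : continuous f -> (forall x, `|f x| <= M) ->
  trigcl f.
Proof.
move=> cf fM.
have M0 : 0 <= M by apply: le_trans (fM 0).
(* The [+ 1] keeps the divisor positive when [M = 0]. *)
pose c := 2 * M + 1; have c0 : 0 < c by rewrite /c; lra.
pose g x := (f x + M) / c.
have g01 x : 0 <= g x <= 1.
  have := fM x; rewrite ler_norml => /andP[h1 h2].
  rewrite /g divr_ge0 ?(ltW c0) ?ler_pdivrMr ?mul1r//=; rewrite /c; lra.
have cg : continuous g.
  by move=> x; apply: cvgM; [apply: cvgD; [exact: cf|exact: cvg_cst]|exact: cvg_cst].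
have tg : trigcl g.
  pose G n x : R := n.+1%:R^-1 * \sum_(k < n.+1) ((k.+1%:R < n.+1%:R * g x)%R)%:R.
  have Gg n x : `|g x - G n x| <= n.+1%:R^-1.
    have n0 : 0 < n.+1%:R :> R by [].
    have h : 0 <= n.+1%:R * g x <= n.+1%:R.
      have /andP[h1 h2] := g01 x; rewrite mulr_ge0//=.
      by rewrite -[leRHS]mulr1 ler_wpM2l.
    have /andP[s1 s2] := sum_lt_nat h.
    rewrite /G; set S := \sum_(k < _) _ in s1 s2 *.
    have -> : g x - n.+1%:R^-1 * S = n.+1%:R^-1 * (n.+1%:R * g x - S).
      by rewrite mulrBr mulrA mulVf ?gt_eqF// mul1r.
    rewrite normrM ger0_norm ?invr_ge0// -[leRHS]mulr1 ler_wpM2l ?invr_ge0//.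
    by rewrite ger0_norm; lra.
  apply: (@trigcl_lim _ _ G _ 2) => [n|n x|x].
  - apply: trigcl_scale.
    have tk k : trigcl (fun x => ((k.+1%:R < n.+1%:R * g x)%R)%:R : R).
      have : trigset [set x | k.+1%:R < n.+1%:R * g x].
        apply: open_trigset; apply: (@open_comp _ _ (fun x => n.+1%:R * g x) [set y | k.+1%:R < y]).
          by move=> x _; apply: cvgM; [exact: cvg_cst|exact: cg].
        exact: open_gt.
      rewrite /trigset /=; apply: trigcl_ext => x; rewrite indicE.
      have [h|h] := boolP (k.+1%:R < n.+1%:R * g x); first by rewrite mem_set.
      by rewrite memNset//; exact/negP.
    have ts m : trigcl (fun x => \sum_(k < m) ((k.+1%:R < n.+1%:R * g x)%R)%:R : R).
      elim: m => [|m IH]; first by apply: trigcl_ext (trigcl_cst 0) => x; rewrite big_ord0.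
      by apply: trigcl_ext (trigcl_lin 1 IH (tk m)) => x; rewrite big_ord_recr mul1r.
    exact: ts.
  - have h : n.+1%:R^-1 <= 1 :> R by rewrite invf_le1// ler1n.
    have := le_trans (Gg n x) h; rewrite !ler_norml => /andP[h1 h2].
    have /andP[h3 h4] := g01 x; apply/andP; split; lra.
  - apply/cvgrPdist_le => e e0; near=> n; apply: le_trans (Gg n x) _; apply/ltW.
    by near: n; exact: (near_infty_natSinv_lt (PosNum e0)).
apply: trigcl_ext (trigcl_lin c tg (trigcl_cst (- M))) => x.
by rewrite /g mulrC divfK ?gt_eqF// addrK.
Unshelve. all: by end_near. Qed.

End Separable.

(** * From characteristic functions to bounded continuous integrands *)

Section Law.
Context {R : realType} {X : completeNormedModType R}.

Lemma continuous_borel_measurable (f : X -> R) : continuous f ->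
  measurable_fun [set: @borelX R X] (f : @borelX R X -> R).
Proof.
move=> cf; apply: (measurability _ (RGenOInfty.measurableE R)) => _ [_ [a ->]] <-.
rewrite setTI; apply: sub_sigma_algebra.
rewrite (_ : `]a, +oo[%classic = [set y | a < y]); last first.
  by apply/seteqP; split=> y /=; rewrite in_itv/= andbT.
by apply: (@open_comp X R f); [move=> x _; exact: cf|exact: open_gt].
Qed.

Lemma bounded_integrable d (T : measurableType d) (P : probability T R) (f : T -> R) M :
  measurable_fun setT f -> (forall x, `|f x| <= M) -> P.-integrable setT (EFin \o f).
Proof.
move=> mf fM; apply: (@le_integrable _ _ _ P _ measurableT _ (EFin \o cst M)).
- exact/measurable_EFinP.
- by move=> x _ /=; rewrite lee_fin (le_trans (fM x))// ler_norm.
- exact: finite_measure_integrable_cst.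
Qed.

Lemma Rintegral_prob_cst d (T : measurableType d) (P : probability T R) (c : R) :
  \int[P]_x c = c.
Proof.
transitivity (c * fine (P setT)); first exact: Rintegral_cst.
by rewrite probability_setT mulr1.
Qed.

Lemma integrable_addR d (T : measurableType d) (mu : {measure set T -> \bar R})
  (D : set T) (f g : T -> R) : measurable D -> mu.-integrable D (EFin \o f) ->
  mu.-integrable D (EFin \o g) -> mu.-integrable D (EFin \o (fun x => f x + g x)).
Proof. by move=> mD fi gi; exact: (integrableD mD fi gi). Qed.

Lemma integrable_subR d (T : measurableType d) (mu : {measure set T -> \bar R})
  (D : set T) (f g : T -> R) : measurable D -> mu.-integrable D (EFin \o f) ->
  mu.-integrable D (EFin \o g) -> mu.-integrable D (EFin \o (fun x => f x - g x)).
Proof. by move=> mD fi gi; exact: (integrableB mD fi gi). Qed.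

Lemma integrable_mulR d (T : measurableType d) (mu : {measure set T -> \bar R})
  (D : set T) (k : R) (f : T -> R) : measurable D -> mu.-integrable D (EFin \o f) ->
  mu.-integrable D (EFin \o (fun x => k * f x)).
Proof. by move=> mD fi; exact: (integrableZl mD k fi). Qed.

Lemma Rintegral_dominated_cvg d (T : measurableType d) (mu : {measure set T -> \bar R})
  (D : set T) (F : nat -> T -> R) (f g : T -> R) : measurable D ->
  (forall n, measurable_fun D (F n)) -> measurable_fun D f ->
  {ae mu, forall x, D x -> F n x @[n --> \oo] --> f x} ->
  (forall n x, D x -> `|F n x| <= g x) -> mu.-integrable D (EFin \o g) ->
  mu.-integrable D (EFin \o f) /\
  \int[mu]_(x in D) F n x @[n --> \oo] --> \int[mu]_(x in D) f x.
Proof.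
move=> mD mF mf Ff Fg ig.
have := @dominated_convergence _ _ _ mu D mD (fun n => EFin \o F n) (EFin \o f) (EFin \o g).
case=> //.
- by move=> n; exact/measurable_EFinP.
- exact/measurable_EFinP.
- by apply: filterS Ff => x h Dx; apply/cvg_EFin; [exact: nearW|exact: h].
- by apply: aeW => x n Dx /=; rewrite lee_fin; exact: Fg.
move=> fi _ c; split=> //.
by apply: fine_cvg; rewrite fineK//; apply: integrable_fin_num.
Qed.

Lemma bounded_Rintegral_cvg d (T : measurableType d) (P : probability T R)
  (F : nat -> T -> R) (f : T -> R) (M : R) :
  (forall n, measurable_fun setT (F n)) -> (forall n x, `|F n x| <= M) ->
  (forall x, F n x @[n --> \oo] --> f x) ->
  measurable_fun setT f /\ \int[P]_x F n x @[n --> \oo] --> \int[P]_x f x.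
Proof.
move=> mF FM Ff.
have mf : measurable_fun setT f by apply: (measurable_fun_cvg mF) => x _; exact: Ff.
split=> //; have [] := @Rintegral_dominated_cvg _ _ P setT F f (cst M) measurableT mF mf => //.
- by apply: aeW => x _; exact: Ff.
- exact: finite_measure_integrable_cst.
Qed.

(** Only the scalar functions [l (Phi w)] are assumed measurable, since on a product sigma-algebra
    the sum of two vectors is not given as a measurable map; measurability of [f (Phi w)] is
    therefore carried through the induction together with the equality, which passes to limits by
    bounded convergence. *)
Lemma trigcl_law d (T : measurableType d) (P : probability T R)
  (g : probability (@borelX R X) R) (Phi : T -> X) :
  (forall l, is_clf l -> measurable_fun setT (fun w => l (Phi w))) ->
  (forall l c, is_clf l ->
    \int[P]_w cos (l (Phi w) + c) = \int[g]_(x in [set: borelX]) cos (l x + c)) ->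
  forall f : X -> R, trigcl f -> [/\ measurable_fun setT (fun w => f (Phi w)),
    measurable_fun setT (f : borelX -> R) &
    \int[P]_w f (Phi w) = \int[g]_(x in [set: borelX]) f x].
Proof.
move=> mPhi cPhi f; elim=> [l c hl|a {}f f' tf [m1 m2 e] tf' [m1' m2' e']|F {}f M tF IH FM Ff].
- have mc : measurable_fun setT (fun y : R => cos (y + c)).
    apply: continuous_measurable_fun => y; apply: continuous_comp; last exact: continuous_cos.
    by apply: cvgD; [exact: cvg_id|exact: cvg_cst].
  split; last exact: cPhi.
    exact: measurableT_comp mc (mPhi _ hl).
  by apply: (measurableT_comp mc); apply: continuous_borel_measurable; case: hl.
- have [M hM] := trigcl_bounded tf; have [N hN] := trigcl_bounded tf'.
  have i1 := bounded_integrable P m1 (fun w => hM (Phi w)).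
  have i1' := bounded_integrable P m1' (fun w => hN (Phi w)).
  have i2 := bounded_integrable g m2 hM.
  have i2' := bounded_integrable g m2' hN.
  split; [by apply: measurable_funD => //; exact: measurable_funM..|].
  rewrite RintegralD//; last exact: (integrableZl measurableT a i1).
  rewrite RintegralZl// e e' RintegralD//; last exact: (integrableZl measurableT a i2).
  by rewrite RintegralZl.
- have m1 n : measurable_fun setT (fun w => F n (Phi w)) by case: (IH n).
  have m2 n : measurable_fun setT (F n : borelX -> R) by case: (IH n).
  have [n1 c1] := bounded_Rintegral_cvg P m1 (fun n w => FM n (Phi w)) (fun w => Ff (Phi w)).
  have [n2 c2] := bounded_Rintegral_cvg g m2 FM Ff.
  split=> //; apply: (cvg_unique (@Rhausdorff R) c1).
  by rewrite (_ : (fun n => _) = fun n => \int[g]_(x in [set: borelX]) F n x)//;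
    apply/funext => n; case: (IH n).
Qed.

Lemma continuous_law d (T : measurableType d) (P : probability T R)
  (g : probability (@borelX R X) R) (Phi : T -> X) (f : X -> R) (M : R) :
  @separable R X ->
  (forall l, is_clf l -> measurable_fun setT (fun w => l (Phi w))) ->
  (forall l c, is_clf l ->
    \int[P]_w cos (l (Phi w) + c) = \int[g]_(x in [set: borelX]) cos (l x + c)) ->
  continuous f -> (forall x, `|f x| <= M) ->
  measurable_fun setT (fun w => f (Phi w)) /\
  \int[P]_w f (Phi w) = \int[g]_(x in [set: borelX]) f x.
Proof.
move=> hsep mPhi cPhi cf fM.
by have [] := trigcl_law mPhi cPhi (continuous_trigcl hsep cf fM).
Qed.

(** The measurability half of [trigcl_law], for a map such as the factor [Psi], whose law is never
    identified. *)
Lemma trigcl_measurable d (T : measurableType d) (Phi : T -> X) (f : X -> R) :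
  (forall l, is_clf l -> measurable_fun setT (fun w => l (Phi w))) -> trigcl f ->
  measurable_fun setT (fun w => f (Phi w)).
Proof.
move=> mPhi; elim=> [l c hl|a {}f f' _ m1 _ m2|F {}f M tF IH FM Ff].
- apply: (@measurableT_comp _ _ _ _ _ _ (fun y : R => cos (y + c))); last exact: mPhi.
  apply: continuous_measurable_fun => y; apply: continuous_comp; last exact: continuous_cos.
  by apply: cvgD; [exact: cvg_id|exact: cvg_cst].
- by apply: measurable_funD => //; exact: measurable_funM.
- by apply: (measurable_fun_cvg IH) => w _; exact: Ff.
Qed.

End Law.

(** * One-dimensional Gaussian translations *)

Section RealCalculus.
Context {R : realType}.
Implicit Types (x y : R).

Lemma mvt_abs (f f' : R -> R) x y : (forall z : R, is_derive z (1 : R) f (f' z)) ->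
  exists c, `|c - x| <= `|y - x| /\ f y - f x = f' c * (y - x).
Proof.
move=> df; have cf : continuous f.
  by move=> z; apply/differentiable_continuous/derivable1_diffP; exact: @ex_derive.
have [xy|yx] := leP x y.
  have [c] := MVT_segment xy (fun z _ => df z) (continuous_subspaceT cf).
  rewrite in_itv/= => /andP[xc cy] e; exists c; split=> //.
  by rewrite !ger0_norm ?subr_ge0// lerD2r.
have [c] := MVT_segment (ltW yx) (fun z _ => df z) (continuous_subspaceT cf).
rewrite in_itv/= => /andP[xc cy] e; exists c; split.
  by rewrite [`|c - x|]distrC [`|y - x|]distrC !ger0_norm ?subr_ge0// ?lerD2l ?lerN2// ltW.
by rewrite -opprB e -mulrN opprB.
Qed.

Lemma derive0_cst (f : R -> R) : (forall z : R, is_derive z (1 : R) f 0) -> forall x y, f x = f y.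
Proof.
move=> df x y; have [c [_ /eqP]] := mvt_abs (f' := fun=> 0) y x df.
by rewrite mul0r subr_eq0 => /eqP.
Qed.

Lemma sin_lipschitz x y : `|sin y - sin x| <= `|y - x|.
Proof.
have [c [_ ->]] := mvt_abs x y (@is_derive_sin R).
rewrite normrM -[leRHS]mul1r ler_wpM2r//.
by rewrite ler_norml cos_geN1 cos_le1.
Qed.

(** The remainder has derivative [sin t - sin (t + z)] in [z], at most [|z|]; a single mean value
    step gives the non-optimal constant 1, which suffices. *)
Lemma cos_taylor1 (t d : R) : `|cos (t + d) - cos t + d * sin t| <= d ^+ 2.
Proof.
pose f z := cos (t + z) - cos t + z * sin t.
have df (z : R) : is_derive z (1 : R) f (sin t - sin (t + z)).
  rewrite /f; apply: is_derive_eq.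
  by rewrite /GRing.scale /=; ring.
have [c [h]] := mvt_abs 0 d df.
rewrite /f addr0 subrr mul0r addr0 !subr0 => ->; rewrite normrM -real_normK ?num_real// expr2.
rewrite ler_wpM2r//; rewrite !subr0 in h; apply: le_trans h.
by apply: le_trans (sin_lipschitz _ _) _; rewrite opprD addNKr normrN.
Qed.

Lemma cos_sub1_le (d : R) : `|cos d - 1| <= d ^+ 2.
Proof. by have := cos_taylor1 0 d; rewrite add0r cos0 sin0 mulr0 addr0. Qed.

Lemma sin_sub_le (d : R) : `|sin d - d| <= d ^+ 2.
Proof.
have := cos_taylor1 (- (pi / 2)) d.
by rewrite [- _ + d]addrC cosBpihalf cosN cos_pihalf sinN sin_pihalf subr0 mulrN1.
Qed.

(** Everything comes from [1 + u <= exp u]: taken at [- u] it gives [exp u * (1 - u) <= 1], that is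
    [exp u - 1 - u <= u * (exp u - 1)]. *)
Lemma expR_taylor1 (u : R) : `|expR u - 1 - u| <= u ^+ 2 * expR `|u|.
Proof.
have h1 := expR_ge1Dx u; have h2 := expR_ge1Dx (- u).
have h3 : expR u * (1 - u) <= 1.
  by rewrite -[leRHS](expRxMexpNx_1 u) ler_wpM2l// expR_ge0.
rewrite ger0_norm; last by lra.
apply: (@le_trans _ _ (u * (expR u - 1))).
  by rewrite mulrBr mulr1; lra.
apply: le_trans (ler_norm _) _; rewrite normrM -real_normK ?num_real// expr2 -mulrA.
rewrite ler_wpM2l//; have [u0|u0] := leP 0 u.
  rewrite (ger0_norm u0) ger0_norm; last by rewrite subr_ge0 -expR0 ler_expR.
  by rewrite mulrC; lra.
rewrite ler0_norm; last by rewrite subr_le0 -expR0 ler_expR ltW.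
have : 1 <= expR `|u| by rewrite -expR0 ler_expR.
rewrite (ltr0_norm u0) => h.
have : (- u) * 1 <= - u * expR (- u) by rewrite ler_wpM2l// oppr_ge0 ltW.
by lra.
Qed.

(** Turns a second-order expansion under Gaussian translation into an exact identity: mean, variance
    and Stein's formula are obtained in this way. *)
Lemma eq0_of_le_sqr (z C : R) : (forall a, 0 < a <= 1 -> `|a * z| <= C * a ^+ 2) -> z = 0.
Proof.
move=> h; apply/eqP; rewrite -normr_eq0 eq_le normr_ge0 andbT.
apply/ler_addgt0Pr => e e0; rewrite add0r.
have C0 : 0 <= C.
  have := h 1; rewrite ltr01 lexx expr1n mulr1 => /(_ isT); exact: le_trans.
pose a := Num.min 1 (e / (C + 1)).
have Cp : 0 < C + 1 by rewrite ltr_wpDl.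
have a0 : 0 < a by rewrite lt_min ltr01 divr_gt0.
have a1 : a <= 1 by rewrite ge_min lexx.
have ae : a * (C + 1) <= e by rewrite -ler_pdivlMr// ge_min lexx orbT.
have := h a; rewrite a0 a1 => /(_ isT); rewrite normrM gtr0_norm// expr2 mulrCA ler_pM2l//.
by move/le_trans; apply; apply: le_trans ae; rewrite mulrC ler_pM2l// lerDl.
Qed.

Lemma is_derive_of_sqr (f : R -> R) (x L C : R) :
  (forall e, `|e| <= 1 -> `|f (x + e) - f x - e * L| <= C * e ^+ 2) -> is_derive x (1 : R) f L.
Proof.
move=> h.
have C0 : 0 <= C.
  have := h 1; rewrite normr1 lexx expr1n mulr1 => /(_ isT); exact: le_trans.
have c : h0^-1 *: (f (h0 *: 1 + x) - f x) @[h0 --> 0^'] --> L.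
  apply/cvgrPdist_le => e e0.
  have Cp : 0 < C + 1 by rewrite ltr_wpDl.
  near=> t.
  have t0 : t != 0 by near: t; exact: nbhs_dnbhs_neq.
  have t1 : `|t| <= 1.
    by near: t; apply: dnbhs0_le.
  have te : `|t| <= e / (C + 1).
    by near: t; apply: dnbhs0_le; rewrite divr_gt0.
  rewrite /GRing.scale /= mulr1 [t + x]addrC distrC.
  have -> : t^-1 * (f (x + t) - f x) - L = t^-1 * (f (x + t) - f x - t * L) by field.
  rewrite normrM normfV ler_pdivrMl ?normr_gt0//.
  apply: le_trans (h t t1) _; rewrite -real_normK ?num_real// expr2 mulrCA ler_wpM2l//.
  rewrite ler_pdivlMr// in te; apply: le_trans te; rewrite mulrC ler_wpM2l// lerDl//.
split; first by apply/cvg_ex; exists L.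
by rewrite /derive; apply/cvg_lim.
Unshelve. all: by end_near. Qed.

End RealCalculus.

Lemma measurable_comp_expR {R : realType} d (T : measurableType d) (f : T -> R) :
  measurable_fun setT f -> measurable_fun setT (fun x => expR (f x)).
Proof. exact: (measurableT_comp (@measurable_expR R)). Qed.

(** * The standard Gaussian measure on the line *)

Section Normal.
Context {R : realType}.
Notation mu := (@lebesgue_measure R).
Definition stdn : probability (measurableTypeR R) R := @normal_prob R 0 1.
Notation nu := stdn.
Notation phi := (@normal_pdf R 0 1).
Implicit Types (x : R).

Lemma stdn_pdfE x : phi x = normal_peak 1 * expR (- x ^+ 2 / 2).
Proof. by rewrite normal_pdfE ?oner_eq0// /normal_fun subr0 expr1n. Qed.

Lemma continuous_gauss_shift (a : R) : continuous (fun x => expR (a * x - a ^+ 2 / 2)).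
Proof.
move=> x; apply: continuous_comp; last exact: continuous_expR.
by apply: cvgD; [apply: cvgM; [exact: cvg_cst|exact: cvg_id]|exact: cvg_cst].
Qed.

(** The Radon-Nikodym derivative and the explicit density integrate to the same value on each
    measurable set, hence agree almost everywhere. *)
Lemma ge0_integral_stdn (f : R -> \bar R) : measurable_fun setT f ->
  (forall x, 0 <= f x)%E -> (\int[nu]_x f x = \int[mu]_x (f x * (phi x)%:E))%E.
Proof.
move=> mf f0; have dom := normal_prob_dominates 0 (1 : R).
rewrite -(Radon_Nikodym_SigmaFinite.change_of_variables dom f0 measurableT mf).
have mphi : measurable_fun setT (EFin \o phi).
  by apply/measurable_EFinP; exact: measurable_normal_pdf.
have fi := Radon_Nikodym_SigmaFinite.f_integrable dom.
apply: ae_eq_integral => //.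
- by apply: emeasurable_funM => //; exact: measurable_int fi.
- exact: emeasurable_funM.
- apply: ae_eqe_mul2l; apply: integral_ae_eq => // E _ mE.
  by rewrite -Radon_Nikodym_SigmaFinite.f_integral.
Qed.

Lemma lebesgue_shift (c : R) (G : R -> R) : continuous G -> (forall x, 0 <= G x) ->
  (\int[mu]_x (G x)%:E = \int[mu]_x (G (x + c))%:E)%E.
Proof.
move=> cG G0.
have d1 x : is_derive x (1 : R) (fun y : R => y + c) 1.
  by apply: is_derive_eq; rewrite addr0.
have F1 : (fun y : R => y + c)^`()%classic = cst 1.
  by apply/funext => x; rewrite derive1E; apply: derive_val.
rewrite (@increasing_ge0_integration_by_substitutionT _ (fun y => y + c) G)//.
- by apply: eq_integral => x _; rewrite F1 /= mulr1.
- by move=> x y xy; rewrite ltrD2r.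
- by rewrite F1 => x; exact: cvg_cst.
- by rewrite F1; apply/cvg_ex; exists 1; exact: cvg_cst.
- by rewrite F1; apply/cvg_ex; exists 1; exact: cvg_cst.
- exact: cvg_addrr_Ny.
- exact: cvg_addrr.
Qed.

(** The Cameron-Martin formula in dimension one, from [phi x = phi (x + a) * exp (a (x + a) - a^2 /
    2)] and translation invariance of Lebesgue measure. *)
Lemma stdn_shift_ge0 (a : R) (G : R -> R) : continuous G -> (forall x, 0 <= G x) ->
  (\int[nu]_x (G (x + a))%:E = \int[nu]_x (G x * expR (a * x - a ^+ 2 / 2))%:E)%E.
Proof.
move=> cG G0.
have cphi : continuous phi by apply: continuous_normal_pdf; rewrite oner_eq0.
have cE := @continuous_gauss_shift a.
have cS (H : R -> R) b : continuous H -> continuous (fun x => H (x + b)).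
  move=> cH x; apply: (@continuous_comp _ _ _ (fun y => y + b)); last exact: cH.
  by apply: cvgD; [exact: cvg_id|exact: cvg_cst].
have mc (H : R -> R) : continuous H -> measurable_fun setT (fun x => (H x)%:E).
  by move=> cH; apply/measurable_EFinP; exact: continuous_measurable_fun.
rewrite ge0_integral_stdn; [|exact: (mc _ (cS _ a cG))|by move=> x; rewrite lee_fin].
rewrite ge0_integral_stdn; last 2 first.
- by apply: mc => x; apply: cvgM; [exact: cG|exact: cE].
- by move=> x; rewrite lee_fin mulr_ge0// expR_ge0.
rewrite (@lebesgue_shift a (fun x => G x * expR (a * x - a ^+ 2 / 2) * phi x)); last 2 first.
- move=> x; apply: cvgM; last exact: cphi.
  by apply: cvgM; [exact: cG|exact: cE].
- by move=> x; rewrite !mulr_ge0 ?expR_ge0// normal_pdf_ge0.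
apply: eq_integral => x _; rewrite -EFinM -mulrA; congr (_ * _)%:E.
rewrite !stdn_pdfE mulrCA -expRD; congr (_ * expR _); by field.
Qed.

Lemma stdn_setT : nu [set: R] = 1%E.
Proof. exact: probability_setT. Qed.

(** The shift formula for the constant 1 is already the moment generating function, so no Gaussian
    integral has to be computed. *)
Lemma integral_expR_stdn (b : R) : (\int[nu]_x (expR (b * x))%:E = (expR (b ^+ 2 / 2))%:E)%E.
Proof.
have c1 : continuous (fun _ : R => 1 : R) by move=> x; exact: cvg_cst.
have h := @stdn_shift_ge0 b _ c1 (fun=> ler01).
have n1 : (\int[nu]_x 1 = 1)%E by rewrite integral_cst// mul1e; exact: stdn_setT.
have mE : measurable_fun setT (fun x : R => (1 * expR (b * x - b ^+ 2 / 2))%:E).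
  apply/measurable_EFinP; apply: measurable_funM => //.
  exact: (continuous_measurable_fun (@continuous_gauss_shift b)).
transitivity (\int[nu]_x ((expR (b ^+ 2 / 2))%:E * (1 * expR (b * x - b ^+ 2 / 2))%:E))%E.
  by apply: eq_integral => x _; rewrite -EFinM mul1r -expRD; congr (expR _)%:E; ring.
rewrite ge0_integralZl ?lee_fin ?expR_ge0// -h n1 mule1//.
Qed.

Lemma stdn_integrable (f : R -> R) (M k : R) : measurable_fun setT f ->
  (forall x, `|f x| <= M * expR (k * `|x|)) -> nu.-integrable setT (EFin \o f).
Proof.
move=> mf fM.
have iE b : nu.-integrable setT (EFin \o (fun x => expR (b * x))).
  apply/integrableP; split.
    apply/measurable_EFinP; apply: measurable_comp_expR.
    by apply: measurable_funM.
  have -> : (\int[nu]_x `|(EFin \o (fun x => expR (b * x))) x| = \int[nu]_x (expR (b * x))%:E)%E.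
    by apply: eq_integral => x _; rewrite /= ger0_norm// expR_ge0.
  by rewrite integral_expR_stdn ltry.
have M0 : 0 <= M.
  have := fM 0; rewrite normr0 mulr0 expR0 mulr1; exact: le_trans.
have := integrableZl measurableT M (integrableD measurableT (iE k) (iE (- k))).
apply: le_integrable => //; first exact/measurable_EFinP.
move=> x _; change ((`|f x|)%:E <= (`|M * (expR (k * x) + expR (- k * x))|)%:E)%E; rewrite lee_fin.
rewrite [leRHS]ger0_norm; last by rewrite mulr_ge0// addr_ge0// expR_ge0.
apply: le_trans (fM x) _; rewrite ler_wpM2l//.
have [x0|x0] := leP 0 x; first by rewrite ger0_norm// lerDl expR_ge0.
by rewrite ltr0_norm// mulrN mulNr lerDr expR_ge0.
Qed.

Lemma stdn_shift (a : R) (g : R -> R) (M : R) : continuous g ->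
  (forall x, `|g x| <= M * expR `|x|) ->
  \int[nu]_x g (x + a) = \int[nu]_x (g x * expR (a * x - a ^+ 2 / 2)).
Proof.
move=> cg gM.
have M0 : 0 <= M.
  have := gM 0; rewrite normr0 expR0 mulr1; exact: le_trans.
(* The shift formula is known for nonnegative functions; it is applied to [g + w] and to [w], and
   subtracted. *)
pose w x : R := M * expR `|x|.
have cw : continuous w.
  move=> x; apply: cvgM; first exact: cvg_cst.
  by apply: continuous_comp; [exact: norm_continuous|exact: continuous_expR].
have cgw : continuous (fun x => g x + w x) by move=> x; apply: cvgD; [exact: cg|exact: cw].
have w0 x : 0 <= w x by rewrite mulr_ge0// expR_ge0.
have gw0 x : 0 <= g x + w x.
  by have := gM x; rewrite ler_norml -/(w x) => /andP[h _]; lra.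
have e1 := congr1 fine (stdn_shift_ge0 a cgw gw0).
have e2 := congr1 fine (stdn_shift_ge0 a cw w0).
rewrite -!/(Rintegral _ _ _) in e1 e2.
have mE := continuous_measurable_fun (@continuous_gauss_shift a).
have bE x : expR (a * x - a ^+ 2 / 2) <= expR (`|a| * `|x|).
  rewrite ler_expR -normrM; apply: le_trans (ler_norm (a * x)).
  by rewrite gerBl divr_ge0// sqr_ge0.
have mS (H : R -> R) : continuous H -> measurable_fun setT (fun x => H (x + a)).
  move=> cH; apply: (measurableT_comp (continuous_measurable_fun cH)).
  exact: measurable_funD.
have i1 (H : R -> R) : continuous H -> (forall x, `|H x| <= w x) ->
    nu.-integrable setT (EFin \o (fun x => H (x + a))).
  move=> cH Hw; apply: (@stdn_integrable _ (M * expR `|a|) 1); first exact: mS.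
  move=> x; apply: le_trans (Hw _) _; rewrite /w -mulrA ler_wpM2l// -expRD ler_expR mul1r.
  by rewrite addrC ler_normD.
have i2 (H : R -> R) : continuous H -> (forall x, `|H x| <= w x) ->
    nu.-integrable setT (EFin \o (fun x => H x * expR (a * x - a ^+ 2 / 2))).
  move=> cH Hw; apply: (@stdn_integrable _ M (1 + `|a|)).
    by apply: measurable_funM => //; exact: continuous_measurable_fun.
  move=> x; rewrite normrM [X in _ * X]ger0_norm ?expR_ge0//.
  rewrite (_ : expR ((1 + `|a|) * `|x|) = expR `|x| * expR (`|a| * `|x|)); last first.
    by rewrite mulrDl expRD mul1r.
  rewrite mulrA.
  by rewrite ler_pM ?expR_ge0// Hw.
have ww x : `|w x| <= w x by rewrite ger0_norm.
rewrite (_ : (fun x => (g x + w x) * _) = fun x => g x * expR (a * x - a ^+ 2 / 2) +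
   w x * expR (a * x - a ^+ 2 / 2)) in e1; last by apply/funext => x; rewrite mulrDl.
by move: e1; rewrite !RintegralD ?e2//; [exact: addIr|exact: i2..|exact: i1|exact: i1].
Qed.

(** For [u = a x - a^2 / 2] one has [|u| <= |a| (|x| + 1)]. The square of [|x| + 1 <= exp |x|]
    contributes [2 |x|] to the exponent and [exp |u|] contributes [|x| + 1]. *)
Lemma gauss_density_taylor (a x : R) : `|a| <= 1 ->
  `|expR (a * x - a ^+ 2 / 2) - 1 - a * x| <= a ^+ 2 * (2 * expR (3 * `|x| + 1)).
Proof.
move=> a1; set u := a * x - a ^+ 2 / 2.
have ua : `|u| <= `|a| * (`|x| + 1).
  rewrite mulrDr mulr1; apply: le_trans (ler_normB _ _) _; rewrite normrM lerD2l.
  rewrite ger0_norm ?divr_ge0 ?sqr_ge0// -real_normK ?num_real//.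
  have : `|a| ^+ 2 <= `|a| by rewrite expr2 -[leRHS]mulr1 ler_wpM2l.
  by have := normr_ge0 a; lra.
have x1 : `|u| <= `|x| + 1 by apply: le_trans ua _; rewrite ler_piMl// addr_ge0.
have E1 : 1 <= expR (3 * `|x| + 1).
  by rewrite -expR0 ler_expR addr_ge0// mulr_ge0.
have h1 : u ^+ 2 * expR `|u| <= a ^+ 2 * expR (3 * `|x| + 1).
  have -> : 3 * `|x| + 1 = `|x| + `|x| + (`|x| + 1) by ring.
  rewrite expRD mulrA ler_pM ?sqr_ge0 ?expR_ge0 ?ler_expR//.
  apply: (@le_trans _ _ ((`|a| * (`|x| + 1)) ^+ 2)).
    by rewrite -(real_normK (num_real u)) ler_sqr ?nnegrE ?mulr_ge0 ?addr_ge0.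
  rewrite exprMn real_normK ?num_real// ler_wpM2l ?sqr_ge0// expRD expr2.
  by rewrite ler_pM ?addr_ge0// addrC expR_ge1Dx.
have -> : expR u - 1 - a * x = (expR u - 1 - u) - a ^+ 2 / 2 by rewrite /u; ring.
apply: le_trans (ler_normB _ _) _.
have h2 := le_trans (expR_taylor1 u) h1.
have h3 : `|a ^+ 2 / 2| <= a ^+ 2 * expR (3 * `|x| + 1).
  rewrite ger0_norm ?divr_ge0 ?sqr_ge0// ler_wpM2l ?sqr_ge0//; lra.
by have := lerD h2 h3; lra.
Qed.

(** The remainder of the density [exp (a x - a^2/2)] contributes [3|x| + 1] to the exponent, the
    growth allowed for [g] in [stdn_taylor_growth] another [|x|]. *)
Definition gauss_C : R := \int[nu]_x (2 * expR (4 * `|x| + 1)).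

(** Exponential growth is allowed because the expansion is also applied to [g = id], from which the
    variance is read off. *)
Lemma stdn_taylor_growth (g : R -> R) (M a : R) : continuous g ->
  (forall x, `|g x| <= M * expR `|x|) -> `|a| <= 1 ->
  `|\int[nu]_x g (x + a) - \int[nu]_x g x - a * \int[nu]_x (g x * x)|
    <= M * gauss_C * a ^+ 2.
Proof.
move=> cg gM a1.
have M0 : 0 <= M.
  have := gM 0; rewrite normr0 expR0 mulr1; exact: le_trans.
have mg := continuous_measurable_fun cg.
have mE := continuous_measurable_fun (@continuous_gauss_shift a).
have ig : nu.-integrable setT (EFin \o g).
  by apply: (@stdn_integrable _ M 1) => // x; rewrite mul1r.
have x1 x : `|x| <= expR `|x|.
  by apply: le_trans (expR_ge1Dx _); rewrite lerDr.
have igx : nu.-integrable setT (EFin \o (fun x => g x * x)).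
  apply: (@stdn_integrable _ M 2); first exact: measurable_funM.
  move=> x; rewrite normrM (_ : 2 * `|x| = `|x| + `|x|); last by ring.
  by rewrite expRD mulrA ler_pM.
have igE : nu.-integrable setT (EFin \o (fun x => g x * expR (a * x - a ^+ 2 / 2))).
  apply: (@stdn_integrable _ M (1 + `|a|)); first exact: measurable_funM.
  move=> x; rewrite normrM [X in _ * X]ger0_norm ?expR_ge0//.
  rewrite (_ : expR ((1 + `|a|) * `|x|) = expR `|x| * expR (`|a| * `|x|)); last first.
    by rewrite mulrDl expRD mul1r.
  rewrite mulrA.
  rewrite ler_pM ?expR_ge0// ler_expR -normrM; apply: le_trans (ler_norm (a * x)).
  by rewrite gerBl divr_ge0// sqr_ge0.
have mC : measurable_fun setT (fun x : R => 2 * expR (4 * `|x| + 1)).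
  apply: measurable_funM => //; apply: measurable_comp_expR.
  apply: measurable_funD => //; apply: measurable_funM => //.
have iC : nu.-integrable setT (EFin \o (fun x => 2 * expR (4 * `|x| + 1))).
  apply: (@stdn_integrable _ (2 * expR 1) 4) => // x.
  by rewrite ger0_norm ?mulr_ge0 ?expR_ge0// -mulrA -expRD addrC.
rewrite (stdn_shift a cg gM) -RintegralZl// -!RintegralB//; last 2 first.
- exact: (integrableB measurableT igE ig).
- exact: (integrableZl measurableT a igx).
have -> : M * gauss_C * a ^+ 2 = \int[nu]_x (M * a ^+ 2 * (2 * expR (4 * `|x| + 1))).
  by rewrite RintegralZl// -/gauss_C; ring.
have ii := integrable_subR measurableT (integrable_subR measurableT igE ig)
  (integrable_mulR a measurableT igx).
apply: le_trans (le_normr_Rintegral measurableT ii) _.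
apply: le_Rintegral => //.
- exact: integrable_norm ii.
- exact: (integrableZl measurableT (M * a ^+ 2) iC).
move=> x _.
have -> : g x * expR (a * x - a ^+ 2 / 2) - g x - a * (g x * x) =
  g x * (expR (a * x - a ^+ 2 / 2) - 1 - a * x) by ring.
rewrite normrM; apply: le_trans (ler_pM (normr_ge0 _) (normr_ge0 _) (gM x) (gauss_density_taylor x a1)) _.
rewrite (_ : 4 * `|x| + 1 = `|x| + (3 * `|x| + 1)); last by ring.
by rewrite [expR (`|x| + _)]expRD le_eqVlt; apply/orP; left; apply/eqP; ring.
Qed.

Lemma integrable_stdn_bounded (g : R -> R) M : measurable_fun setT g ->
  (forall x, `|g x| <= M) -> nu.-integrable setT (EFin \o g).
Proof. by move=> mg gM; exact: (bounded_integrable nu mg gM). Qed.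

Lemma le_id_expR x : `|x| <= expR `|x|.
Proof. by apply: le_trans (expR_ge1Dx _); rewrite lerDr. Qed.

Lemma integrable_stdn_boundedM (g : R -> R) M : measurable_fun setT g ->
  (forall x, `|g x| <= M) -> nu.-integrable setT (EFin \o (fun x => g x * x)).
Proof.
move=> mg gM; apply: (@stdn_integrable _ M 1); first exact: measurable_funM.
by move=> x; rewrite normrM mul1r ler_pM// le_id_expR.
Qed.

Lemma integrable_stdn_sqr : nu.-integrable setT (EFin \o (fun x => x * x)).
Proof.
apply: (@stdn_integrable _ 1 2); first exact: measurable_funM.
move=> x; rewrite normrM mul1r (_ : 2 * `|x| = `|x| + `|x|); last by ring.
by rewrite expRD ler_pM// le_id_expR.
Qed.

Lemma integrable_stdn_id : nu.-integrable setT (EFin \o (fun x => x)).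
Proof.
by apply: (@stdn_integrable _ 1 1) => // x; rewrite !mul1r le_id_expR.
Qed.

Lemma Rintegral_stdn_cst (c : R) : \int[nu]_x c = c.
Proof.
transitivity (c * fine (nu setT)); first exact: Rintegral_cst.
by rewrite stdn_setT mulr1.
Qed.

(** The first two moments follow from the translation expansion. For [g = 1] the translation changes
    nothing, so [a] times the mean is [O(a^2)]; for [g = id] it changes the integral by exactly [a],
    so [a] times [1 - \int x^2] is [O(a^2)]. *)
Lemma stdn_mean : \int[nu]_x x = 0.
Proof.
apply: (@eq0_of_le_sqr _ _ gauss_C) => a /andP[a0 a1].
have c1 : continuous (fun _ : R => 1 : R) by move=> x; exact: cvg_cst.
have := @stdn_taylor_growth _ 1 a c1; rewrite !Rintegral_stdn_cst subrr sub0r normrN mul1r.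
rewrite (_ : (fun x => 1 * x) = id); last by apply/funext => x; rewrite mul1r.
apply; last by rewrite ger0_norm// ltW.
by move=> x; rewrite normr1 mul1r -expR0 ler_expR.
Qed.

Lemma stdn_var : \int[nu]_x (x * x) = 1.
Proof.
apply/eqP; rewrite eq_sym -subr_eq0; apply/eqP.
apply: (@eq0_of_le_sqr _ _ gauss_C) => a /andP[a0 a1].
have E : \int[nu]_x (x + a) = a.
  rewrite RintegralD//; first by rewrite stdn_mean Rintegral_stdn_cst add0r.
    exact: integrable_stdn_id.
  exact: finite_measure_integrable_cst.
have := @stdn_taylor_growth id 1 a (fun x => cvg_id).
rewrite /= E stdn_mean subr0 mulrBr mulr1 mul1r; apply.
  by move=> x; rewrite mul1r le_id_expR.
by rewrite ger0_norm// ltW.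
Qed.

(** Bessel's inequality for the unit vector [x] of [L^2(nu)]: expand the integral of
    [(g x - t * x)^2], with [t] the inner product. *)
Lemma stdn_cauchy (g : R -> R) M : measurable_fun setT g -> (forall x, `|g x| <= M) ->
  (\int[nu]_x (g x * x)) ^+ 2 <= \int[nu]_x (g x ^+ 2).
Proof.
move=> mg gM; set t := \int[nu]_x (g x * x).
have i1 : nu.-integrable setT (EFin \o (fun x => g x ^+ 2)).
  apply: (@integrable_stdn_bounded _ (M ^+ 2)); first exact: measurable_funX.
  by move=> x; rewrite normrX lerXn2r ?nnegrE// (le_trans _ (gM x)).
have i2 := integrable_stdn_boundedM mg gM.
have i3 := integrable_stdn_sqr.
have : 0 <= \int[nu]_x (g x ^+ 2 + (- (2 * t) * (g x * x) + t ^+ 2 * (x * x))).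
  apply: Rintegral_ge0 => x _.
  have -> : g x ^+ 2 + (- (2 * t) * (g x * x) + t ^+ 2 * (x * x)) = (g x - t * x) ^+ 2 by ring.
  exact: sqr_ge0.
have i2' := integrableZl measurableT (- (2 * t)) i2.
have i3' := integrableZl measurableT (t ^+ 2) i3.
rewrite RintegralD//; last exact: (integrableD measurableT i2' i3').
rewrite RintegralD// !RintegralZl// stdn_var -/t mulr1; lra.
Qed.

Lemma stdn_abs_moment : \int[nu]_x `|x| <= 1.
Proof.
have i1 : nu.-integrable setT (EFin \o (fun x : R => `|x|)) by exact: integrable_norm integrable_stdn_id.
have i3 := integrable_stdn_sqr.
have i0 : nu.-integrable setT (EFin \o cst (2^-1)) by exact: finite_measure_integrable_cst.
have i3' := integrableZl measurableT (2^-1) i3.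
have := @le_Rintegral _ _ _ nu setT (fun x => `|x|) (fun x => 2^-1 + 2^-1 * (x * x)) measurableT i1.
rewrite RintegralD// RintegralZl// stdn_var Rintegral_stdn_cst.
rewrite (_ : 2^-1 + 2^-1 * 1 = 1); last by field.
apply; first exact: (integrableD measurableT i0 i3').
move=> x _; have : 0 <= (`|x| - 1) ^+ 2 by exact: sqr_ge0.
have : `|x| * `|x| = x * x by rewrite -normrM ger0_norm// -expr2 sqr_ge0.
by move=> <-; lra.
Qed.

Lemma gauss_C_ge0 : 0 <= gauss_C.
Proof. by apply: Rintegral_ge0 => x _; rewrite mulr_ge0// expR_ge0. Qed.

(** For [|a| > 1] each of the three terms on the left is at most [M * a^2] in absolute value, whence
    the summand 3. *)
Lemma stdn_taylor (g : R -> R) (M a : R) : continuous g -> (forall x, `|g x| <= M) ->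
  `|\int[nu]_x g (x + a) - \int[nu]_x g x - a * \int[nu]_x (g x * x)|
    <= (gauss_C + 3) * M * a ^+ 2.
Proof.
move=> cg gM.
have M0 : 0 <= M by apply: le_trans (gM 0).
have gC := gauss_C_ge0.
have [a1|a1] := leP `|a| 1.
  apply: (@le_trans _ _ (M * gauss_C * a ^+ 2)).
    apply: stdn_taylor_growth => // x; apply: le_trans (gM x) _.
    by rewrite ler_peMr// -expR0 ler_expR.
  rewrite ler_wpM2r ?sqr_ge0// mulrC ler_wpM2r//; lra.
have mg := continuous_measurable_fun cg.
have ib (h : R -> R) : measurable_fun setT h -> (forall x, `|h x| <= M) -> `|\int[nu]_x h x| <= M.
  move=> mh hM; have ih := integrable_stdn_bounded mh hM.
  apply: le_trans (le_normr_Rintegral measurableT ih) _.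
  rewrite -[leRHS]Rintegral_stdn_cst; apply: le_Rintegral => //.
  - exact: integrable_norm ih.
  - exact: finite_measure_integrable_cst.
have h1 : `|\int[nu]_x g (x + a)| <= M.
  apply: ib => //; apply: (measurableT_comp mg); exact: measurable_funD.
have h2 := ib _ mg gM.
have h3 : `|\int[nu]_x (g x * x)| <= M.
  have ih := integrable_stdn_boundedM mg gM.
  have in1 : nu.-integrable setT (EFin \o (fun x : R => `|x|)) by exact: integrable_norm integrable_stdn_id.
  apply: le_trans (le_normr_Rintegral measurableT ih) _.
  apply: (@le_trans _ _ (\int[nu]_x (M * `|x|))).
    apply: le_Rintegral => //.
    - exact: integrable_norm ih.
    - exact: (integrableZl measurableT M in1).
    - by move=> x _; rewrite normrM ler_wpM2r.
  by rewrite RintegralZl// ler_piMr// stdn_abs_moment.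
have a2 : `|a| <= a ^+ 2 by rewrite -real_normK ?num_real// expr2 ler_peMl// ltW.
have a3 : 1 <= a ^+ 2 by apply: le_trans a2; rewrite ltW.
apply: le_trans (ler_normB _ _) _; apply: le_trans (lerD (ler_normB _ _) (lexx _)) _.
rewrite normrM.
have h4 : `|a| * `|\int[nu]_x (g x * x)| <= a ^+ 2 * M by rewrite ler_pM.
have h5 : M <= a ^+ 2 * M by rewrite ler_peMl.
have h6 : 0 <= gauss_C * M * a ^+ 2 by rewrite mulr_ge0 ?sqr_ge0// mulr_ge0.
have -> : (gauss_C + 3) * M * a ^+ 2 = gauss_C * M * a ^+ 2 + 3 * (a ^+ 2 * M) by ring.
by lra.
Qed.

Let F (c b : R) := \int[nu]_x cos (b * x + c).

Lemma measurable_cos_affine (b c : R) : measurable_fun setT (fun x : R => cos (b * x + c)).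
Proof.
apply: continuous_measurable_fun => x; apply: continuous_comp; last exact: continuous_cos.
by apply: cvgD; [apply: cvgM; [exact: cvg_cst|exact: cvg_id]|exact: cvg_cst].
Qed.

Lemma continuous_sin_affine (b c : R) : continuous (fun x : R => sin (b * x + c)).
Proof.
move=> x; apply: continuous_comp; last exact: continuous_sin.
by apply: cvgD; [apply: cvgM; [exact: cvg_cst|exact: cvg_id]|exact: cvg_cst].
Qed.

(** Gaussian integration by parts, without differentiating under the integral: the addition formula
    makes the translate of the sine explicit, and its first-order term in [a] must match that of
    [stdn_taylor]. *)
Lemma stdn_stein_sin (b c : R) :
  \int[nu]_x (sin (b * x + c) * x) = b * \int[nu]_x cos (b * x + c).
Proof.
set J := \int[nu]_x _; set K := \int[nu]_x _; set S := \int[nu]_x sin (b * x + c).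
have cs := @continuous_sin_affine b c.
have s1 x : `|sin (b * x + c)| <= 1 by rewrite ler_norml sin_geN1 sin_le1.
have c1 x : `|cos (b * x + c)| <= 1 by rewrite ler_norml cos_geN1 cos_le1.
have isn := integrable_stdn_bounded (continuous_measurable_fun cs) s1.
have ic := integrable_stdn_bounded (measurable_cos_affine b c) c1.
apply/esym/eqP; rewrite -subr_eq0; apply/eqP.
apply: (@eq0_of_le_sqr _ _ ((gauss_C + 3) + b ^+ 2 * `|K| + b ^+ 2 * `|S|)) => a _.
have := stdn_taylor a cs s1; rewrite mulr1 -/S -/J.
rewrite (_ : (fun x => sin (b * (x + a) + c)) =
    fun x => cos (b * a) * sin (b * x + c) + sin (b * a) * cos (b * x + c)); last first.
  apply/funext => x; rewrite (_ : b * (x + a) + c = (b * x + c) + b * a); last by ring.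
  by rewrite sinD; ring.
rewrite RintegralD//; last 2 first.
- exact: (integrableZl measurableT (cos (b * a)) isn).
- exact: (integrableZl measurableT (sin (b * a)) ic).
rewrite !RintegralZl// -/S -/K => h.
have h1 : `|(sin (b * a) - b * a) * K| <= b ^+ 2 * `|K| * a ^+ 2.
  by rewrite normrM mulrAC -exprMn ler_wpM2r// sin_sub_le.
have h2 : `|(cos (b * a) - 1) * S| <= b ^+ 2 * `|S| * a ^+ 2.
  by rewrite normrM mulrAC -exprMn ler_wpM2r// cos_sub1_le.
have -> : a * (b * K - J) = (cos (b * a) * S + sin (b * a) * K - S - a * J)
   - ((sin (b * a) - b * a) * K) - ((cos (b * a) - 1) * S) by ring.
apply: le_trans (ler_normB _ _) _; apply: le_trans (lerD (ler_normB _ _) (lexx _)) _.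
by rewrite [leRHS]mulrDl [X in _ <= X + _]mulrDl !lerD.
Qed.

(** By Stein's identity the integral [F c z] solves [F' = - z F] in the frequency [z], so its
    product with [exp (z^2 / 2)] is constant and is evaluated at 0. *)
Lemma stdn_cos (b c : R) : \int[nu]_x cos (b * x + c) = cos c * expR (- b ^+ 2 / 2).
Proof.
have dF (z : R) : is_derive z (1 : R) (F c) (- z * F c z).
  apply: (@is_derive_of_sqr _ _ _ _ 1) => e _.
  rewrite mulrA mulrN mulNr -mulrA -stdn_stein_sin opprK mul1r.
  have c1 w x : `|cos (w * x + c)| <= 1 by rewrite ler_norml cos_geN1 cos_le1.
  have ic w := integrable_stdn_bounded (measurable_cos_affine w c) (c1 w).
  have s1 x : `|sin (z * x + c)| <= 1 by rewrite ler_norml sin_geN1 sin_le1.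
  have isx := integrable_stdn_boundedM (continuous_measurable_fun (@continuous_sin_affine z c)) s1.
  rewrite /F -RintegralZl// -RintegralB// -RintegralD//; last 2 first.
  - exact: (integrableB measurableT (ic _) (ic _)).
  - exact: (integrableZl measurableT e isx).
  have ii := integrableD measurableT (integrableB measurableT (ic (z + e)) (ic z)) (integrableZl measurableT e isx).
  apply: le_trans (le_normr_Rintegral measurableT ii) _.
  (* The pointwise remainder is at most [(e x)^2], and the unit variance integrates this to
     [e^2]. *)
  rewrite -[leRHS]mulr1 -stdn_var -RintegralZl//; last exact: integrable_stdn_sqr.
  apply: le_Rintegral => //.
  - exact: integrable_norm ii.
  - exact: (integrableZl measurableT (e ^+ 2) integrable_stdn_sqr).
  move=> x _; have := cos_taylor1 (z * x + c) (e * x).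
  rewrite (_ : z * x + c + e * x = (z + e) * x + c); last by ring.
  rewrite (_ : (e * x) ^+ 2 = e ^+ 2 * (x * x)); last by ring.
  by rewrite (_ : e * x * sin (z * x + c) = e * (sin (z * x + c) * x)); last by ring.
pose H z := F c z * expR (z ^+ 2 / 2).
have dH (z : R) : is_derive z (1 : R) H 0.
  rewrite /H; apply: is_derive_eq.
  by rewrite /GRing.scale /=; field.
have := derive0_cst dH b 0; rewrite /H expr0n mul0r expR0 mulr1 /F.
under [in RHS]eq_Rintegral do rewrite mul0r add0r.
rewrite Rintegral_stdn_cst => <-; rewrite -mulrA -expRD.
by rewrite (_ : _ + _ = 0) ?expR0 ?mulr1//; ring.
Qed.

End Normal.

Section ScaledNormal.
Context {R : realType}.
Notation mu := (@lebesgue_measure R).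

Lemma ge0_integral_normal (s : R) (f : R -> \bar R) : measurable_fun setT f ->
  (forall x, 0 <= f x)%E ->
  (\int[@normal_prob R 0 s]_x f x = \int[mu]_x (f x * (normal_pdf 0 s x)%:E))%E.
Proof.
move=> mf f0; have dom := normal_prob_dominates 0 s.
rewrite -(Radon_Nikodym_SigmaFinite.change_of_variables dom f0 measurableT mf).
have mphi : measurable_fun setT (EFin \o normal_pdf 0 s).
  by apply/measurable_EFinP; exact: measurable_normal_pdf.
have fi := Radon_Nikodym_SigmaFinite.f_integrable dom.
apply: ae_eq_integral => //.
- by apply: emeasurable_funM => //; exact: measurable_int fi.
- exact: emeasurable_funM.
- apply: ae_eqe_mul2l; apply: integral_ae_eq => // E _ mE.
  by rewrite -Radon_Nikodym_SigmaFinite.f_integral.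
Qed.

Lemma lebesgue_scale (c : R) (G : R -> R) : 0 < c -> continuous G -> (forall x, 0 <= G x) ->
  (\int[mu]_x (G x)%:E = \int[mu]_x (G (c * x) * c)%:E)%E.
Proof.
move=> c0 cG G0.
have d1 x : is_derive x (1 : R) (fun y : R => c * y) c.
  by apply: is_derive_eq; rewrite /GRing.scale /=; ring.
have F1 : (fun y : R => c * y)^`()%classic = cst c.
  by apply/funext => x; rewrite derive1E; apply: derive_val.
rewrite (@increasing_ge0_integration_by_substitutionT _ (fun y => c * y) G)//.
- by apply: eq_integral => x _; rewrite F1.
- by move=> x y xy; rewrite ltr_pM2l.
- by rewrite F1 => x; exact: cvg_cst.
- by rewrite F1; apply/cvg_ex; exists c; exact: cvg_cst.
- by rewrite F1; apply/cvg_ex; exists c; exact: cvg_cst.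
- by apply: gt0_cvgMrNy => //; exact: cvg_id.
- by apply: gt0_cvgMry => //; exact: cvg_id.
Qed.

Lemma integral_normal_stdn (s : R) (G : R -> R) : 0 < s -> continuous G ->
  (forall x, 0 <= G x) ->
  (\int[@normal_prob R 0 s]_x (G x)%:E = \int[stdn]_x (G (s * x))%:E)%E.
Proof.
move=> s0 cG G0.
have mc (H : R -> R) : continuous H -> measurable_fun setT (fun x => (H x)%:E).
  by move=> cH; apply/measurable_EFinP; exact: continuous_measurable_fun.
have cS : continuous (fun x => G (s * x)).
  move=> x; apply: (@continuous_comp _ _ _ (fun y => s * y)); last exact: cG.
  by apply: cvgM; [exact: cvg_cst|exact: cvg_id].
have cp : continuous (@normal_pdf R 0 s) by apply: continuous_normal_pdf; rewrite gt_eqF.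
rewrite ge0_integral_normal; [|exact: mc|by move=> x; rewrite lee_fin].
rewrite ge0_integral_stdn; [|exact: mc|by move=> x; rewrite lee_fin].
rewrite (@lebesgue_scale s (fun x => G x * normal_pdf 0 s x))//; last 2 first.
- by move=> x; apply: cvgM; [exact: cG|exact: cp].
- by move=> x; rewrite mulr_ge0// normal_pdf_ge0.
apply: eq_integral => x _; rewrite -EFinM -mulrA; congr (_ * _)%:E.
rewrite stdn_pdfE normal_pdfE ?gt_eqF// /normal_fun subr0 /normal_peak expr1n mul1r.
rewrite mulrAC; congr (_ * expR _); last by field; rewrite gt_eqF.
rewrite -mulrnAr sqrtrM ?sqr_ge0// sqrtr_sqr gtr0_norm// invfM mulrAC mulVf ?gt_eqF// mul1r.
by [].
Qed.

End ScaledNormal.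

(** * Cameron-Martin factorization *)

Section GaussianFunctionals.
Context {R : realType} {X : completeNormedModType R}.
Variable gamma : probability (@borelX R X) R.
Hypothesis hgauss : centered_gaussian gamma.
Notation nu := (@stdn R).

Lemma clf_borel (l : X -> R) : is_clf l ->
  measurable_fun [set: @borelX R X] (l : @borelX R X -> R).
Proof. by move=> [_ cl]; exact: continuous_borel_measurable. Qed.

(** The value [s = 0] merges the degenerate case of [centered_gaussian] with the others, so that no
    later argument distinguishes them. *)
Lemma clf_law (l : X -> R) : is_clf l -> exists s : R, forall G : R -> R, continuous G ->
  (forall x, 0 <= G x) ->
  (\int[gamma]_(x in [set: @borelX R X]) (G (l x))%:E = \int[nu]_x (G (s * x))%:E)%E.
Proof.
move=> hl; pose l' : @borelX R X -> measurableTypeR R := l.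
have ml : measurable_fun setT l' := clf_borel hl.
have mc (G : R -> R) : continuous G ->
    measurable_fun setT (fun x : measurableTypeR R => (G x)%:E).
  by move=> cG; apply/measurable_EFinP; exact: continuous_measurable_fun.
have push (G : R -> R) : continuous G -> (forall x, 0 <= G x) ->
  (\int[gamma]_(x in [set: @borelX R X]) (G (l x))%:E =
   \int[pushforward gamma l']_x (G x)%:E)%E.
  move=> cG G0; rewrite (ge0_integral_pushforward ml)//; first exact: mc.
  by move=> y _; rewrite lee_fin.
have [h|[s [s0 h]]] := hgauss hl; last first.
  exists s => G cG G0; rewrite push// -integral_normal_stdn//.
  by apply: eq_measure_integral => A mA _; exact: h.
exists 0 => G cG G0; rewrite push//.
transitivity (\int[@dirac _ (measurableTypeR R) (0 : R)%R R]_x (G x)%:E)%E.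
  by apply: eq_measure_integral => A mA _; exact: h.
rewrite integral_dirac//; last exact: mc.
rewrite diracT mul1e; under eq_integral do rewrite mul0r.
rewrite integral_cst// [X in (_ * X)%E](_ : _ = 1%E) ?mule1//; exact: stdn_setT.
Qed.

(** The variance of a functional, that is, the diagonal of the covariance of [gamma]. *)
Definition qform (l : X -> R) : R := \int[gamma]_(x in [set: @borelX R X]) (l x ^+ 2).

Lemma clf_gauss (l : X -> R) : is_clf l ->
  gamma.-integrable [set: @borelX R X] (EFin \o (fun x => l x ^+ 2)) /\
  forall c, \int[gamma]_(x in [set: @borelX R X]) cos (l x + c) =
    cos c * expR (- qform l / 2).
Proof.
move=> hl; have ml := clf_borel hl; have [s hs] := clf_law hl.
have e : (\int[gamma]_(x in [set: @borelX R X]) (l x ^+ 2)%:E = (s ^+ 2)%:E)%E.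
  rewrite (hs (fun y => y ^+ 2)); last 2 first.
  - by move=> x; exact: exprn_continuous.
  - by move=> x; exact: sqr_ge0.
  rewrite -(mulr1 (s ^+ 2)) -stdn_var EFinM.
  rewrite -[X in (_ * X)%E](_ : \int[nu]_x (x * x)%:E = _)%E; last first.
    by rewrite fineK//; exact: integrable_fin_num integrable_stdn_sqr.
  rewrite -integralZl//; last exact: integrable_stdn_sqr.
  by apply: eq_integral => x _; rewrite -EFinM exprMn (expr2 x).
split.
  apply/integrableP; split.
    by apply/measurable_EFinP; exact: measurable_funX.
  under eq_integral do rewrite /= ger0_norm ?sqr_ge0//.
  by rewrite e ltry.
have -> : qform l = s ^+ 2 by rewrite /qform /Rintegral e.
move=> c; have cc : continuous (fun y : R => cos (y + c)).
  move=> x; apply: continuous_comp; last exact: continuous_cos.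
  by apply: cvgD; [exact: cvg_id|exact: cvg_cst].
(* Adding 1 makes the integrand nonnegative, as [clf_law] requires. *)
have := hs (fun y => cos (y + c) + 1).
have h1 : continuous (fun y : R => cos (y + c) + 1).
  by move=> x; apply: cvgD; [exact: cc|exact: cvg_cst].
have h2 (y : R) : 0 <= cos (y + c) + 1 by have := cos_geN1 (y + c); lra.
move/(_ h1 h2)/(congr1 fine).
have b1 (y : R) : `|cos (y + c)| <= 1 by rewrite ler_norml cos_geN1 cos_le1.
have i1 : gamma.-integrable [set: @borelX R X] (EFin \o (fun x => cos (l x + c))).
  apply: (bounded_integrable gamma (M := 1)) => //.
  exact: (measurableT_comp (continuous_measurable_fun cc) ml).
have i2 : nu.-integrable setT (EFin \o (fun x => cos (s * x + c))).
  by apply: (integrable_stdn_bounded (M := 1)) => //; exact: measurable_cos_affine.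
rewrite -!/(Rintegral _ _ _) RintegralD//; last exact: finite_measure_integrable_cst.
rewrite RintegralD//; last exact: finite_measure_integrable_cst.
rewrite stdn_cos Rintegral_stdn_cst (Rintegral_prob_cst gamma) => /addIr ->.
by rewrite mulNr.
Qed.

Lemma qform_ge0 l : 0 <= qform l.
Proof. by apply: Rintegral_ge0 => x _; exact: sqr_ge0. Qed.

Definition qdot (l m : X -> R) : R := \int[gamma]_(x in [set: @borelX R X]) (l x * m x).

Lemma clf_mul_integrable l m : is_clf l -> is_clf m ->
  gamma.-integrable [set: @borelX R X] (EFin \o (fun x => l x * m x)).
Proof.
move=> hl hm; have [il _] := clf_gauss hl; have [im _] := clf_gauss hm.
apply: le_integrable (integrable_addR measurableT il im) => //.
  by apply/measurable_EFinP; apply: measurable_funM; exact: clf_borel.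
move=> x _ /=; rewrite lee_fin normrM [leRHS]ger0_norm ?addr_ge0 ?sqr_ge0//.
rewrite -[l x ^+ 2]real_normK ?num_real// -[m x ^+ 2]real_normK ?num_real//.
have := sqr_ge0 (`|l x| - `|m x|); have := normr_ge0 (l x); have := normr_ge0 (m x); nra.
Qed.

Lemma qform_lin (a b : R) l m : is_clf l -> is_clf m ->
  qform (fun x => a * l x + b * m x) =
  a ^+ 2 * qform l + 2 * (a * b) * qdot l m + b ^+ 2 * qform m.
Proof.
move=> hl hm; have [il _] := clf_gauss hl; have [im _] := clf_gauss hm.
have ilm := clf_mul_integrable hl hm.
rewrite /qform (_ : (fun x => (a * l x + b * m x) ^+ 2) = fun x =>
  (a ^+ 2 * l x ^+ 2 + 2 * (a * b) * (l x * m x)) + b ^+ 2 * m x ^+ 2); last first.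
  by apply/funext => x; ring.
rewrite RintegralD//; last 2 first.
- by apply: (@integrable_addR _ _ _ gamma) => //; exact: integrable_mulR.
- exact: integrable_mulR.
by rewrite RintegralD ?RintegralZl//; exact: integrable_mulR.
Qed.

Lemma qform_scale (a : R) l : is_clf l -> qform (fun x => a * l x) = a ^+ 2 * qform l.
Proof.
move=> hl; have <- : a ^+ 2 * qform l + 2 * (a * 0) * qdot l l + 0 ^+ 2 * qform l = a ^+ 2 * qform l by ring.
rewrite -qform_lin//.
by congr qform; apply/funext => x; rewrite mul0r addr0.
Qed.

Lemma cm_admissible l : is_clf l ->
  (\int[gamma]_(x in [set: @borelX R X]) ((l x) ^+ 2)%:E <= 1)%E = (qform l <= 1).
Proof.
move=> hl; have [il _] := clf_gauss hl.
by rewrite -lee_fin /qform /Rintegral fineK//; exact: integrable_fin_num il.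
Qed.

Lemma cm_enorm_ge0 h : (0 <= cm_enorm gamma h)%E.
Proof.
apply: ereal_sup_ubound => /=; exists (fun=> 0) => //; split; first exact: clf_0.
rewrite cm_admissible; last exact: clf_0.
by rewrite /qform expr0n /= (Rintegral_prob_cst gamma) ler01.
Qed.

Lemma hnorm_ge0 h : 0 <= hnorm gamma h.
Proof. by rewrite fine_ge0// cm_enorm_ge0. Qed.

Lemma cm_enormE h : inH gamma h -> cm_enorm gamma h = (hnorm gamma h)%:E.
Proof. by move=> hh; rewrite /hnorm fineK// ge0_fin_numE// cm_enorm_ge0. Qed.

Lemma clf_le_hnorm1 l h : inH gamma h -> is_clf l -> qform l <= 1 -> l h <= hnorm gamma h.
Proof.
move=> hh hl ql; rewrite -lee_fin -cm_enormE//; apply: ereal_sup_ubound => /=.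
by exists l => //; split => //; rewrite cm_admissible.
Qed.

Lemma hnorm_le h (c : R) : (forall l, is_clf l -> qform l <= 1 -> l h <= c) ->
  inH gamma h /\ hnorm gamma h <= c.
Proof.
move=> hc.
have le : (cm_enorm gamma h <= c%:E)%E.
  apply: ge_ereal_sup => _ [l [hl ql] <-]; rewrite lee_fin; apply: hc => //.
  by rewrite -cm_admissible.
have hh : inH gamma h by apply: le_lt_trans le _; rewrite ltry.
by split=> //; rewrite -lee_fin -cm_enormE.
Qed.

(** Divide [l] by its standard deviation to make it admissible in the supremum. If the variance is
    0, all multiples of [l] are admissible, which forces [l h = 0]. *)
Lemma clf_sqr_le l h : inH gamma h -> is_clf l ->
  (l h) ^+ 2 <= qform l * hnorm gamma h ^+ 2.
Proof.
move=> hh hl; have h0 := hnorm_ge0 h; have q0 := qform_ge0 l.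
have [q1|q1] := eqVneq (qform l) 0.
  have z : l h = 0.
    have b (t : R) : t * l h <= hnorm gamma h.
      apply: (@clf_le_hnorm1 (fun x => t * l x)) => //; first exact: clf_scale.
      by rewrite qform_scale// q1 mulr0 ler01.
    apply/eqP; rewrite -[_ == 0]negbK; apply/negP => nz.
    have := b ((hnorm gamma h + 1) / l h); rewrite divfK//; lra.
  by rewrite z expr0n mulr_ge0// sqr_ge0.
have qp : 0 < qform l by rewrite lt_def q1.
pose r := Num.sqrt (qform l); have r0 : 0 < r by rewrite sqrtr_gt0.
have rr : r ^+ 2 = qform l by rewrite sqr_sqrtr.
have b (t : R) : t ^+ 2 = r ^- 2 -> t * l h <= hnorm gamma h.
  move=> tr; apply: (@clf_le_hnorm1 (fun x => t * l x)) => //; first exact: clf_scale.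
  by rewrite qform_scale// -rr tr mulVf// expf_neq0// gt_eqF.
have b1 : r^-1 * l h <= hnorm gamma h by apply: b; rewrite exprVn.
have b2 : - r^-1 * l h <= hnorm gamma h by apply: b; rewrite sqrrN exprVn.
have : `|r^-1 * l h| <= hnorm gamma h.
  by rewrite ler_norml b1 andbT lerNl -mulNr.
move=> b3; rewrite -rr -exprMn -real_normK ?num_real// ler_sqr ?nnegrE//; last first.
  by rewrite mulr_ge0// ltW.
by move: b3; rewrite normrM normfV (gtr0_norm r0) ler_pdivrMl.
Qed.

Lemma inH0 : inH gamma 0.
Proof.
by have [|//] := @hnorm_le 0 0; move=> l hl _; rewrite clf0.
Qed.

Lemma inH_lin (a : R) h k : inH gamma h -> inH gamma k ->
  inH gamma (a *: h + k) /\ hnorm gamma (a *: h + k) <= `|a| * hnorm gamma h + hnorm gamma k.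
Proof.
move=> hh hk; apply: hnorm_le => l hl ql; rewrite clfD// clfZ//; apply: lerD; last exact: clf_le_hnorm1.
apply: le_trans (ler_norm _) _; rewrite normrM ler_wpM2l//.
rewrite ler_norml (clf_le_hnorm1 hh hl ql) andbT lerNl -mulN1r.
apply: (@clf_le_hnorm1 (fun x => -1 * l x)) => //; first exact: clf_scale.
by rewrite qform_scale// sqrrN expr1n mul1r.
Qed.

Lemma inH_scale (a : R) h : inH gamma h -> inH gamma (a *: h).
Proof. by move=> hh; have [] := inH_lin a hh inH0; rewrite addr0. Qed.

Lemma hnorm0 : hnorm gamma 0 = 0.
Proof.
apply/eqP; rewrite eq_le hnorm_ge0 andbT; have [//|_ ->//] := @hnorm_le 0 0.
by move=> l hl _; rewrite clf0.
Qed.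

Lemma hnorm_scale_le (a : R) h : inH gamma h -> hnorm gamma (a *: h) <= `|a| * hnorm gamma h.
Proof. by move=> hh; have [_] := inH_lin a hh inH0; rewrite addr0 hnorm0 addr0. Qed.

Lemma hnorm_scale (a : R) h : inH gamma h -> hnorm gamma (a *: h) = `|a| * hnorm gamma h.
Proof.
move=> hh; apply/eqP; rewrite eq_le hnorm_scale_le//=.
have [->|a0] := eqVneq a 0; first by rewrite normr0 mul0r hnorm_ge0.
rewrite mulrC -ler_pdivlMr ?normr_gt0// mulrC -normfV.
have := hnorm_scale_le (a^-1) (inH_scale a hh).
by rewrite scalerA mulVf// scale1r.
Qed.

(** A functional norming [h] is controlled at [h] by its variance times the square of the
    [H]-norm. *)
Lemma hnorm_eq0 h : inH gamma h -> hnorm gamma h = 0 -> h = 0.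
Proof.
move=> hh h0; have [l [hl lh _]] := hahn_banach_norming h.
have := clf_sqr_le hh hl; rewrite h0 expr0n mulr0 lh => le.
by apply/eqP; rewrite -normr_eq0 -sqrf_eq0 eq_le le sqr_ge0.
Qed.

End GaussianFunctionals.

Section ProductFubini.
Context {R : realType} d1 d2 (T1 : measurableType d1) (T2 : measurableType d2).
Variables (P1 : probability T1 R) (P2 : probability T2 R).

Lemma Rintegral_fubini (F : T1 * T2 -> R) M : measurable_fun setT F ->
  (forall z, `|F z| <= M) ->
  \int[(P1 \x P2)%E]_z F z = \int[P1]_x \int[P2]_y F (x, y) /\
  \int[(P1 \x P2)%E]_z F z = \int[P2]_y \int[P1]_x F (x, y).
Proof.
move=> mF FM.
have iF := bounded_integrable (P1 \x P2)%E mF FM.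
have i1 x : P2.-integrable setT (EFin \o (fun y => F (x, y))).
  by apply: (bounded_integrable P2 _ (fun y => FM (x, y))); exact: measurableT_comp.
have i2 y : P1.-integrable setT (EFin \o (fun x => F (x, y))).
  by apply: (bounded_integrable P1 _ (fun x => FM (x, y))); exact: measurableT_comp.
split; rewrite /Rintegral; congr fine.
  rewrite -(integral12_prod_meas1 iF); apply: eq_integral => x _.
  by rewrite /fubini_F fineK//; exact: integrable_fin_num (i1 x).
rewrite -(integral21_prod_meas1 iF); apply: eq_integral => y _.
by rewrite /fubini_G fineK//; exact: integrable_fin_num (i2 y).
Qed.

End ProductFubini.

(** * Rotation invariance and the Gaussian variable of a unit vector of H *)

Section Rotation.
Context {R : realType} {X : completeNormedModType R}.
Variable gamma : probability (@borelX R X) R.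
Hypothesis hsep : @separable R X.
Hypothesis hgauss : centered_gaussian gamma.
Notation nu := (@stdn R).
Notation BX := (@borelX R X).

Lemma measurable_cosD (c : R) : measurable_fun setT (fun y : R => cos (y + c)).
Proof.
apply: continuous_measurable_fun => y; apply: continuous_comp; last exact: continuous_cos.
by apply: cvgD; [exact: cvg_id|exact: cvg_cst].
Qed.

Lemma norm_cos_le1 (y : R) : `|cos y| <= 1.
Proof. by rewrite ler_norml cos_geN1 cos_le1. Qed.

(** The variances of [a l] and [b l] add up to that of [l], so the two laws have the same
    characteristic function. *)
Lemma gauss_rotate (a b : R) (f : X -> R) (M : R) : a ^+ 2 + b ^+ 2 = 1 ->
  continuous f -> (forall x, `|f x| <= M) ->
  \int[gamma]_(y in [set: BX]) \int[gamma]_(z in [set: BX]) f (a *: (y : X) + b *: (z : X)) =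
  \int[gamma]_(y in [set: BX]) f y.
Proof.
move=> ab cf fM.
pose Phi (z : BX * BX) : X := a *: (z.1 : X) + b *: (z.2 : X).
have lPhi l (hl : is_clf l) w : l (Phi w) = a * l w.1 + b * l w.2.
  by rewrite /Phi (clfD _ _ hl) !(clfZ _ _ hl).
have mPhi l : is_clf l -> measurable_fun setT (fun w => l (Phi w)).
  move=> hl; rewrite (_ : (fun w => _) = fun w : BX * BX => a * l w.1 + b * l w.2); last first.
    by apply/funext => w; exact: lPhi.
  have ml := clf_borel hl.
  apply: measurable_funD; apply: measurable_funM => //.
    exact: (measurableT_comp ml).
  exact: (measurableT_comp ml).
have [|mf e] := @continuous_law _ _ _ _ (gamma \x gamma)%E gamma Phi f M hsep mPhi _ cf fM.
  move=> l c hl.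
  have mc := measurableT_comp (measurable_cosD c) (mPhi l hl).
  have [-> _] := Rintegral_fubini gamma gamma mc (fun z => norm_cos_le1 _).
  have [_ eb] := clf_gauss hgauss (clf_scale b hl).
  have [ia ea] := clf_gauss hgauss (clf_scale a hl).
  have [_ el] := clf_gauss hgauss hl.
  transitivity (\int[gamma]_(x in [set: BX])
      (cos (a * l x + c) * expR (- qform gamma (fun y => b * l y) / 2))).
    apply: eq_Rintegral => x _; rewrite -eb; apply: eq_Rintegral => y _.
    by rewrite [LHS]/= (lPhi l hl) /=; congr cos; ring.
  rewrite RintegralZr//; last first.
    apply: (bounded_integrable gamma (M := 1)) => [|x]; last exact: norm_cos_le1.
    by apply: (measurableT_comp (measurable_cosD c)); exact: (clf_borel (clf_scale a hl)).
  rewrite ea el !(qform_scale hgauss)// -mulrA -expRD; congr (_ * expR _).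
  set q := qform gamma l; have qe : q = (a ^+ 2 + b ^+ 2) * q by rewrite ab mul1r.
  by rewrite [in RHS]qe; field.
by rewrite -e; have [-> _] := Rintegral_fubini gamma gamma mf (fun z => fM _).
Qed.

(** The parallelogram identity makes functionals that almost realize [|k|_H = 1] a Cauchy sequence
    in [L^2(gamma)]; the limit [opt_lim] is the Gaussian variable associated with [k]. *)
Section Approximation.
Variable k : X.
Hypothesis hk : inH gamma k.
Hypothesis k1 : hnorm gamma k = 1.

Lemma near_optimal (e : R) : 0 < e ->
  exists l : X -> R, [/\ is_clf l, qform gamma l <= 1 & 1 - e < l k].
Proof.
move=> e0; have fin : cm_enorm gamma k \is a fin_num by rewrite (cm_enormE hgauss).
have [_ [l [hl ql] <-]] := ub_ereal_sup_adherent e0 fin.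
rewrite -/(cm_enorm gamma k) (cm_enormE hgauss)// k1 -EFinB lte_fin => h.
by exists l; split=> //; rewrite -(cm_admissible hgauss).
Qed.

(** The 8 is the factor lost in the parallelogram identity: with this tolerance, consecutive
    functionals differ by at most [2^-(n+1)] in [L^2(gamma)], which is summable. *)
Definition opt_eps (n : nat) : R := ((2 ^ n.+1)%:R^-1) ^+ 2 / 8.

Lemma opt_eps_gt0 n : 0 < opt_eps n.
Proof. by rewrite divr_gt0// exprn_gt0// invr_gt0 ltr0n expn_gt0. Qed.

Definition opt_seq (n : nat) : X -> R := projT1 (cid (near_optimal (opt_eps_gt0 n))).

Lemma opt_seqP n : [/\ is_clf (opt_seq n), qform gamma (opt_seq n) <= 1 &
  1 - opt_eps n < opt_seq n k].
Proof. by rewrite /opt_seq; case: cid. Qed.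

Lemma opt_seq_le1 n : opt_seq n k <= 1.
Proof. by have [h1 h2 _] := opt_seqP n; rewrite -k1 (clf_le_hnorm1 hgauss). Qed.

Lemma opt_eps_nincr n : opt_eps n.+1 <= opt_eps n.
Proof.
rewrite /opt_eps ler_wpM2r// ler_sqr ?nnegrE ?invr_ge0//.
by rewrite lef_pV2 ?posrE ?ltr0n ?expn_gt0// ler_nat leq_exp2l.
Qed.

Lemma opt_eps_small n : opt_eps n <= 1 / 8.
Proof.
rewrite /opt_eps ler_wpM2r// expr_le1 ?invr_ge0//.
by rewrite invf_le1 ?ltr0n ?expn_gt0// ler1n expn_gt0.
Qed.

Lemma opt_seq_cauchy n :
  qform gamma (fun x => opt_seq n.+1 x - opt_seq n x) <= ((2 ^ n.+1)%:R^-1) ^+ 2.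
Proof.
have [h1 q1 e1] := opt_seqP n.+1; have [h0 q0 e0] := opt_seqP n.
set l1 := opt_seq n.+1 in h1 q1 e1 *; set l0 := opt_seq n in h0 q0 e0 *.
have e10 := opt_eps_nincr n; have es := opt_eps_small n; have ep := opt_eps_gt0 n.
have qa := qform_lin hgauss 1 1 h1 h0; have qs := qform_lin hgauss 1 (-1) h1 h0.
rewrite (_ : (fun x => 1 * l1 x + -1 * l0 x) = fun x => l1 x - l0 x) in qs; last first.
  by apply/funext => x; ring.
have hs : is_clf (fun x => 1 * l1 x + 1 * l0 x) by apply: clf_add; exact: clf_scale.
(* Since [|k|_H = 1], the variance of the sum is at least the square of its value at [k], nearly 4,
   while the two variances are at most 1. *)
have := clf_sqr_le hgauss hk hs; rewrite k1 expr1n mulr1 => le.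
have le4 : 4 - 8 * opt_eps n <= (1 * l1 k + 1 * l0 k) ^+ 2.
  have b : 2 - 2 * opt_eps n <= 1 * l1 k + 1 * l0 k by lra.
  have : (2 - 2 * opt_eps n) ^+ 2 <= (1 * l1 k + 1 * l0 k) ^+ 2.
    by rewrite ler_sqr ?nnegrE//; lra.
  apply: le_trans; have := sqr_ge0 (opt_eps n); lra.
have -> : ((2 ^ n.+1)%:R^-1) ^+ 2 = 8 * opt_eps n by rewrite /opt_eps; field.
lra.
Qed.

Let dif n (x : BX) : R := opt_seq n.+1 x - opt_seq n x.

(** Young's inequality [|d| <= e / 2 + d^2 / (2 e)], weighted by the [L^2] bound [e], makes each
    half integrate to at most [e / 2]. *)
Lemma opt_dif_l1 n : (\int[gamma]_(x in [set: BX]) (`|dif n x|)%:E <= ((2 ^ n.+1)%:R^-1)%:E)%E.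
Proof.
have [h1 _ _] := opt_seqP n.+1; have [h0 _ _] := opt_seqP n.
have hd := clf_sub h1 h0; have [i2 _] := clf_gauss hgauss hd.
have md : measurable_fun setT (dif n) by exact: (clf_borel hd).
set e : R := (2 ^ n.+1)%:R^-1; have e0 : 0 < e by rewrite invr_gt0 ltr0n expn_gt0.
have ic : gamma.-integrable [set: BX] (EFin \o cst (e / 2)) by exact: finite_measure_integrable_cst.
have ii := integrable_addR measurableT ic (integrable_mulR ((2 * e)^-1) measurableT i2).
apply: (@le_trans _ _ (\int[gamma]_(x in [set: BX]) (e / 2 + (2 * e)^-1 * dif n x ^+ 2)%:E)%E).
  apply: ge0_le_integral => //.
  - by apply/measurable_EFinP; apply: measurableT_comp.
  - exact: measurable_int ii.
  move=> x _; rewrite lee_fin.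
  have -> : e / 2 + (2 * e)^-1 * dif n x ^+ 2 = `|dif n x| + (2 * e)^-1 * (`|dif n x| - e) ^+ 2.
    by rewrite -[dif n x ^+ 2]real_normK ?num_real//; field; rewrite gt_eqF.
  by rewrite lerDl mulr_ge0 ?sqr_ge0// invr_ge0 mulr_ge0// ltW.
rewrite -[X in (X <= _)%E]fineK; last exact: integrable_fin_num ii.
rewrite lee_fin -/(Rintegral _ _ _).
have -> : \int[gamma]_(x in [set: BX]) (e / 2 + (2 * e)^-1 * dif n x ^+ 2) =
    e / 2 + (2 * e)^-1 * qform gamma (dif n).
  transitivity (\int[gamma]_(x in [set: BX]) (e / 2) +
    \int[gamma]_(x in [set: BX]) ((2 * e)^-1 * dif n x ^+ 2)).
    by apply: RintegralD => //; exact: integrable_mulR.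
  by congr (_ + _); [exact: Rintegral_prob_cst|exact: RintegralZl].
have := opt_seq_cauchy n; rewrite -/e -[X in X <= _]/(qform gamma (dif n)) => q.
apply: (@le_trans _ _ (e / 2 + (2 * e)^-1 * e ^+ 2)).
  by rewrite lerD2l ler_wpM2l// invr_ge0 mulr_ge0// ltW.
by rewrite le_eqVlt; apply/orP; left; apply/eqP; field; rewrite gt_eqF.
Qed.

(** The [L^1] norms of the increments are summable, so the series of their absolute values is finite
    almost everywhere and the telescoping series converges there. *)
Lemma opt_seq_cvg : {ae gamma, forall x : BX, cvgn (fun n => opt_seq n x)}.
Proof.
have md n : measurable_fun setT (fun x => (`|dif n x|)%:E).
  have [h1 _ _] := opt_seqP n.+1; have [h0 _ _] := opt_seqP n.
  by apply/measurable_EFinP; apply: measurableT_comp => //; exact: (clf_borel (clf_sub h1 h0)).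
have d0 n (x : BX) : (0 <= (`|dif n x|)%:E)%E by rewrite lee_fin.
pose g (x : BX) := (\sum_(n <oo) (`|dif n x|)%:E)%E.
have mg : measurable_fun setT g.
  by apply: ge0_emeasurable_sum => [n x _ _|n _]; [exact: d0|exact: md].
have g0 x : (0 <= g x)%E by apply: nneseries_ge0 => n _ _; exact: d0.
have gi : gamma.-integrable setT g.
  apply/integrableP; split => //.
  under eq_integral do rewrite gee0_abs//.
  rewrite integral_nneseries//.
  apply: (@le_lt_trans _ _ (\sum_(n <oo) ((1 / (2 ^ (n + 1))%:R)%:E : \bar R))%E).
    apply: lee_nneseries => [n _ _|n _]; first by apply: integral_ge0.
    by rewrite addn1 div1r; exact: opt_dif_l1.
  have := @cvg_geometric_eseries_half R 1 0 => /cvg_lim -> //.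
  by rewrite ltry.
apply: filterS (integrable_ae measurableT gi) => x /(_ Logic.I) fx.
have cs : cvgn (series (fun n => dif n x)).
  apply: normed_cvg; apply: nondecreasing_is_cvgn.
    by apply: (@nondecreasing_series _ (fun n => `|dif n x|) xpredT).
  exists (fine (g x)) => _ [n _ <-]; rewrite -lee_fin fineK//.
  rewrite /series /= -sumEFin.
  by apply: nneseries_lim_ge => i _ _; exact: d0.
have -> : (fun n => opt_seq n x) = (fun n => opt_seq 0 x + series (fun n => dif n x) n).
  by apply/funext => n; rewrite (eq_sum_telescope (fun n => opt_seq n x)).
by apply: is_cvgD => //; exact: is_cvg_cst.
Qed.

(** A measurable version defined everywhere; off the set of convergence its value is irrelevant. *)
Definition opt_lim (x : BX) : R := fine (limn_esup (fun n => (opt_seq n x)%:E)).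

Lemma measurable_opt_lim : measurable_fun setT opt_lim.
Proof.
apply: measurableT_comp => //; apply: measurable_fun_limn_esup => n.
by apply/measurable_EFinP; have [h _ _] := opt_seqP n; exact: (clf_borel h).
Qed.

Lemma opt_limP : {ae gamma, forall x : BX, opt_seq n x @[n --> \oo] --> opt_lim x}.
Proof.
apply: filterS opt_seq_cvg => x cx.
rewrite /opt_lim is_cvg_limn_esupE; last first.
  by apply/cvg_ex; exists (limn (fun n => opt_seq n x))%:E; apply/cvg_EFin => //; exact: nearW.
rewrite (_ : limn _ = (limn (fun n => opt_seq n x))%:E)//.
by apply/cvg_lim => //; apply/cvg_EFin => //; exact: nearW.
Qed.

Lemma opt_eps_cvg0 : opt_eps n @[n --> \oo] --> (0 : R).
Proof.
have c := @cvg_geometric R (1 / 2) (2^-1).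
have c1 : (2 ^ n.+1)%:R^-1 @[n --> \oo] --> (0 : R).
  rewrite (_ : (fun n => _) = geometric (1 / 2) (2^-1)); last first.
    by apply/funext => n; rewrite /geometric /= natrX exprS invfM exprVn div1r.
  by apply: c; rewrite ger0_norm; lra.
rewrite -(mul0r (8^-1 : R)); apply: cvgM; last exact: cvg_cst.
by rewrite (_ : 0 = 0 ^+ 2 :> R); [apply: cvgM; exact: c1|rewrite expr0n].
Qed.

(** In the limit the covariance of [m] with the optimal variable is [m k], so removing that
    component lowers the variance by [m k ^+ 2]. The proof is quantitative, with an error of order
    [sqrt (opt_eps n)]. *)
Lemma qform_opt_cvg (m : X -> R) : is_clf m ->
  qform gamma (fun x => m x - m k * opt_seq n x) @[n --> \oo] --> qform gamma m - m k ^+ 2.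
Proof.
move=> hm; pose q := qform gamma m; have q0 := qform_ge0 gamma m.
have bound n : `|qform gamma (fun x => m x - m k * opt_seq n x) - (q - m k ^+ 2)| <=
   Num.sqrt (opt_eps n) * (`|m k| * (2 + q)) + 3 * m k ^+ 2 * opt_eps n.
  have [hl ql el] := opt_seqP n; have l1 := opt_seq_le1 n.
  have ep := opt_eps_gt0 n; have es := opt_eps_small n.
  set l := opt_seq n in hl ql el l1 *; set D := qdot gamma m l; set e := opt_eps n in el ep es *.
  have nl := qform_lin hgauss 1 (- m k) hm hl.
  rewrite (_ : (fun x => 1 * m x + - m k * l x) = fun x => m x - m k * l x) in nl; last first.
    by apply/funext => x; ring.
  rewrite nl -/q -/D.
  have ql1 : 1 - 2 * e <= qform gamma l.
    have := clf_sqr_le hgauss hk hl; rewrite k1 expr1n mulr1; apply: le_trans.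
    have : (1 - e) ^+ 2 <= l k ^+ 2 by rewrite ler_sqr ?nnegrE; lra.
    by apply: le_trans; have := sqr_ge0 e; lra.
  (* Near-optimality of [l] is tested against the perturbation [l + t m]; the choice [t = s] or
     [t = - s] with [s^2 = e] balances the two error terms. *)
  have key (t : R) : 2 * t * (l k * m k - D) <= 1 - l k ^+ 2 + t ^+ 2 * q.
    have hlt : is_clf (fun x => 1 * l x + t * m x) by apply: clf_add; exact: clf_scale.
    have := clf_sqr_le hgauss hk hlt; rewrite k1 expr1n mulr1 (qform_lin hgauss)//.
    rewrite (_ : qdot gamma l m = D); last first.
      by rewrite /D /qdot; apply: eq_Rintegral => x _; rewrite mulrC.
    by rewrite -/q => h; have := sqr_ge0 (t * m k); lra.
  pose s := Num.sqrt e; have s0 : 0 < s by rewrite sqrtr_gt0.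
  have ss : s ^+ 2 = e by rewrite sqr_sqrtr// ltW.
  have lk2 : 1 - l k ^+ 2 <= 2 * e.
    have : (1 - e) ^+ 2 <= l k ^+ 2 by rewrite ler_sqr ?nnegrE; lra.
    by have := sqr_ge0 e; lra.
  have kb : `|l k * m k - D| <= s * (2 + q) / 2.
    have k1' := key s; have k2' := key (- s); rewrite sqrrN ss in k2'; rewrite ss in k1'.
    have u0 : s * (s * (2 + q)) = e * (2 + q) by rewrite mulrA -expr2 ss.
    have u1 : s * (2 * (l k * m k - D)) <= s * (s * (2 + q)).
      by rewrite u0; lra.
    have u2 : s * (- (2 * (l k * m k - D))) <= s * (s * (2 + q)).
      by rewrite u0; lra.
    by rewrite ler_pM2l// in u1; rewrite ler_pM2l// in u2; rewrite ler_norml; apply/andP; split; lra.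
  have -> : 1 ^+ 2 * q + 2 * (1 * - m k) * D + (- m k) ^+ 2 * qform gamma l - (q - m k ^+ 2)
    = 2 * m k * (l k * m k - D) + m k ^+ 2 * (2 * (1 - l k) - (1 - qform gamma l)) by ring.
  apply: le_trans (ler_normD _ _) _; apply: lerD.
    rewrite !normrM (ger0_norm (ler0n _ _)) -mulrA mulrCA mulrC.
    have -> : Num.sqrt e * (`|m k| * (2 + q)) = (s * (2 + q) / 2) * 2 * `|m k| by rewrite -/s; field.
    by rewrite ler_wpM2r// mulrC ler_wpM2r.
  rewrite normrM (ger0_norm (sqr_ge0 _)) (_ : 3 * m k ^+ 2 * e = m k ^+ 2 * (3 * e)); last by ring.
  rewrite ler_wpM2l ?sqr_ge0//.
  by rewrite ler_norml; apply/andP; split; lra.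
apply/cvgrPdist_le => e e0.
have cb : Num.sqrt (opt_eps n) * (`|m k| * (2 + q)) + 3 * m k ^+ 2 * opt_eps n @[n --> \oo] --> (0 : R).
  rewrite -[X in _ --> X]addr0; apply: cvgD.
    rewrite -(mul0r (`|m k| * (2 + q))); apply: cvgM; last exact: cvg_cst.
    rewrite -sqrtr0; apply: continuous_cvg; [exact: sqrt_continuous|exact: opt_eps_cvg0].
  rewrite -(mulr0 (3 * m k ^+ 2)); apply: cvgM; [exact: cvg_cst|exact: opt_eps_cvg0].
near=> n; rewrite distrC; apply: le_trans (bound n) _.
by near: n; move/cvgrPdist_le : cb => /(_ e e0); apply: filterS => n; rewrite sub0r normrN; exact/le_trans/ler_norm.
Unshelve. all: by end_near. Qed.

Let Phi (z : BX * measurableTypeR R) : X := ((z.1 : X) - opt_lim z.1 *: k) + z.2 *: k.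

(** The functionals [m - m k * opt_seq n] are Gaussian with known variance, and bounded convergence
    carries their characteristic functions to the limit. *)
Lemma factor_cos (m : X -> R) c : is_clf m ->
  \int[gamma]_(y in [set: BX]) cos (m y - opt_lim y * m k + c) =
  cos c * expR (- (qform gamma m - m k ^+ 2) / 2).
Proof.
move=> hm; have mm := clf_borel hm.
have ho n : is_clf (fun x => m x - m k * opt_seq n x).
  by have [h _ _] := opt_seqP n; apply: clf_sub => //; exact: clf_scale.
have [||||| _ c1] := @Rintegral_dominated_cvg _ _ _ gamma [set: BX]
  (fun n y => cos (m y - m k * opt_seq n y + c)) (fun y => cos (m y - opt_lim y * m k + c))
  (cst 1) measurableT _ _ _ _ _.
- by move=> n; apply: (measurableT_comp (measurable_cosD c)); exact: (clf_borel (ho n)).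
- apply: (measurableT_comp (measurable_cosD c)); apply: measurable_funB => //.
  by apply: measurable_funM => //; exact: measurable_opt_lim.
- apply: filterS opt_limP => y h _; apply: continuous_cvg; first exact: continuous_cos.
  apply: cvgD; last exact: cvg_cst.
  apply: cvgB; first exact: cvg_cst.
  by rewrite mulrC; apply: cvgM; [exact: cvg_cst|exact: h].
- by move=> n y _; exact: norm_cos_le1.
- exact: finite_measure_integrable_cst.
have c2 : cos c * expR (- qform gamma (fun x => m x - m k * opt_seq n x) / 2) @[n --> \oo] -->
    cos c * expR (- (qform gamma m - m k ^+ 2) / 2).
  apply: cvgM; first exact: cvg_cst.
  apply: continuous_cvg; first exact: continuous_expR.
  by apply: cvgM; [apply: cvgN; exact: qform_opt_cvg|exact: cvg_cst].
apply: (cvg_unique (@Rhausdorff R) _ c2).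
rewrite (_ : (fun n => _) = fun n => \int[gamma]_(y in [set: BX]) cos (m y - m k * opt_seq n y + c)); last first.
  by apply/funext => n; have [_ ->] := clf_gauss hgauss (ho n).
exact: c1.
Qed.

(** The residual has lost exactly the variance [(l k)^2] in the direction of [l], and the
    independent Gaussian multiple of [k] restores it: the characteristic functions multiply to that
    of [gamma]. *)
Lemma factor_unit (f : X -> R) M : continuous f -> (forall x, `|f x| <= M) ->
  \int[gamma]_(y in [set: BX]) f y =
  \int[nu]_a \int[gamma]_(y in [set: BX]) f (((y : X) - opt_lim y *: k) + a *: k).
Proof.
move=> cf fM.
have mz1 : measurable_fun setT (fun z : BX * measurableTypeR R => opt_lim z.1).
  exact: (measurableT_comp measurable_opt_lim).
have lPhi l (hl : is_clf l) w : l (Phi w) = (l w.1 - opt_lim w.1 * l k) + w.2 * l k.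
  by rewrite /Phi (clfD _ _ hl) (clfB _ _ hl) !(clfZ _ _ hl).
have mPhi l : is_clf l -> measurable_fun setT (fun w => l (Phi w)).
  move=> hl; have ml := clf_borel hl.
  rewrite (_ : (fun w => _) = fun w : BX * measurableTypeR R => (l w.1 - opt_lim w.1 * l k) + w.2 * l k); last first.
    by apply/funext => w; exact: lPhi.
  apply: measurable_funD; last by apply: measurable_funM.
  by apply: measurable_funB; [exact: (measurableT_comp ml)|exact: measurable_funM].
have [|mf e] := @continuous_law _ _ _ _ (gamma \x nu)%E gamma Phi f M hsep mPhi _ cf fM.
  move=> l c hl.
  have mc := measurableT_comp (measurable_cosD c) (mPhi l hl).
  have [-> _] := Rintegral_fubini gamma nu mc (fun z => norm_cos_le1 _).
  have [_ ->] := clf_gauss hgauss hl.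
  transitivity (\int[gamma]_(y in [set: BX]) (cos (l y - opt_lim y * l k + c) * expR (- (l k) ^+ 2 / 2))).
    apply: eq_Rintegral => y _; rewrite -stdn_cos; apply: eq_Rintegral => a _.
    by rewrite [LHS]/= (lPhi l hl) /=; congr cos; ring.
  rewrite RintegralZr//; last first.
    apply: (bounded_integrable gamma (M := 1)) => [|x]; last exact: norm_cos_le1.
    apply: (measurableT_comp (measurable_cosD c)); apply: measurable_funB; first exact: clf_borel.
    by apply: measurable_funM => //; exact: measurable_opt_lim.
  rewrite factor_cos// -mulrA -expRD; congr (_ * expR _); by field.
by rewrite -e; have [_ ->] := Rintegral_fubini gamma nu mf (fun z => fM _).
Qed.

End Approximation.

(** The weak form [hnorm gamma h0 <= 1] admits [h = 0], served by [h0 = 0] and the identity;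
    otherwise [h0] is the normalized vector. *)
Lemma cm_factorization (h : X) : inH gamma h ->
  exists (Psi : BX -> X) (h0 : X), [/\ h = hnorm gamma h *: h0,
    inH gamma h0 /\ hnorm gamma h0 <= 1, forall l, is_clf l -> measurable_fun setT (fun y => l (Psi y)) &
    forall (f : X -> R) M, continuous f -> (forall x, `|f x| <= M) ->
      \int[gamma]_(y in [set: BX]) f y =
      \int[nu]_a \int[gamma]_(y in [set: BX]) f (Psi y + a *: h0)].
Proof.
move=> hh; have [h0|hn0] := eqVneq (hnorm gamma h) 0.
  exists (fun y : BX => y : X), 0; split.
  - by rewrite scaler0 (hnorm_eq0 hgauss hh h0).
  - by split; [exact: (inH0 hgauss)|rewrite (hnorm0 hgauss) ler01].
  - by move=> l hl; exact: clf_borel.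
  - move=> f M cf fM; under [RHS]eq_Rintegral do under eq_Rintegral do rewrite scaler0 addr0.
    by rewrite Rintegral_stdn_cst.
pose k := (hnorm gamma h)^-1 *: h.
have hk : inH gamma k by exact: inH_scale.
have k1 : hnorm gamma k = 1.
  by rewrite (hnorm_scale hgauss)// ger0_norm ?invr_ge0 ?hnorm_ge0// mulVf.
exists (fun y : BX => (y : X) - opt_lim hk k1 y *: k), k; split.
- by rewrite /k scalerA mulfV// scale1r.
- by split=> //; rewrite k1.
- move=> l hl; rewrite (_ : (fun y => _) = fun y : BX => l y - opt_lim hk k1 y * l k); last first.
    by apply/funext => y; rewrite clfB// clfZ.
  apply: measurable_funB; first exact: clf_borel.
  by apply: measurable_funM => //; exact: measurable_opt_lim.
- by move=> f M cf fM; exact: (factor_unit hk k1 cf fM).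
Qed.

End Rotation.

(** * Derivatives of the Ornstein-Uhlenbeck semigroup *)

Section SequentialContinuity.
Context {R : realType} {V : normedModType R}.

(** Dominated convergence speaks of sequences, whereas continuity is stated with neighbourhoods;
    this is the bridge. *)
Lemma seq_eps_delta (F : V -> R) (x : V) :
  (forall y : nat -> V, y n @[n --> \oo] --> x -> F (y n) @[n --> \oo] --> (0 : R)) ->
  forall e, 0 < e -> exists d, 0 < d /\ forall y, `|y - x| < d -> `|F y| <= e.
Proof.
move=> h e e0; apply: contrapT => nd.
have ex n : exists y, `|y - x| < n.+1%:R^-1 /\ e < `|F y|.
  apply: contrapT => ny; apply: nd; exists (n.+1%:R^-1); split=> [|y yx]; first by rewrite invr_gt0.
  by rewrite leNgt; apply/negP => ey; apply: ny; exists y.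
pose y n := projT1 (cid (ex n)).
have yP n : `|y n - x| < n.+1%:R^-1 /\ e < `|F (y n)| by rewrite /y; case: cid.
have /h/cvgr0_norm_le : y n @[n --> \oo] --> x.
  apply/cvgrPdist_lt => d d0; near=> n; rewrite distrC (lt_trans (yP n).1)//.
  by near: n; exact: (near_infty_natSinv_lt (PosNum d0)).
move=> /(_ e e0)[N _ /(_ N (leqnn N))] /=.
by rewrite leNgt (yP N).2.
Unshelve. all: by end_near. Qed.

Lemma seq_continuous (F : V -> R) (x : V) :
  (forall y : nat -> V, y n @[n --> \oo] --> x -> F (y n) @[n --> \oo] --> F x) ->
  {for x, continuous F}.
Proof.
move=> h; apply/cvgrPdist_le => e e0.
have [|d [d0 hd]] := @seq_eps_delta (fun y => F y - F x) x _ e e0.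
  move=> y yx; rewrite -(subrr (F x)); apply: cvgB; [exact: h|exact: cvg_cst].
near=> y; rewrite distrC; apply: hd; rewrite distrC; near: y; exact: cvgr_dist_lt.
Unshelve. all: by end_near. Qed.

End SequentialContinuity.

Section DirectionalDerivative.
Context {R : realType} {X : completeNormedModType R}.

(** A junk value unless the difference quotients converge. *)
Definition ddir (F : X -> R) (h x : X) : R :=
  limn (fun n => n.+1%:R * (F (x + n.+1%:R^-1 *: h) - F x)).

Lemma cvg_harmonicR : n.+1%:R^-1 @[n --> \oo] --> (0 : R).
Proof. exact: cvg_harmonic. Qed.

Lemma ddirP (F : X -> R) (h x : X) (L C : R) :
  (forall s : R, `|F (x + s *: h) - F x - s * L| <= C * s ^+ 2) ->
  n.+1%:R * (F (x + n.+1%:R^-1 *: h) - F x) @[n --> \oo] --> L /\ ddir F h x = L.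
Proof.
move=> hF; suff c : n.+1%:R * (F (x + n.+1%:R^-1 *: h) - F x) @[n --> \oo] --> L.
  by split=> //; apply/cvg_lim.
have C0 : 0 <= C by have := hF 1; rewrite expr1n mulr1; exact: le_trans.
have b n : `|L - n.+1%:R * (F (x + n.+1%:R^-1 *: h) - F x)| <= C * n.+1%:R^-1.
  have n0 : n.+1%:R != 0 :> R by [].
  have -> : L - n.+1%:R * (F (x + n.+1%:R^-1 *: h) - F x) =
    - (n.+1%:R * (F (x + n.+1%:R^-1 *: h) - F x - n.+1%:R^-1 * L)).
    by field; rewrite nat1r.
  rewrite normrN normrM ger0_norm//.
  apply: (@le_trans _ _ (n.+1%:R * (C * n.+1%:R^-1 ^+ 2))); first by rewrite ler_wpM2l.
  by rewrite le_eqVlt; apply/orP; left; apply/eqP; field; rewrite nat1r.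
have c0 : C * n.+1%:R^-1 @[n --> \oo] --> (0 : R).
  by rewrite -(mulr0 C); apply: cvgM; [exact: cvg_cst|exact: cvg_harmonicR].
apply/cvgrPdist_le => e e0; near=> n; apply: le_trans (b n) _; apply: le_trans (ler_norm _) _.
near: n; move/cvgrPdist_le : c0 => /(_ e e0); apply: filterS => n.
by rewrite sub0r normrN.
Unshelve. all: by end_near. Qed.

Definition cbdd (f : X -> R) (M : R) := continuous f /\ forall x, `|f x| <= M.

Lemma cbdd_ge0 f M : cbdd f M -> 0 <= M.
Proof. by move=> [_ h]; exact: le_trans (h 0). Qed.

Lemma cbdd_affine f M (v : X) (a : R) : cbdd f M -> cbdd (fun y => f (v + a *: y)) M.
Proof.
move=> [cf fM]; split=> // y.
apply: (@continuous_comp _ _ _ (fun y => v + a *: y)); last exact: cf.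
by apply: cvgD; [exact: cvg_cst|apply: cvgZr; exact: cvg_id].
Qed.

Lemma cbdd_shift f M (v : X) : cbdd f M -> cbdd (fun y => f (y + v)) M.
Proof.
move=> [cf fM]; split=> // y.
by apply: (@continuous_comp _ _ _ (fun y => y + v)); [apply: cvgD; [exact: cvg_id|exact: cvg_cst]|exact: cf].
Qed.

Lemma cbdd_lin f g M N (a : R) : cbdd f M -> cbdd g N -> cbdd (fun y => a * f y + g y) (`|a| * M + N).
Proof.
move=> [cf fM] [cg gN]; split=> [y|y].
  by apply: cvgD; [apply: cvgM; [exact: cvg_cst|exact: cf]|exact: cg].
by apply: le_trans (ler_normD _ _) _; rewrite lerD// normrM ler_wpM2l.
Qed.

Lemma cbdd_sqr f M : cbdd f M -> cbdd (fun y => f y ^+ 2) (M ^+ 2).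
Proof.
move=> [cf fM]; split=> [y|y].
  by apply: (@continuous_comp _ _ _ f (fun z => z ^+ 2)); [exact: cf|exact: exprn_continuous].
by rewrite normrX lerXn2r ?nnegrE// (le_trans _ (fM y)).
Qed.

End DirectionalDerivative.

(** * Semigroup law and expansion along H *)

Section OrnsteinUhlenbeck.
Context {R : realType} {X : completeNormedModType R}.
Variable gamma : probability (@borelX R X) R.
Hypothesis hsep : @separable R X.
Hypothesis hgauss : centered_gaussian gamma.
Notation nu := (@stdn R).
Notation BX := (@borelX R X).
Notation OUg := (OU gamma).
Notation hn := (hnorm gamma).
Implicit Types (t s r a b : R).

Definition ou_s (t : R) : R := Num.sqrt (1 - expR (- (2 * t))).
(** [e^{-t} h = ou_s t *: (ou_c t *: h)]: a shift of the starting point by [h] is a shift of the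
    Gaussian variable by [ou_c t *: h]. *)
Definition ou_c (t : R) : R := expR (- t) / ou_s t.

Lemma OUE t f x : OUg t f x =
  \int[gamma]_(y in [set: BX]) f (expR (- t) *: x + ou_s t *: (y : X)).
Proof. by []. Qed.

Lemma ou_s_gt0 t : 0 < t -> 0 < ou_s t.
Proof. by move=> t0; rewrite sqrtr_gt0 subr_gt0 -[ltRHS]expR0 ltr_expR; lra. Qed.

Lemma ou_s_sqr t : 0 <= t -> ou_s t ^+ 2 = 1 - expR (- t) ^+ 2.
Proof.
move=> t0; rewrite sqr_sqrtr; last by rewrite subr_ge0 -[leRHS]expR0 ler_expR; lra.
by rewrite expr2 -expRD; congr (_ - expR _); ring.
Qed.

Lemma ou_c_gt0 t : 0 < t -> 0 < ou_c t.
Proof. by move=> t0; rewrite divr_gt0 ?expR_gt0 ?ou_s_gt0. Qed.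

Lemma ou_cs t : 0 < t -> ou_c t * ou_s t = expR (- t).
Proof. by move=> t0; rewrite divfK// gt_eqF// ou_s_gt0. Qed.

Lemma cbdd_integrable f M : cbdd f M -> gamma.-integrable [set: BX] (EFin \o f).
Proof.
by move=> [cf fM]; apply: (bounded_integrable gamma (M := M)) => //; exact: continuous_borel_measurable.
Qed.

Lemma cbdd_integral_le f M : cbdd f M -> `|\int[gamma]_(y in [set: BX]) f y| <= M.
Proof.
move=> hf; have i := cbdd_integrable hf.
apply: le_trans (le_normr_Rintegral measurableT i) _.
rewrite -[leRHS](Rintegral_prob_cst gamma); apply: le_Rintegral => //.
- exact: integrable_norm i.
- exact: finite_measure_integrable_cst.
- by move=> x _; case: hf.
Qed.

Lemma prob_jensen d (T : measurableType d) (P : probability T R) (f : T -> R) M :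
  measurable_fun setT f -> (forall x, `|f x| <= M) ->
  (\int[P]_x f x) ^+ 2 <= \int[P]_x (f x ^+ 2).
Proof.
move=> mf fM; set m := \int[P]_x f x.
have i1 := bounded_integrable P mf fM.
have i2 : P.-integrable setT (EFin \o (fun x => f x ^+ 2)).
  apply: (bounded_integrable P (M := M ^+ 2)); first exact: measurable_funX.
  by move=> x; rewrite normrX lerXn2r ?nnegrE// (le_trans _ (fM x)).
have i3 : P.-integrable setT (EFin \o cst (m ^+ 2)) by exact: finite_measure_integrable_cst.
have : 0 <= \int[P]_x ((f x ^+ 2 + (- (2 * m)) * f x) + m ^+ 2).
  apply: Rintegral_ge0 => x _.
  have -> : (f x ^+ 2 + (- (2 * m)) * f x) + m ^+ 2 = (f x - m) ^+ 2 by ring.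
  exact: sqr_ge0.
have i1' := integrable_mulR (- (2 * m)) measurableT i1.
rewrite RintegralD//; last exact: integrable_addR.
rewrite RintegralD// RintegralZl// (Rintegral_prob_cst P) -/m; lra.
Qed.

Lemma OU_bound t f M x : cbdd f M -> `|OUg t f x| <= M.
Proof. by move=> hf; exact: cbdd_integral_le (cbdd_affine _ _ hf). Qed.

Lemma OU_lin t a f g M N x : cbdd f M -> cbdd g N ->
  OUg t (fun y => a * f y + g y) x = a * OUg t f x + OUg t g x.
Proof.
move=> hf hg; rewrite !OUE.
have i1 := cbdd_integrable (cbdd_affine (expR (- t) *: x) (ou_s t) hf).
have i2 := cbdd_integrable (cbdd_affine (expR (- t) *: x) (ou_s t) hg).
rewrite RintegralD//; last exact: integrable_mulR.
by rewrite RintegralZl.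
Qed.

Lemma OU_le t f g M N x : cbdd f M -> cbdd g N -> (forall y, f y <= g y) ->
  OUg t f x <= OUg t g x.
Proof.
move=> hf hg fg; rewrite !OUE; apply: le_Rintegral => //.
- exact: cbdd_integrable (cbdd_affine _ _ hf).
- exact: cbdd_integrable (cbdd_affine _ _ hg).
Qed.

Lemma OU_continuous t f M : cbdd f M -> continuous (OUg t f).
Proof.
move=> hf x; apply: seq_continuous => y yx.
have [|||_ c] := @bounded_Rintegral_cvg _ _ _ gamma
  (fun n z => f (expR (- t) *: y n + ou_s t *: (z : X)))
  (fun z => f (expR (- t) *: x + ou_s t *: (z : X))) M; last exact: c.
- by move=> n; apply: continuous_borel_measurable; case: (cbdd_affine (expR (- t) *: y n) (ou_s t) hf).
- by move=> n z; case: hf.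
- move=> z; apply: continuous_cvg; first exact: (hf.1 _).
  by apply: cvgD; [apply: cvgZr; exact: yx|exact: cvg_cst].
Qed.

Lemma cbdd_OU t f M : cbdd f M -> cbdd (OUg t f) M.
Proof. by move=> hf; split=> [|x]; [exact: OU_continuous hf|exact: OU_bound]. Qed.

(** The two Gaussian variables enter with coefficients whose squares sum to [ou_s (s + r) ^+ 2];
    after division by [ou_s (s + r)], rotation invariance merges them into one. *)
Lemma OU_add s r f M x : 0 < s -> 0 < r -> cbdd f M ->
  OUg s (OUg r f) x = OUg (s + r) f x.
Proof.
move=> s0 r0 hf.
have sr0 : 0 < s + r by exact: addr_gt0.
have S0 := ou_s_gt0 sr0; set S := ou_s (s + r) in S0 *.
pose a := expR (- r) * ou_s s / S; pose b := ou_s r / S.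
have ab : a ^+ 2 + b ^+ 2 = 1.
  have SS : S ^+ 2 = 1 - (expR (- s) * expR (- r)) ^+ 2.
    by rewrite ou_s_sqr ?ltW// opprD expRD.
  have : (expR (- r) * ou_s s) ^+ 2 + ou_s r ^+ 2 = S ^+ 2.
    by rewrite exprMn SS !ou_s_sqr ?ltW//; ring.
  have -> : a ^+ 2 + b ^+ 2 = ((expR (- r) * ou_s s) ^+ 2 + ou_s r ^+ 2) / S ^+ 2.
    by rewrite /a /b; field; rewrite gt_eqF.
  by move=> ->; rewrite divff// expf_neq0// gt_eqF.
pose f' := fun w : X => f (expR (- (s + r)) *: x + S *: w).
have [cf' f'M] : cbdd f' M by exact: cbdd_affine.
rewrite [RHS]OUE -/S -[RHS](gauss_rotate hsep hgauss ab cf' f'M) OUE.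
apply: eq_Rintegral => y _; rewrite OUE; apply: eq_Rintegral => z _.
rewrite /f'; congr f; rewrite !scalerDr !scalerA addrA; congr (_ *: _ + _ *: _ + _ *: _).
- by rewrite -expRD; congr expR; ring.
- by rewrite /a mulrCA mulfV ?gt_eqF// mulr1.
- by rewrite /b mulrCA mulfV ?gt_eqF// mulr1.
Qed.

Definition ou_C : R := @gauss_C R + 3.

Lemma ou_C_ge : 3 <= ou_C.
Proof. by rewrite /ou_C lerDr gauss_C_ge0. Qed.

Lemma powR_le al a b : 0 <= al -> 0 <= a -> a <= b -> a `^ al <= b `^ al.
Proof.
move=> al0 a0 ab; apply: (ge0_ler_powR al0); rewrite ?nnegrE//.
exact: le_trans ab.
Qed.

(** All three estimates concern the same [L = c |h|_H \int g(b) b], where [g] averages [f] over the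
    part [Psi] of the Gaussian variable. The second is kept in mean-square form, Bessel followed by
    Jensen, because it will be applied to differences of [f] that are small only on average. *)
Lemma OU_taylor_exists t h f M x : 0 < t -> inH gamma h -> cbdd f M ->
  exists L, [/\ forall s : R, `|OUg t f (x + s *: h) - OUg t f x - s * L|
       <= ou_C * M * (ou_c t * hn h) ^+ 2 * s ^+ 2,
    L ^+ 2 <= (ou_c t * hn h) ^+ 2 * OUg t (fun y => f y ^+ 2) x &
    forall K alpha : R, 0 < alpha < 1 -> 0 <= K ->
      (forall z k, inH gamma k -> `|f (z + k) - f z| <= K * hn k `^ alpha) ->
      `|L| <= 2 * K * ou_s t `^ alpha * (ou_c t * hn h)].
Proof.
move=> t0 hh hf; have [Psi [h0 [hE [hh0 hn0] mPsi law]]] := cm_factorization hsep hgauss hh.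
set s := ou_s t; set c := ou_c t; set v := expR (- t) *: x.
have s0 : 0 < s by exact: ou_s_gt0.
have c0 : 0 < c by exact: ou_c_gt0.
have M0 := cbdd_ge0 hf.
pose G (b : R) (w : X) := f (v + s *: (w + b *: h0)).
have hG b : cbdd (G b) M.
  by have := cbdd_shift (b *: h0) (cbdd_affine v s hf).
(* [Psi] is measurable through functionals only, hence the detour by [trigcl]. *)
have mG b : measurable_fun setT (fun y : BX => G b (Psi y)).
  by case: (hG b) => cG GM; exact: (trigcl_measurable mPsi (continuous_trigcl hsep cG GM)).
have GM b (y : BX) : `|G b (Psi y)| <= M by case: (hG b).
pose g (b : R) := \int[gamma]_(y in [set: BX]) G b (Psi y).
have iG b := bounded_integrable gamma (mG b) (GM b).
have gM b : `|g b| <= M.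
  apply: le_trans (le_normr_Rintegral measurableT (iG b)) _.
  rewrite -[leRHS](Rintegral_prob_cst gamma); apply: le_Rintegral => //.
  - exact: integrable_norm (iG b).
  - exact: finite_measure_integrable_cst.
have cGb (bn : nat -> R) b (y : BX) : bn n @[n --> \oo] --> b ->
    G (bn n) (Psi y) @[n --> \oo] --> G b (Psi y).
  move=> bnb; rewrite /G; apply: continuous_cvg; first exact: (hf.1 _).
  apply: cvgD; first exact: cvg_cst.
  apply: cvgZr; apply: cvgD; first exact: cvg_cst.
  by apply: cvgZl; exact: bnb.
have cg : continuous g.
  move=> b; apply: seq_continuous => bn bnb.
  have [|||_ cc] := @bounded_Rintegral_cvg _ _ _ gamma (fun n y => G (bn n) (Psi y)) (fun y => G b (Psi y)) M; last exact: cc.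
  - by move=> n; exact: mG.
  - by move=> n y; exact: GM.
  - by move=> y; exact: cGb.
have mg := continuous_measurable_fun cg.
(* Since [exp (- t) = c * s], the displacement along [h] is absorbed by translating the scalar
   variable [b]. *)
have OUs (u : R) : OUg t f (x + u *: h) = \int[nu]_b g (b + u * (c * hn h)).
  rewrite OUE -/s.
  have [cf1 f1M] := cbdd_affine (expR (- t) *: (x + u *: h)) s hf.
  rewrite (law _ M cf1 f1M); apply: eq_Rintegral => b _; apply: eq_Rintegral => y _.
  rewrite /G scalerDr -addrA; congr (f (_ + _)).
  rewrite [in LHS]hE !scalerDr !scalerA addrCA; congr (_ + _).
  rewrite mulrDr scalerDl addrC; congr (_ + _ *: _).
  by rewrite -(ou_cs t0) -/c -/s; ring.
have OU0 : OUg t f x = \int[nu]_b g b.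
  have := OUs 0; rewrite scale0r addr0 => ->.
  by apply: eq_Rintegral => b _; rewrite mul0r addr0.
exists (c * hn h * \int[nu]_b (g b * b)); split.
- move=> u; rewrite OUs OU0 mulrA.
  have := stdn_taylor (u * (c * hn h)) cg gM.
  by rewrite -/ou_C exprMn (mulrC (u ^+ 2)) !mulrA.
- rewrite exprMn ler_wpM2l ?sqr_ge0//; apply: le_trans (stdn_cauchy mg gM) _.
  have [cf2 f2M] := cbdd_affine v s (cbdd_sqr hf).
  rewrite OUE -/v -/s (law _ _ cf2 f2M); apply: le_Rintegral => //.
  + apply: (integrable_stdn_bounded (M := M ^+ 2)); first exact: measurable_funX.
    by move=> b; rewrite normrX lerXn2r ?nnegrE.
  + apply: (integrable_stdn_bounded (M := M ^+ 2)).
      apply: continuous_measurable_fun => b; apply: seq_continuous => bn bnb.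
      have [|||_ cc] := @bounded_Rintegral_cvg _ _ _ gamma (fun n y => G (bn n) (Psi y) ^+ 2)
          (fun y => G b (Psi y) ^+ 2) (M ^+ 2); last exact: cc.
      * by move=> n; exact: measurable_funX.
      * by move=> n y; rewrite normrX lerXn2r ?nnegrE.
      * by move=> y; exact: (cvgM (cGb _ _ y bnb) (cGb _ _ y bnb)).
    move=> b; have h2 : cbdd (fun w => G b w ^+ 2) (M ^+ 2) by exact: cbdd_sqr.
    have m2 : measurable_fun setT (fun y : BX => G b (Psi y) ^+ 2) by exact: measurable_funX.
    have i2 := bounded_integrable gamma m2 (fun y => h2.2 (Psi y)).
    apply: le_trans (le_normr_Rintegral measurableT i2) _.
    rewrite -[leRHS](Rintegral_prob_cst gamma); apply: le_Rintegral => //.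
    * exact: integrable_norm i2.
    * exact: finite_measure_integrable_cst.
    * by move=> y _; exact: (h2.2 (Psi y)).
  + by move=> b _; exact: (prob_jensen gamma (mG b) (GM b)).
- move=> K al /andP[al0 al1] K0 hK.
  have cs0 : 0 <= c * hn h by apply: mulr_ge0; [exact: ltW|exact: hnorm_ge0].
  rewrite normrM (ger0_norm cs0) mulrC ler_wpM2r//.
  have gd b : `|g b - g 0| <= K * (s `^ al * `|b| `^ al).
    rewrite /g -RintegralB//.
    have ii := integrable_subR measurableT (iG b) (iG 0).
    apply: le_trans (le_normr_Rintegral measurableT ii) _.
    rewrite -[leRHS](Rintegral_prob_cst gamma); apply: le_Rintegral => //.
    - exact: integrable_norm ii.
    - exact: finite_measure_integrable_cst.
    move=> y _; rewrite /G scale0r addr0 scalerDr addrA scalerA.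
    have hk : inH gamma ((s * b) *: h0) by exact: inH_scale.
    apply: le_trans (hK _ _ hk) _; rewrite ler_wpM2l//.
    rewrite -(powRM _ (ltW s0) (normr_ge0 b)); apply: powR_le; [exact: ltW|exact: hnorm_ge0|].
    by rewrite (hnorm_scale hgauss)// normrM (gtr0_norm s0) ler_piMr// mulr_ge0// ltW.
  have igx := integrable_stdn_boundedM mg gM.
  have ig0 := integrable_mulR (g 0) measurableT (@integrable_stdn_id R).
  (* The mean of [nu] is 0, so [g 0] may be subtracted. The final factor 2 is the integral of
     [1 + b^2], which dominates [|b|^al |b|]. *)
  have -> : \int[nu]_b (g b * b) = \int[nu]_b (g b * b - g 0 * b).
    by rewrite RintegralB// RintegralZl// ?stdn_mean ?mulr0 ?subr0//; exact: integrable_stdn_id.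
  have ii := integrable_subR measurableT igx ig0.
  apply: le_trans (le_normr_Rintegral measurableT ii) _.
  have i1 : nu.-integrable setT (EFin \o cst (1 : R)) by exact: finite_measure_integrable_cst.
  have iw := integrable_mulR (K * s `^ al) measurableT (integrable_addR measurableT i1 (@integrable_stdn_sqr R)).
  apply: (@le_trans _ _ (\int[nu]_b (K * s `^ al * (1 + b * b)))); last first.
    rewrite RintegralZl//; last exact: (integrable_addR measurableT i1 (@integrable_stdn_sqr R)).
    rewrite RintegralD//; last exact: integrable_stdn_sqr.
    by rewrite Rintegral_stdn_cst stdn_var le_eqVlt; apply/orP; left; apply/eqP; ring.
  apply: le_Rintegral => //; first exact: integrable_norm ii.
  move=> b _; rewrite -mulrBl normrM.
  apply: le_trans (ler_wpM2r (normr_ge0 b) (gd b)) _.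
  rewrite (_ : K * (s `^ al * `|b| `^ al) * `|b| = K * s `^ al * (`|b| `^ al * `|b|)); last by ring.
  rewrite ler_wpM2l ?mulr_ge0 ?powR_ge0//.
  have b2 : `|b| * `|b| = b * b by rewrite -normrM ger0_norm// -expr2 sqr_ge0.
  have [b1|b1] := leP `|b| 1.
    have pb : `|b| `^ al <= 1.
      by have := powR_le (ltW al0) (normr_ge0 b) b1; rewrite powR1.
    apply: (@le_trans _ _ 1); last by rewrite -b2 lerDl mulr_ge0.
    by rewrite mulr_ile1 ?powR_ge0.
  have pb : `|b| `^ al <= `|b|.
    by rewrite -[leRHS]powRr1// ler_powR// ltW.
  apply: le_trans (ler_wpM2r (normr_ge0 b) pb) _.
  by rewrite b2 lerDr.
Qed.

End OrnsteinUhlenbeck.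

Lemma cvg_continuous_seq {R : realType} {V : normedModType R} (F : V -> R) (z : nat -> V) (x : V) :
  continuous F -> z n @[n --> \oo] --> x -> F (z n) @[n --> \oo] --> F x.
Proof. by move=> cF zx; apply: continuous_cvg => //; exact: cF. Qed.

(** * First and second derivatives of the semigroup *)

Section OUDerivatives.
Context {R : realType} {X : completeNormedModType R}.
Variable gamma : probability (@borelX R X) R.
Hypothesis hsep : @separable R X.
Hypothesis hgauss : centered_gaussian gamma.
Notation BX := (@borelX R X).
Notation OUg := (OU gamma).
Notation hn := (hnorm gamma).
Notation C := (@ou_C R).
Implicit Types (t s r a b : R) (f g : X -> R) (h k x y : X).

Definition ouD1 t h f : X -> R := ddir (OUg t f) h.
(** Differentiated along [h] first, then along [k]. *)
Definition ouD2 t h k f : X -> R := ddir (ouD1 t h f) k.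

Lemma normr_le_of_sqr a b : 0 <= b -> a ^+ 2 <= b ^+ 2 -> `|a| <= b.
Proof. by move=> b0 h; rewrite -(@ler_sqr _ `|a| b) ?nnegrE// real_normK ?num_real. Qed.

Lemma hn_ge0 h : 0 <= hn h. Proof. exact: (hnorm_ge0 hgauss). Qed.

Lemma chn_ge0 t h : 0 < t -> 0 <= ou_c t * hn h.
Proof. by move=> t0; apply: mulr_ge0; [apply: ltW; exact: ou_c_gt0|exact: hn_ge0]. Qed.

Lemma ouD1_spec t h f M x : 0 < t -> inH gamma h -> cbdd f M ->
  [/\ forall s, `|OUg t f (x + s *: h) - OUg t f x - s * ouD1 t h f x|
        <= C * M * (ou_c t * hn h) ^+ 2 * s ^+ 2,
    n.+1%:R * (OUg t f (x + n.+1%:R^-1 *: h) - OUg t f x) @[n --> \oo] --> ouD1 t h f x,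
    ouD1 t h f x ^+ 2 <= (ou_c t * hn h) ^+ 2 * OUg t (fun y => f y ^+ 2) x &
    forall K alpha : R, 0 < alpha < 1 -> 0 <= K ->
      (forall z k, inH gamma k -> `|f (z + k) - f z| <= K * hn k `^ alpha) ->
      `|ouD1 t h f x| <= 2 * K * ou_s t `^ alpha * (ou_c t * hn h)].
Proof.
move=> t0 hh hf; have [L [L1 L2 L3]] := OU_taylor_exists hsep hgauss x t0 hh hf.
by have [c e] := ddirP L1; rewrite /ouD1 e.
Qed.

Lemma ouD1_uniq t h f x (L C0 : R) :
  (forall s, `|OUg t f (x + s *: h) - OUg t f x - s * L| <= C0 * s ^+ 2) -> ouD1 t h f x = L.
Proof. by move=> hL; have [_] := ddirP hL. Qed.

Lemma ouD1_le t h f M x : 0 < t -> inH gamma h -> cbdd f M ->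
  `|ouD1 t h f x| <= ou_c t * hn h * M.
Proof.
move=> t0 hh hf; have [_ _ h3 _] := ouD1_spec x t0 hh hf.
have M0 := cbdd_ge0 hf; have cn := chn_ge0 h t0.
apply: normr_le_of_sqr; first exact: mulr_ge0.
apply: le_trans h3 _; rewrite [leRHS]exprMn ler_wpM2l ?sqr_ge0//.
by apply: le_trans (ler_norm _) _; exact: OU_bound (cbdd_sqr hf).
Qed.

(** The difference quotients are continuous and converge at the rate [B / n.+1], uniformly in the
    point. *)
Lemma ouD1_continuous t h f M : 0 < t -> inH gamma h -> cbdd f M -> continuous (ouD1 t h f).
Proof.
move=> t0 hh hf x.
set B := C * M * (ou_c t * hn h) ^+ 2.
have B0 : 0 <= B.
  rewrite mulr_ge0 ?sqr_ge0// mulr_ge0 ?(cbdd_ge0 hf)//.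
  exact: le_trans ou_C_ge.
pose q n y := n.+1%:R * (OUg t f (y + n.+1%:R^-1 *: h) - OUg t f y).
have qA n y : `|q n y - ouD1 t h f y| <= B * n.+1%:R^-1.
  have [h1 _ _ _] := ouD1_spec y t0 hh hf; have := h1 (n.+1%:R^-1).
  have n0 : n.+1%:R != 0 :> R by [].
  have -> : q n y - ouD1 t h f y =
    n.+1%:R * (OUg t f (y + n.+1%:R^-1 *: h) - OUg t f y - n.+1%:R^-1 * ouD1 t h f y).
    by rewrite /q; field; rewrite nat1r.
  rewrite normrM ger0_norm// -/B => hb.
  apply: (@le_trans _ _ (n.+1%:R * (B * n.+1%:R^-1 ^+ 2))); first by rewrite ler_wpM2l.
  by rewrite le_eqVlt; apply/orP; left; apply/eqP; field; rewrite nat1r.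
have cq n : continuous (q n).
  have cT := @OU_continuous _ _ gamma t f M hf.
  move=> y; apply: cvgM; first exact: cvg_cst.
  apply: cvgB; last exact: cT.
  apply: (@continuous_comp _ _ _ (fun y => y + n.+1%:R^-1 *: h)); last exact: cT.
  by apply: cvgD; [exact: cvg_id|exact: cvg_cst].
apply/cvgrPdist_le => e e0.
have c0 : B * n.+1%:R^-1 @[n --> \oo] --> (0 : R).
  by rewrite -(mulr0 B); apply: cvgM; [exact: cvg_cst|exact: cvg_harmonicR].
have e3 : 0 < e / 3 by rewrite divr_gt0.
move/cvgrPdist_le : c0 => /(_ _ e3)[n _ /(_ n (leqnn n))] /=.
rewrite sub0r normrN ger0_norm ?divr_ge0// => Bn.
near=> y.
have qxy : `|q n x - q n y| <= e / 3 by near: y; apply: cvgr_dist_le => //; exact: cq.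
have -> : ouD1 t h f x - ouD1 t h f y = - (q n x - ouD1 t h f x) + (q n x - q n y) + (q n y - ouD1 t h f y).
  by ring.
apply: le_trans (ler_normD _ _) _; apply: le_trans (lerD (ler_normD _ _) (lexx _)) _.
have h1 := le_trans (qA n x) Bn; have h2 := le_trans (qA n y) Bn.
rewrite normrN (_ : e = e / 3 + e / 3 + e / 3); last by field.
by rewrite !lerD.
Unshelve. all: by end_near. Qed.

Lemma cbdd_ouD1 t h f M : 0 < t -> inH gamma h -> cbdd f M ->
  cbdd (ouD1 t h f) (ou_c t * hn h * M).
Proof. by move=> t0 hh hf; split=> [|x]; [exact: ouD1_continuous hf|exact: ouD1_le]. Qed.

Lemma cbdd_weaken f M N : cbdd f M -> (forall x, `|f x| <= N) -> cbdd f N.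
Proof. by move=> [cf _] fN. Qed.

Lemma ouD1_linf t a h f g M N x : 0 < t -> inH gamma h -> cbdd f M -> cbdd g N ->
  ouD1 t h (fun y => a * f y + g y) x = a * ouD1 t h f x + ouD1 t h g x.
Proof.
move=> t0 hh hf hg.
have [h1 _ _ _] := ouD1_spec x t0 hh hf; have [h2 _ _ _] := ouD1_spec x t0 hh hg.
apply: (@ouD1_uniq _ _ _ _ _ (`|a| * (C * M * (ou_c t * hn h) ^+ 2) + C * N * (ou_c t * hn h) ^+ 2)) => s.
rewrite !(OU_lin _ _ _ _ hf hg).
have -> : a * OUg t f (x + s *: h) + OUg t g (x + s *: h) - (a * OUg t f x + OUg t g x) -
   s * (a * ouD1 t h f x + ouD1 t h g x) =
   a * (OUg t f (x + s *: h) - OUg t f x - s * ouD1 t h f x) +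
   (OUg t g (x + s *: h) - OUg t g x - s * ouD1 t h g x) by ring.
apply: le_trans (ler_normD _ _) _; rewrite [leRHS]mulrDl; apply: lerD; last exact: h2.
by rewrite normrM -[leRHS]mulrA ler_wpM2l.
Qed.

(** The expansion holds along lines only, so the step along [a *: h + k] is split into one along [h]
    and one along [k] from the moved point [z n]; continuity of the derivative brings that point
    back to [x]. *)
Lemma ouD1_linh t a h k f M x : 0 < t -> inH gamma h -> inH gamma k -> cbdd f M ->
  ouD1 t (a *: h + k) f x = a * ouD1 t h f x + ouD1 t k f x.
Proof.
move=> t0 hh hk hf; have [hhk _] := inH_lin hgauss a hh hk.
have [_ c _ _] := ouD1_spec x t0 hhk hf.
apply: (cvg_unique (@Rhausdorff R) c).
have hah := inH_scale hgauss a hh.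
set Bk := C * M * (ou_c t * hn k) ^+ 2; set Bh := C * M * (ou_c t * hn h) ^+ 2.
have C0 : 0 <= C by exact: le_trans ou_C_ge.
have Bk0 : 0 <= Bk by rewrite mulr_ge0 ?sqr_ge0// mulr_ge0 ?(cbdd_ge0 hf).
have Bh0 : 0 <= Bh by rewrite mulr_ge0 ?sqr_ge0// mulr_ge0 ?(cbdd_ge0 hf).
pose z n : X := x + (n.+1%:R^-1 * a) *: h.
have zx : z n @[n --> \oo] --> x.
  rewrite -[X in _ --> X]addr0; apply: cvgD; first exact: cvg_cst.
  rewrite -(scale0r h); apply: cvgZl; rewrite -(mul0r a).
  by apply: cvgM; [exact: cvg_harmonicR|exact: cvg_cst].
have cA : ouD1 t k f (z n) @[n --> \oo] --> ouD1 t k f x.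
  exact: (cvg_continuous_seq (ouD1_continuous t0 hk hf) zx).
pose e1 n := n.+1%:R * (OUg t f (z n) - OUg t f x) - a * ouD1 t h f x.
pose e2 n := n.+1%:R * (OUg t f (z n + n.+1%:R^-1 *: k) - OUg t f (z n)) - ouD1 t k f (z n).
have small (u : nat -> R) B : 0 <= B -> (forall n, `|u n| <= B * n.+1%:R^-1) -> u n @[n --> \oo] --> (0 : R).
  move=> B0 ub; apply/cvgrPdist_le => e e0.
  have c0 : B * n.+1%:R^-1 @[n --> \oo] --> (0 : R).
    by rewrite -(mulr0 B); apply: cvgM; [exact: cvg_cst|exact: cvg_harmonicR].
  move/cvgrPdist_le : c0 => /(_ _ e0); apply: filterS => n.
  by rewrite !sub0r !normrN [`|B * _|]ger0_norm ?mulr_ge0//; exact: le_trans.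
have e1c : e1 n @[n --> \oo] --> (0 : R).
  apply: (small _ (Bh * a ^+ 2)); first by rewrite mulr_ge0 ?sqr_ge0.
  move=> n; have [h1 _ _ _] := ouD1_spec x t0 hh hf; have := h1 (n.+1%:R^-1 * a).
  have n0 : n.+1%:R != 0 :> R by [].
  have -> : e1 n = n.+1%:R * (OUg t f (x + (n.+1%:R^-1 * a) *: h) - OUg t f x - n.+1%:R^-1 * a * ouD1 t h f x).
    by rewrite /e1 /z; field; rewrite nat1r.
  rewrite normrM ger0_norm// -/Bh => hb.
  apply: (@le_trans _ _ (n.+1%:R * (Bh * (n.+1%:R^-1 * a) ^+ 2))); first by rewrite ler_wpM2l.
  by rewrite le_eqVlt; apply/orP; left; apply/eqP; field; rewrite nat1r.
have e2c : e2 n @[n --> \oo] --> (0 : R).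
  apply: (small _ Bk) => // n; have [h1 _ _ _] := ouD1_spec (z n) t0 hk hf; have := h1 (n.+1%:R^-1).
  have n0 : n.+1%:R != 0 :> R by [].
  have -> : e2 n = n.+1%:R * (OUg t f (z n + n.+1%:R^-1 *: k) - OUg t f (z n) - n.+1%:R^-1 * ouD1 t k f (z n)).
    by rewrite /e2; field; rewrite nat1r.
  rewrite normrM ger0_norm// -/Bk => hb.
  apply: (@le_trans _ _ (n.+1%:R * (Bk * n.+1%:R^-1 ^+ 2))); first by rewrite ler_wpM2l.
  by rewrite le_eqVlt; apply/orP; left; apply/eqP; field; rewrite nat1r.
rewrite (_ : (fun n => _) = fun n => (e1 n + a * ouD1 t h f x) + (e2 n + ouD1 t k f (z n))); last first.
  apply/funext => n; rewrite /e1 /e2 !subrK /z scalerDr scalerA addrA; ring.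
suff : (e1 n + a * ouD1 t h f x) + (e2 n + ouD1 t k f (z n)) @[n --> \oo] -->
  (0 + a * ouD1 t h f x) + (0 + ouD1 t k f x) by rewrite !add0r.
by apply: cvgD; [apply: cvgD; [exact: e1c|exact: cvg_cst]|apply: cvgD; [exact: e2c|exact: cA]].
Qed.

(** Under [OU r], a shift of [x] by [h] becomes a shift by [exp (- r) h] inside the integral, where
    the expansion of [OU s f] holds uniformly. *)
Lemma ouD1_add s r h f M x : 0 < s -> 0 < r -> inH gamma h -> cbdd f M ->
  ouD1 (s + r) h f x = expR (- r) * OUg r (ouD1 s h f) x.
Proof.
move=> s0 r0 hh hf; rewrite addrC.
set B := C * M * (ou_c s * hn h) ^+ 2.
apply: (@ouD1_uniq _ _ _ _ _ (B * expR (- r) ^+ 2)) => u.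
have hT := cbdd_OU gamma s hf; have hA := cbdd_ouD1 s0 hh hf.
rewrite -!(OU_add hsep hgauss _ r0 s0 hf) !OUE.
set e := expR (- r).
pose v := e *: x; pose d := (e * u) *: h.
have iT w : gamma.-integrable [set: BX] (EFin \o (fun y : BX => OUg s f (w + ou_s r *: (y : X)))).
  exact: cbdd_integrable (cbdd_affine w (ou_s r) hT).
have iA := cbdd_integrable gamma (cbdd_affine v (ou_s r) hA).
have -> : e *: (x + u *: h) = v + d by rewrite scalerDr scalerA.
rewrite mulrA -/v -RintegralZl// -RintegralB// -RintegralB//; last 2 first.
- by apply: integrable_subR.
- exact: integrable_mulR.
have ii := integrable_subR measurableT (integrable_subR measurableT (iT (v + d)) (iT v))
  (integrable_mulR (u * e) measurableT iA).
apply: le_trans (le_normr_Rintegral measurableT ii) _.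
rewrite -[leRHS](Rintegral_prob_cst gamma); apply: le_Rintegral => //.
- exact: integrable_norm ii.
- exact: finite_measure_integrable_cst.
move=> y _; have [h1 _ _ _] := ouD1_spec (v + ou_s r *: (y : X)) s0 hh hf.
have -> : v + d + ou_s r *: (y : X) = v + ou_s r *: (y : X) + d by rewrite addrAC.
by rewrite (mulrC u e) -[leRHS]mulrA -exprMn; exact: h1.
Qed.

Lemma OU_lip t h f M x : 0 < t -> inH gamma h -> cbdd f M ->
  `|OUg t f (x + h) - OUg t f x| <= (C + 2) * (ou_c t * hn h) * M.
Proof.
move=> t0 hh hf; have [h1 _ _ _] := ouD1_spec x t0 hh hf.
have M0 := cbdd_ge0 hf; have cn := chn_ge0 h t0; have aM := ouD1_le x t0 hh hf.
have C0 : 0 <= C by exact: le_trans ou_C_ge.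
set w := ou_c t * hn h in h1 cn aM *.
have := h1 1; rewrite scale1r mul1r expr1n mulr1 => h2.
have wM : 0 <= w * M by rewrite mulr_ge0.
have CwM : 0 <= C * (w * M) by rewrite mulr_ge0.
have -> : (C + 2) * w * M = C * (w * M) + 2 * (w * M) by ring.
have [w1|w1] := leP w 1.
  have -> : OUg t f (x + h) - OUg t f x = (OUg t f (x + h) - OUg t f x - ouD1 t h f x) + ouD1 t h f x by ring.
  apply: le_trans (ler_normD _ _) _; apply: lerD; last by apply: le_trans aM _; lra.
  apply: le_trans h2 _; rewrite -mulrA ler_wpM2l// mulrC ler_wpM2r// expr2 ler_piMl//.
apply: le_trans (ler_normB _ _) _.
have b1 := OU_bound gamma t (x + h) hf; have b2 := OU_bound gamma t x hf.
have : M <= w * M by rewrite ler_peMl// ltW.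
lra.
Qed.

(** For [w = ou_c t * |h|_H <= 1] the quadratic bound is at most [w^p], and for [w > 1] the
    Lipschitz bound is. The free exponent is the point: [p = 2] would cost [1/t] after insertion of
    [ou_c t], while any [p > 1] keeps the remainder [o(|h|_H)]. *)
Lemma OU_remainder t h f M p x : 0 < t -> inH gamma h -> cbdd f M -> 1 <= p <= 2 ->
  `|OUg t f (x + h) - OUg t f x - ouD1 t h f x| <= (C + 3) * M * (ou_c t * hn h) `^ p.
Proof.
move=> t0 hh hf /andP[p1 p2]; have [h1 _ _ _] := ouD1_spec x t0 hh hf.
have M0 := cbdd_ge0 hf; have cn := chn_ge0 h t0; have aM := ouD1_le x t0 hh hf.
have C0 : 0 <= C by exact: le_trans ou_C_ge.
have lip := OU_lip x t0 hh hf.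
set w := ou_c t * hn h in h1 cn aM lip *.
have := h1 1; rewrite scale1r mul1r expr1n mulr1 => h2.
have wp : 0 <= w `^ p by exact: powR_ge0.
have [w1|w1] := leP w 1.
  apply: le_trans h2 _; apply: ler_pM; rewrite ?sqr_ge0 ?mulr_ge0//.
    by rewrite ler_wpM2r// lerDl.
  have [->|w0] := eqVneq w 0; first by rewrite expr0n powR_ge0.
  have w01 : 0 < w <= 1 by rewrite lt_def w0 cn w1.
  by rewrite -powR_mulrn//; exact: (ger_powR w01 p2).
apply: le_trans (ler_normB _ _) _.
apply: (@le_trans _ _ ((C + 3) * M * w)).
  have -> : (C + 3) * M * w = (C + 2) * w * M + w * M by ring.
  exact: lerD.
apply: ler_wpM2l; first by rewrite mulr_ge0// addr_ge0.
by rewrite -[leLHS](powRr1 cn) ler_powR// ltW.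
Qed.

Lemma ouD1_half t h f M x : 0 < t -> inH gamma h -> cbdd f M ->
  ouD1 t h f x = expR (- (t / 2)) * OUg (t / 2) (ouD1 (t / 2) h f) x.
Proof.
move=> t0 hh hf; have t2 : 0 < t / 2 by rewrite divr_gt0.
by rewrite -(ouD1_add _ t2 t2 hh hf) -splitr.
Qed.

Lemma expRN_le1 t : 0 <= t -> expR (- t) <= 1.
Proof. by move=> t0; rewrite -[leRHS]expR0 ler_expR oppr_le0. Qed.

(** Half of the time smooths in each direction: the derivative at time [t / 2] is again bounded and
    continuous, so the first-order results apply to it. *)
Lemma ouD2_half t h k f M x : 0 < t -> inH gamma h -> inH gamma k -> cbdd f M ->
  ouD2 t h k f x = expR (- (t / 2)) * ouD1 (t / 2) k (ouD1 (t / 2) h f) x /\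
  n.+1%:R * (ouD1 t h f (x + n.+1%:R^-1 *: k) - ouD1 t h f x) @[n --> \oo] --> ouD2 t h k f x.
Proof.
move=> t0 hh hk hf; have t2 : 0 < t / 2 by rewrite divr_gt0.
have hF := cbdd_ouD1 t2 hh hf; have [h1 _ _ _] := ouD1_spec x t2 hk hF.
set N := ou_c (t / 2) * hn h * M in hF h1.
have e1 := expRN_le1 (ltW t2); have e0 := expR_ge0 (- (t / 2)).
have [c e] : n.+1%:R * (ouD1 t h f (x + n.+1%:R^-1 *: k) - ouD1 t h f x) @[n --> \oo] -->
   expR (- (t / 2)) * ouD1 (t / 2) k (ouD1 (t / 2) h f) x /\
   ddir (ouD1 t h f) k x = expR (- (t / 2)) * ouD1 (t / 2) k (ouD1 (t / 2) h f) x.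
  apply: (@ddirP _ _ _ _ _ _ (C * N * (ou_c (t / 2) * hn k) ^+ 2)) => s.
  rewrite !(ouD1_half _ t0 hh hf) mulrCA -!mulrBr normrM (ger0_norm e0).
  by apply: le_trans (h1 s); rewrite ler_piMl.
by rewrite /ouD2 e.
Qed.

Lemma ouD2_sqr t h k f M x : 0 < t -> inH gamma h -> inH gamma k -> cbdd f M ->
  ouD2 t h k f x ^+ 2 <= (ou_c (t / 2) * hn k) ^+ 2 * (ou_c (t / 2) * hn h) ^+ 2
    * OUg t (fun y => f y ^+ 2) x.
Proof.
move=> t0 hh hk hf; have t2 : 0 < t / 2 by rewrite divr_gt0.
have hF := cbdd_ouD1 t2 hh hf; have [_ _ h3 _] := ouD1_spec x t2 hk hF.
have [-> _] := ouD2_half x t0 hh hk hf.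
have e1 := expRN_le1 (ltW t2); have e0 := expR_ge0 (- (t / 2)).
set w := ou_c (t / 2) * hn h in hF h3 *.
rewrite exprMn; apply: (@le_trans _ _ (ouD1 (t / 2) k (ouD1 (t / 2) h f) x ^+ 2)).
  by rewrite ler_piMl ?sqr_ge0// expr_le1.
apply: le_trans h3 _; rewrite -mulrA ler_wpM2l ?sqr_ge0//.
have hT := cbdd_OU gamma (t / 2) (cbdd_sqr hf).
have hS : cbdd (fun y => w ^+ 2 * OUg (t / 2) (fun y => f y ^+ 2) y + 0) (`|w ^+ 2| * M ^+ 2 + 0).
  apply: (@cbdd_lin _ _ _ (fun=> 0) _ 0 (w ^+ 2) hT); split=> [y|y]; first exact: cvg_cst.
  by rewrite normr0.
apply: (@le_trans _ _ (OUg (t / 2) (fun y => w ^+ 2 * OUg (t / 2) (fun y => f y ^+ 2) y + 0) x)).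
  apply: (OU_le _ _ _ (cbdd_sqr hF) hS) => y; rewrite addr0.
  by have [_ _ h3' _] := ouD1_spec y t2 hh hf.
have h0 : cbdd (fun _ : X => 0 : R) 0 by split=> [y|y]; [exact: cvg_cst|rewrite normr0].
rewrite (OU_lin _ _ _ _ hT h0) (OU_add hsep hgauss _ t2 t2 (cbdd_sqr hf)) -splitr.
by rewrite [X in _ + X](_ : _ = 0) ?addr0// OUE (Rintegral_prob_cst gamma).
Qed.

Lemma ouD2_le t h k f M N x : 0 < t -> inH gamma h -> inH gamma k -> cbdd f M ->
  (forall y, `|ouD1 (t / 2) h f y| <= N) -> `|ouD2 t h k f x| <= ou_c (t / 2) * hn k * N.
Proof.
move=> t0 hh hk hf hN; have t2 : 0 < t / 2 by rewrite divr_gt0.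
have hF := cbdd_weaken (cbdd_ouD1 t2 hh hf) hN.
have [-> _] := ouD2_half x t0 hh hk hf.
rewrite normrM ger0_norm ?expR_ge0//; apply: le_trans (ouD1_le x t2 hk hF).
by rewrite ler_piMl// expRN_le1// ltW.
Qed.

Lemma ouD1_remainder t h k f M N p x : 0 < t -> inH gamma h -> inH gamma k -> cbdd f M ->
  (forall y, `|ouD1 (t / 2) h f y| <= N) -> 1 <= p <= 2 ->
  `|ouD1 t h f (x + k) - ouD1 t h f x - ouD2 t h k f x|
    <= (C + 3) * N * (ou_c (t / 2) * hn k) `^ p.
Proof.
move=> t0 hh hk hf hN hp; have t2 : 0 < t / 2 by rewrite divr_gt0.
have hF := cbdd_weaken (cbdd_ouD1 t2 hh hf) hN.
have [-> _] := ouD2_half x t0 hh hk hf.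
rewrite !(ouD1_half _ t0 hh hf) -!mulrBr normrM ger0_norm ?expR_ge0//.
apply: le_trans (OU_remainder x t2 hk hF hp).
by rewrite ler_piMl// expRN_le1// ltW.
Qed.

(** Three increments are paid with times [t / 2], [t / 4] and [t / 4]; the Lipschitz bound of
    [OU (t / 4)] replaces a third derivative. *)
Lemma ouD2_lip t h k (g : X) f M N x : 0 < t -> inH gamma h -> inH gamma k -> inH gamma g ->
  cbdd f M -> (forall y, `|ouD1 (t / 2) h f y| <= N) ->
  `|ouD2 t h k f (x + g) - ouD2 t h k f x|
    <= (C + 2) * (ou_c (t / 2 / 2) * hn g) * (ou_c (t / 2 / 2) * hn k * N).
Proof.
move=> t0 hh hk hg hf hN; have t2 : 0 < t / 2 by rewrite divr_gt0.
have t4 : 0 < t / 2 / 2 by rewrite divr_gt0.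
have hF := cbdd_weaken (cbdd_ouD1 t2 hh hf) hN.
have [-> _] := ouD2_half x t0 hh hk hf; have [-> _] := ouD2_half (x + g) t0 hh hk hf.
rewrite !(ouD1_half _ t2 hk hF) -!mulrBr !normrM !(ger0_norm (expR_ge0 _)).
have hA := cbdd_ouD1 t4 hk hF.
apply: le_trans (OU_lip x t4 hg hA).
apply: le_trans (ler_piMl _ _) _; rewrite ?mulr_ge0 ?expR_ge0 ?expRN_le1 ?(ltW t2)//.
by rewrite ler_piMl// expRN_le1// ltW.
Qed.

Lemma ouD2_link t a h k (g : X) f M x : 0 < t -> inH gamma h -> inH gamma k -> inH gamma g ->
  cbdd f M -> ouD2 t h (a *: k + g) f x = a * ouD2 t h k f x + ouD2 t h g f x.
Proof.
move=> t0 hh hk hg hf; have t2 : 0 < t / 2 by rewrite divr_gt0.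
have [hkg _] := inH_lin hgauss a hk hg.
have [-> _] := ouD2_half x t0 hh hk hf; have [-> _] := ouD2_half x t0 hh hg hf.
have [-> _] := ouD2_half x t0 hh hkg hf.
by rewrite (ouD1_linh _ _ t2 hk hg (cbdd_ouD1 t2 hh hf)) mulrDr mulrCA.
Qed.

Lemma ouD2_linh t a h (g : X) k f M x : 0 < t -> inH gamma h -> inH gamma g -> inH gamma k ->
  cbdd f M -> ouD2 t (a *: h + g) k f x = a * ouD2 t h k f x + ouD2 t g k f x.
Proof.
move=> t0 hh hg hk hf; have t2 : 0 < t / 2 by rewrite divr_gt0.
have [hhg _] := inH_lin hgauss a hh hg.
have [-> _] := ouD2_half x t0 hh hk hf; have [-> _] := ouD2_half x t0 hg hk hf.
have [-> _] := ouD2_half x t0 hhg hk hf.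
have -> : ouD1 (t / 2) (a *: h + g) f = fun y => a * ouD1 (t / 2) h f y + ouD1 (t / 2) g f y.
  by apply/funext => y; exact: (ouD1_linh _ _ t2 hh hg hf).
by rewrite (ouD1_linf _ _ t2 hk (cbdd_ouD1 t2 hh hf) (cbdd_ouD1 t2 hg hf)) mulrDr mulrCA.
Qed.

Lemma ouD2_linf t a h k f g M N x : 0 < t -> inH gamma h -> inH gamma k ->
  cbdd f M -> cbdd g N ->
  ouD2 t h k (fun y => a * f y + g y) x = a * ouD2 t h k f x + ouD2 t h k g x.
Proof.
move=> t0 hh hk hf hg; have t2 : 0 < t / 2 by rewrite divr_gt0.
have [-> _] := ouD2_half x t0 hh hk hf; have [-> _] := ouD2_half x t0 hh hk hg.
have [-> _] := ouD2_half x t0 hh hk (cbdd_lin a hf hg).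
have -> : ouD1 (t / 2) h (fun y => a * f y + g y) = fun y => a * ouD1 (t / 2) h f y + ouD1 (t / 2) h g y.
  by apply/funext => y; exact: (ouD1_linf _ _ t2 hh hf hg).
by rewrite (ouD1_linf _ _ t2 hk (cbdd_ouD1 t2 hh hf) (cbdd_ouD1 t2 hh hg)) mulrDr mulrCA.
Qed.

Section Translation.
Variables (t : R) (f : X -> R) (M : R) (x y : X).
Hypothesis t0 : 0 < t.
Hypothesis hf : cbdd f M.
(** Moving the base point from [x] to [y] translates the argument of [f] by [v]. An increment of a
    derivative between [x] and [y] is thus the same derivative of [g] at [x]. *)
Let v := expR (- t) *: (y - x).
Let fv := fun z => f (z + v).
Let g := fun z => -1 * f z + fv z.

Let shift_eq (a b c d : X) : a + b + c = d + b + c + (a - d).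
Proof. by rewrite -!addrA [RHS]addrC -!addrA addNr addr0 [in RHS]addrA [RHS]addrC. Qed.

Let OU_trans z : OUg t f (y + z) = OUg t fv (x + z).
Proof.
rewrite !OUE; apply: eq_Rintegral => w _; rewrite /fv /v; congr f.
by rewrite !scalerDr scalerN; exact: shift_eq.
Qed.

Let ouD1_trans h z : ouD1 t h f (y + z) = ouD1 t h fv (x + z).
Proof.
rewrite /ouD1 /ddir; congr (limn _); apply/funext => n.
by rewrite -!addrA !OU_trans.
Qed.

Let ouD2_trans h k z : ouD2 t h k f (y + z) = ouD2 t h k fv (x + z).
Proof.
rewrite /ouD2 /ddir; congr (limn _); apply/funext => n.
by rewrite -!addrA !ouD1_trans.
Qed.

(** Controls the increments of all derivatives between [x] and [y] by dominated convergence alone: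
    [f] is not assumed uniformly continuous. *)
Definition ou_modulus : R := OUg t (fun z => g z ^+ 2) x.

Let hfv : cbdd fv M. Proof. exact: cbdd_shift. Qed.
Let hg : cbdd g (`|-1| * M + M). Proof. exact: cbdd_lin. Qed.

Lemma OU_diff_sqr : (OUg t f y - OUg t f x) ^+ 2 <= ou_modulus.
Proof.
have -> : OUg t f y - OUg t f x = OUg t g x.
  by have := OU_trans 0; rewrite !addr0 /g (OU_lin _ _ _ _ hf hfv) => ->; rewrite mulN1r addrC.
rewrite /ou_modulus !OUE.
have [cg gM] := cbdd_affine (expR (- t) *: x) (ou_s t) hg.
exact: (prob_jensen gamma (continuous_borel_measurable cg) gM).
Qed.

Lemma ouD1_diff_sqr h : inH gamma h ->
  (ouD1 t h f y - ouD1 t h f x) ^+ 2 <= (ou_c t * hn h) ^+ 2 * ou_modulus.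
Proof.
move=> hh; have -> : ouD1 t h f y - ouD1 t h f x = ouD1 t h g x.
  by have := ouD1_trans h 0; rewrite !addr0 /g (ouD1_linf _ _ t0 hh hf hfv) => ->; rewrite mulN1r addrC.
by have [_ _ h3 _] := ouD1_spec x t0 hh hg.
Qed.

Lemma ouD2_diff_sqr h k : inH gamma h -> inH gamma k ->
  (ouD2 t h k f y - ouD2 t h k f x) ^+ 2 <=
    (ou_c (t / 2) * hn k) ^+ 2 * (ou_c (t / 2) * hn h) ^+ 2 * ou_modulus.
Proof.
move=> hh hk; have -> : ouD2 t h k f y - ouD2 t h k f x = ouD2 t h k g x.
  by have := ouD2_trans h k 0; rewrite !addr0 /g (ouD2_linf _ _ t0 hh hk hf hfv) => ->; rewrite mulN1r addrC.
exact: ouD2_sqr hg.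
Qed.

Lemma ou_modulusE : ou_modulus = \int[gamma]_(z in [set: BX])
  (f (expR (- t) *: y + ou_s t *: (z : X)) - f (expR (- t) *: x + ou_s t *: (z : X))) ^+ 2.
Proof.
rewrite /ou_modulus OUE; apply: eq_Rintegral => z _; rewrite /g /fv mulN1r addrC.
rewrite (_ : _ + v = expR (- t) *: y + ou_s t *: (z : X))// /v scalerDr scalerN.
by rewrite addrAC [expR (- t) *: x + _]addrC subrK.
Qed.

End Translation.

End OUDerivatives.

(** * Integration in time *)

Section TimeWeights.
Context {R : realType}.
Notation mu := (@lebesgue_measure R).
Notation D := (`]0%R, +oo[%classic : set R).
Implicit Types (a d k t u r : R).

Lemma powR_continuous_pos d t : 0 < t -> {for t, continuous (fun x : R => x `^ d)}.
Proof.
move=> t0; apply/differentiable_continuous/derivable1_diffP.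
by have [] := is_derive1_powR d t0.
Qed.

(** The weight is chosen because it has an elementary antiderivative, behaves like [u^(d-1)]
    at 0 and like [u^(-d-1)] at infinity, and so dominates every singular weight met below. *)
Definition omega d u : R := d * u `^ (d - 1) / (1 + u `^ d) ^+ 2.

Lemma omega_ge0 d u : 0 <= d -> 0 <= omega d u.
Proof. by move=> d0; rewrite divr_ge0 ?sqr_ge0// mulr_ge0// powR_ge0. Qed.

Lemma one_plus_powR_gt0 d u : 0 < 1 + u `^ d.
Proof. by rewrite ltr_wpDr ?powR_ge0. Qed.

Lemma measurable_omega d k (E : set R) : measurable_fun E (fun t => k * omega d (k * t)).
Proof.
apply: measurable_funTS; apply: measurable_funM => //.
have mk : measurable_fun setT (fun t : R => k * t) by exact: measurable_funM.
apply: (measurable_comp (F := setT) (f := omega d)) => //.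
apply: measurable_funM; first exact: measurable_funM.
apply: measurable_funTS.
have m1 : measurable_fun setT (fun u : R => (1 + u `^ d) ^+ 2).
  by apply: measurable_funX; exact: measurable_funD.
rewrite (_ : (fun u => _) = fun u => (1 + u `^ d) `^ (- 2%:R)); last first.
  by apply/funext => u; rewrite powRN powR_mulrn// ltW// one_plus_powR_gt0.
by apply: (measurableT_comp (measurable_powR _)); exact: measurable_funD.
Qed.

Lemma omega_antiderivative d k t : 0 < k -> 0 < t ->
  is_derive t (1 : R) (fun t => - (1 + (k * t) `^ d)^-1) (k * omega d (k * t)).
Proof.
move=> k0 t0; have kt0 : 0 < k * t by exact: mulr_gt0.
have dk : is_derive t (1 : R) (fun t : R => k * t) k.
  by apply: is_derive_eq; rewrite /GRing.scale /=; ring.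
have dp := is_derive1_powR d kt0.
have dc : is_derive t (1 : R) (fun t => (k * t) `^ d) (d * (k * t) `^ (d - 1) * k).
  exact: (is_derive1_comp dp dk).
have d1 : is_derive t (1 : R) (fun t => 1 + (k * t) `^ d) (d * (k * t) `^ (d - 1) * k).
  by have h := is_deriveD (is_derive_cst (1 : R) t (1 : R)) dc; rewrite add0r in h.
have nz : 1 + (k * t) `^ d != 0 by rewrite gt_eqF// one_plus_powR_gt0.
have dv := is_deriveV (f := fun t => 1 + (k * t) `^ d) nz d1.
have dn := is_deriveN dv.
apply: is_derive_eq; rewrite /GRing.scale /= /omega; field.
exact: nz.
Qed.

Lemma omega_continuous_pos d k t : 0 < k -> 0 < t ->
  {for t, continuous (fun t => k * omega d (k * t))}.
Proof.
move=> k0 t0; have kt0 : 0 < k * t by exact: mulr_gt0.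
have ck : {for t, continuous (fun t : R => k * t)}.
  by apply: cvgM; [exact: cvg_cst|exact: cvg_id].
have cp e : {for t, continuous (fun t : R => (k * t) `^ e)}.
  by apply: (@continuous_comp _ _ _ (fun t => k * t) (fun u => u `^ e)) => //; exact: powR_continuous_pos.
apply: cvgM; first exact: cvg_cst.
apply: cvgM; first by apply: cvgM; [exact: cvg_cst|exact: cp].
have c1 : 1 + (k * x) `^ d @[x --> t] --> 1 + (k * t) `^ d by apply: cvgD; [exact: cvg_cst|exact: cp].
apply: cvgV; first by rewrite expf_neq0// gt_eqF// one_plus_powR_gt0.
exact: (cvgM c1 c1).
Qed.

Lemma omega_tail_le1 d k a : 0 < d -> 0 < k -> 0 < a ->
  (\int[mu]_(t in `[a, +oo[) (k * omega d (k * t))%:E <= 1)%E.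
Proof.
move=> d0 k0 a0; pose F t := - (1 + (k * t) `^ d)^-1.
have pos x : a <= x -> 0 < x by exact: lt_le_trans.
rewrite (@ge0_continuous_FTC2y _ _ F a 0).
- rewrite -EFinB lee_fin sub0r opprK invf_le1 ?one_plus_powR_gt0// lerDl powR_ge0//.
- by move=> x _; rewrite mulr_ge0 ?(ltW k0)// omega_ge0// ltW.
- apply/continuous_in_subspaceT => x /set_mem /=; rewrite in_itv/= andbT => ax.
  by apply: omega_continuous_pos => //; exact: pos.
- rewrite -oppr0; apply: cvgN; apply/cvgrPdist_le => e e0; near=> t.
  rewrite sub0r normrN ger0_norm ?invr_ge0 ?(ltW (one_plus_powR_gt0 _ _))//.
  rewrite invf_ple ?posrE ?one_plus_powR_gt0//.
  have tT : (e^-1) `^ d^-1 / k <= t by near: t; apply: nbhs_pinfty_ge; exact: num_real.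
  rewrite ler_pdivrMr// in tT.
  have := @powR_le R d _ _ (ltW d0) (powR_ge0 _ _) tT.
  rewrite -powRrM mulVf ?gt_eqF// powRr1 ?invr_ge0 ?(ltW e0)// [t * k]mulrC => h.
  by apply: le_trans h _; rewrite lerDr.
- move=> x ax; have [] := omega_antiderivative d k0 (pos _ (ltW ax)); done.
- apply: cvg_at_right_filter; apply/differentiable_continuous/derivable1_diffP.
  by have [] := omega_antiderivative d k0 a0.
- move=> x; rewrite in_itv/= andbT => ax.
  by have [_ h] := omega_antiderivative d k0 (pos _ (ltW ax)); rewrite derive1E.
Unshelve. all: by end_near. Qed.

Lemma measurable_D : measurable (D : set (measurableTypeR R)).
Proof. exact: measurable_itv. Qed.

(** The weight may be singular at 0, so the fundamental theorem is used on [[1/(n+1), +oo[] and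
    monotone convergence does the rest. *)
Lemma omega_le1 d k : 0 < d -> 0 < k -> (\int[mu]_(t in D) (k * omega d (k * t))%:E <= 1)%E.
Proof.
move=> d0 k0; pose f t := k * omega d (k * t).
have f0 t : 0 <= f t by rewrite mulr_ge0 ?(ltW k0)// omega_ge0// ltW.
pose E n := `[n.+1%:R^-1, +oo[%classic : set R.
pose g n t : \bar R := (f t * \1_(E n) t)%:E.
have mg n : measurable_fun D (g n).
  apply/measurable_EFinP; apply: measurable_funM; first exact: measurable_omega.
  apply: measurable_funTS; apply: measurable_indic; exact: measurable_itv.
have ng t : D t -> nondecreasing_seq (g^~ t).
  move=> Dt m n mn; rewrite lee_fin ler_wpM2l// !indicE ler_nat.
  case: (boolP (t \in E m)) => // /set_mem h; rewrite mem_set//.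
  move: h; rewrite /E /= !in_itv/= !andbT; apply: le_trans.
  by rewrite lef_pV2 ?posrE// ler_nat.
have cg t : D t -> g n t @[n --> \oo] --> (f t)%:E.
  rewrite /= in_itv/= andbT => t0; apply: cvg_near_cst.
  have [N _ hN] := near_infty_natSinv_lt (PosNum t0); exists N => // n Nn.
  rewrite /g indicE mem_set ?mulr1//= /E /= in_itv/= andbT ltW//.
  exact: (hN n Nn).
have g0 n t : D t -> (0 <= g n t)%E by move=> _; rewrite lee_fin mulr_ge0.
have := @cvg_monotone_convergence _ _ _ mu D measurable_D g mg g0 ng.
have -> : (\int[mu]_(t in D) limn (g^~ t) = \int[mu]_(t in D) (f t)%:E)%E.
  by apply: eq_integral => t /set_mem Dt; apply/cvg_lim => //; exact: cg.
move=> c; rewrite -(cvg_lim _ c)//.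
apply: lime_le; first by apply/cvg_ex; eexists; exact: c.
apply: nearW => n.
have -> : (\int[mu]_(t in D) g n t = \int[mu]_(t in D `&` E n) (f t)%:E)%E.
  rewrite integral_mkcondr; apply: eq_integral => t _; rewrite patchE /g indicE.
  by case: ifP => _; rewrite (mulr1, mulr0).
rewrite setIidr; first by apply: (@omega_tail_le1 d k (n.+1%:R^-1) d0 k0 _); rewrite invr_gt0.
by move=> t; rewrite /E /= !in_itv/= !andbT; apply: lt_le_trans; rewrite invr_gt0.
Qed.

(** The bound [C] does not depend on the scale [k]; choosing [k] as a power of the increment is what
    later produces the Holder exponent. *)
Lemma weight_integrable d k (C : R) (w : R -> R) : 0 < d -> 0 < k ->
  measurable_fun D w -> (forall t, 0 < t -> 0 <= w t <= C * (k * omega d (k * t))) ->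
  mu.-integrable D (EFin \o w) /\ \int[mu]_(t in D) w t <= C.
Proof.
move=> d0 k0 mw wC.
have C0 : 0 <= C.
  have /andP[h1 h2] := wC 1 ltr01; have := le_trans h1 h2.
  rewrite pmulr_lge0// mulr1 mulr_gt0// divr_gt0 ?exprn_gt0 ?one_plus_powR_gt0//.
  by rewrite mulr_gt0// powR_gt0.
have io : mu.-integrable D (EFin \o (fun t => k * omega d (k * t))).
  apply/integrableP; split; first by apply/measurable_EFinP; exact: measurable_omega.
  apply: le_lt_trans (ltry 1); apply: le_trans (omega_le1 d0 k0).
  rewrite le_eqVlt; apply/orP; left; apply/eqP; apply: eq_integral => t _ /=.
  by rewrite ger0_norm// mulr_ge0 ?(ltW k0)// omega_ge0// ltW.
have iC := integrable_mulR C measurable_D io.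
have iw : mu.-integrable D (EFin \o w).
  apply: le_integrable iC => //; first exact/measurable_EFinP.
  move=> t; rewrite /= in_itv/= andbT => t0; have /andP[w0 w1] := wC _ t0.
  by rewrite lee_fin ger0_norm// (le_trans w1)// ler_norm.
split=> //; apply: (@le_trans _ _ (\int[mu]_(t in D) (C * (k * omega d (k * t))))).
  apply: le_Rintegral => // t; rewrite /= in_itv/= andbT => t0.
  by have /andP[] := wC _ t0.
rewrite RintegralZl// -[leRHS]mulr1 ler_wpM2l// -lee_fin /Rintegral fineK ?omega_le1//.
exact: integrable_fin_num io.
Qed.

Lemma measurable_powR_fun (E : set R) a : measurable_fun E (fun t : R => t `^ a).
Proof. exact: measurable_funTS (measurable_powR _). Qed.

Lemma exp_powR_integrable (la a : R) : 0 < la -> 0 < a <= 1 ->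
  mu.-integrable D (EFin \o (fun t => expR (- (la * t)) * t `^ (a - 1))).
Proof.
(* From [1 + t^a <= 2 + t <= (2 + 2 / la) * exp (la t / 2)], squared; the division by [a] cancels
   the factor in [omega]. *)
move=> la0 /andP[a0 a1]; pose c := (2 + 2 / la) ^+ 2 / a.
have mw : measurable_fun D (fun t => expR (- (la * t)) * t `^ (a - 1)).
  apply: measurable_funM; last exact: measurable_powR_fun.
  apply: measurable_funTS; apply: measurable_comp_expR.
  by apply: measurableT_comp => //; exact: measurable_funM.
have [] // := @weight_integrable a 1 c _ a0 ltr01 mw.
move=> t t0; rewrite mulr_ge0 ?expR_ge0 ?powR_ge0//= !mul1r /omega.
have h : (1 + t `^ a) ^+ 2 <= (2 + 2 / la) ^+ 2 * expR (la * t).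
  have -> : expR (la * t) = expR (la * t / 2) ^+ 2.
    by rewrite expr2 -expRD; congr expR; field.
  rewrite -exprMn ler_sqr ?nnegrE ?mulr_ge0 ?expR_ge0 ?addr_ge0 ?divr_ge0 ?powR_ge0 ?(ltW la0)//.
  have ta : t `^ a <= 1 + t.
    have [t1|t1] := leP t 1.
      have := powR_le (ltW a0) (ltW t0) t1; rewrite powR1 => /le_trans; apply.
      by rewrite lerDl ltW.
    have : t `^ a <= t by rewrite -[leRHS](powRr1 (ltW t0)) ler_powR// ltW.
    by move/le_trans; apply; rewrite lerDr.
  have e1 := expR_ge1Dx (la * t / 2); set E := expR _ in e1 *.
  have tE : t <= 2 / la * E.
    have -> : t = 2 / la * (la * t / 2) by field; rewrite gt_eqF.
    by rewrite ler_wpM2l ?divr_ge0 ?(ltW la0)//; lra.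
  have E1 : 1 <= E by apply: le_trans e1; rewrite lerDl divr_ge0// mulr_ge0 ?ltW.
  by rewrite mulrDl; lra.
have P0 : 0 < (1 + t `^ a) ^+ 2 by rewrite exprn_gt0// one_plus_powR_gt0.
have -> : c * (a * t `^ (a - 1) / (1 + t `^ a) ^+ 2) =
   ((2 + 2 / la) ^+ 2 / (1 + t `^ a) ^+ 2) * t `^ (a - 1).
  by rewrite /c; field; rewrite !gt_eqF ?one_plus_powR_gt0.
rewrite ler_wpM2r ?powR_ge0// ler_pdivlMr// expRN mulrC ler_pdivrMr ?expR_gt0//.
Qed.

Definition min_weight d r t : R := Num.min (t `^ (d - 1)) (t `^ (d - 3 / 2) * r).

(** The two powers cross at [t = r^2]. In the variable [u = t / r^2] the weight is [r^(2d-2)] times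
    the minimum of [u^(d-1)] and [u^(d-3/2)], and the change of variable contributes the missing
    [r^2]. *)
Lemma min_weight_integral d : 0 < d < 1 / 2 -> exists K : R, 0 <= K /\ forall r, 0 < r ->
  mu.-integrable D (EFin \o min_weight d r) /\
  \int[mu]_(t in D) min_weight d r t <= K * r `^ (2 * d).
Proof.
(* The bound [e <= d] gives domination by [omega] at 0, and [e <= 1/2 - d] at infinity. The 4 bounds
   [(1 + u^e)^2] for [u <= 1], and relative to [u^(2e)] for [u > 1]. *)
move=> /andP[d0 d1]; pose e := Num.min d (1 / 2 - d).
have e0 : 0 < e by rewrite lt_min d0 subr_gt0.
have ed : e <= d by rewrite ge_min lexx.
have ed2 : e <= 1 / 2 - d by rewrite ge_min lexx orbT.
exists (4 / e); split=> [|r r0]; first by rewrite divr_ge0// ltW.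
have k0 : 0 < r ^- 2 by rewrite invr_gt0 exprn_gt0.
have mw : measurable_fun D (min_weight d r).
  apply: measurable_minr; first exact: measurable_powR_fun.
  by apply: measurable_funM => //; exact: measurable_powR_fun.
apply: (@weight_integrable e (r ^- 2) _ _ e0 k0 mw) => t t0.
rewrite /min_weight le_min !powR_ge0 mulr_ge0 ?powR_ge0 ?(ltW r0)//=.
set u := r ^- 2 * t; have u0 : 0 < u by exact: mulr_gt0.
have tu : t = r ^+ 2 * u by rewrite /u mulrA divff ?mul1r// expf_neq0// gt_eqF.
have r2 : r ^+ 2 = r `^ 2%:R by rewrite powR_mulrn// ltW.
have P0 : 0 < (1 + u `^ e) ^+ 2 by rewrite exprn_gt0// one_plus_powR_gt0.
have rn0 : r != 0 by rewrite gt_eqF.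
have scale p : t `^ p = r `^ (2 * p) * u `^ p.
  by rewrite tu r2 powRM ?powR_ge0 ?(ltW u0)// -powRrM.
have -> : 4 / e * r `^ (2 * d) * (r ^- 2 * omega e u) =
    r `^ (2 * d - 2) * (4 * u `^ (e - 1) / (1 + u `^ e) ^+ 2).
  have -> : r `^ (2 * d - 2) = r `^ (2 * d) / r ^+ 2.
    by rewrite powRB ?rn0 ?implybT//; congr (_ / _); rewrite powR_mulrn// ltW.
  by rewrite /omega; field; rewrite rn0 !gt_eqF ?one_plus_powR_gt0.
have rp := powR_gt0 (2 * d - 2) r0.
have [u1|u1] := leP u 1.
  rewrite ge_min; apply/orP; left; rewrite scale (_ : 2 * (d - 1) = 2 * d - 2); last by ring.
  rewrite ler_wpM2l ?(ltW rp)// ler_pdivlMr//.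
  have h : (1 + u `^ e) ^+ 2 <= 4.
    rewrite (_ : 4 = 2 ^+ 2 :> R); last by ring.
    rewrite ler_sqr ?nnegrE ?(ltW (one_plus_powR_gt0 _ _))//.
    have := powR_le (ltW e0) (ltW u0) u1; rewrite powR1; lra.
  rewrite [leRHS]mulrC ler_pM ?powR_ge0 ?sqr_ge0//.
  by apply: ger_powR; [rewrite u0|rewrite lerD2r].
rewrite ge_min; apply/orP; right; rewrite scale.
have -> : r `^ (2 * (d - 3 / 2)) * u `^ (d - 3 / 2) * r = r `^ (2 * d - 2) * u `^ (d - 3 / 2).
  rewrite mulrAC -[X in _ * X * _](powRr1 (ltW r0)) -powRD ?rn0 ?implybT//.
  by congr (_ `^ _ * _); field.
rewrite ler_wpM2l ?(ltW rp)// ler_pdivlMr//.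
have h : (1 + u `^ e) ^+ 2 <= 4 * u `^ (2 * e).
  have ue : 1 <= u `^ e by rewrite -(powRr0 u) ler_powR// ltW.
  have -> : 4 * u `^ (2 * e) = (2 * u `^ e) ^+ 2.
    by rewrite exprMn mulrC [2 * e]mulrC powRrM powR_mulrn ?powR_ge0//; ring.
  by rewrite ler_sqr ?nnegrE ?mulr_ge0 ?powR_ge0 ?(ltW (one_plus_powR_gt0 _ _))//; lra.
apply: (@le_trans _ _ (u `^ (d - 3 / 2) * (4 * u `^ (2 * e)))); first by rewrite ler_wpM2l ?powR_ge0.
rewrite mulrCA -powRD ?(gt_eqF u0) ?implybT// ler_wpM2l//.
by apply: ler_powR; [exact: ltW|lra].
Qed.

End TimeWeights.

(** * Powers of t bounding the coefficients of the semigroup *)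

Section TimeEstimates.
Context {R : realType}.
Implicit Types (t p q a b : R).

Lemma powRN_le q a b : 0 <= q -> 0 < a -> a <= b -> b `^ (- q) <= a `^ (- q).
Proof.
move=> q0 a0 ab; have b0 := lt_le_trans a0 ab.
by rewrite !powRN lef_pV2 ?posrE ?powR_gt0// powR_le// ltW.
Qed.

Lemma powRN2_sqr t : 0 < t -> (t `^ (- 2^-1)) ^+ 2 = t^-1.
Proof. by move=> t0; rewrite -powR_mulrn ?powR_ge0// -powRrM mulNr mulVf// powR_inv1// ltW. Qed.

(** The square of [ou_c t] is [1 / (exp (2 t) - 1)]. *)
Lemma ou_c_sqr_le t : 0 < t -> ou_c t ^+ 2 <= (2 * t)^-1.
Proof.
move=> t0; have s0 := ou_s_gt0 t0.
rewrite /ou_c exprMn exprVn ou_s_sqr ?(ltW t0)//.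
have e : expR (- t) ^+ 2 = expR (- (2 * t)) by rewrite expr2 -expRD; congr expR; ring.
rewrite e; have := expR_ge1Dx (2 * t); have p0 := expR_gt0 (2 * t).
have e1 : expR (- (2 * t)) < 1 by rewrite -[ltRHS]expR0 ltr_expR oppr_lt0 mulr_gt0.
rewrite ler_pdivrMr ?subr_gt0// ler_pdivlMl ?mulr_gt0// expRN.
move=> h; rewrite -(ler_pM2r p0) mulrBl -mulrA mulVf ?gt_eqF//; lra.
Qed.

Lemma ou_c_le t : 0 < t -> ou_c t <= (2 * t) `^ (- 2^-1).
Proof.
move=> t0; rewrite -ler_sqr ?nnegrE ?powR_ge0 ?(ltW (ou_c_gt0 t0))//.
by rewrite powRN2_sqr ?mulr_gt0// ou_c_sqr_le.
Qed.

Lemma ou_c_half_le t : 0 < t -> ou_c (t / 2) <= t `^ (- 2^-1).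
Proof.
move=> t0; have t2 : 0 < t / 2 by rewrite divr_gt0.
by apply: le_trans (ou_c_le t2) _; rewrite mulrCA divff// mulr1.
Qed.

Lemma ou_c_le1 t : 0 < t -> ou_c t <= t `^ (- 2^-1).
Proof.
move=> t0; apply: le_trans (ou_c_le t0) _; apply: powRN_le => //.
by rewrite ler_peMl ?(ltW t0)// ler1n.
Qed.

Lemma ou_c_quarter_le t : 0 < t -> ou_c (t / 2 / 2) <= 2 * t `^ (- 2^-1).
Proof.
move=> t0; have t4 : 0 < t / 2 / 2 by rewrite !divr_gt0.
rewrite -ler_sqr ?nnegrE ?(ltW (ou_c_gt0 t4)) ?(mulr_ge0 _ (powR_ge0 _ _))//.
rewrite [leRHS]exprMn powRN2_sqr//; apply: le_trans (ou_c_sqr_le t4) _.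
have -> : (2 * (t / 2 / 2))^-1 = 2 * t^-1 by field; rewrite gt_eqF.
by rewrite ler_pM2r ?invr_gt0// expr2; lra.
Qed.

(** Write the product as [(c s)^al * c^(1 - al)]; the first factor is a power of [exp (- t)], at
    most 1. *)
Lemma ou_sc_le al t : 0 < al < 1 -> 0 < t ->
  ou_s t `^ al * ou_c t <= (2 * t) `^ ((al - 1) / 2).
Proof.
move=> /andP[a0 a1] t0; have s0 := ou_s_gt0 t0; have c0 := ou_c_gt0 t0.
have -> : ou_s t `^ al * ou_c t = (ou_c t * ou_s t) `^ al * ou_c t `^ (1 - al).
  rewrite powRM ?ltW// [ou_c t `^ al * _]mulrC -mulrA -powRD ?(gt_eqF c0) ?implybT//.
  by rewrite addrC subrK powRr1// ltW.
rewrite ou_cs// (_ : (al - 1) / 2 = - 2^-1 * (1 - al)); last by field.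
rewrite powRrM -[leRHS]mul1r; apply: ler_pM; rewrite ?powR_ge0//.
  have := @powR_le R al _ _ (ltW a0) (expR_ge0 (- t)) (expRN_le1 (ltW t0)).
  by rewrite powR1.
by apply: powR_le; rewrite ?subr_ge0 ?(ltW c0) ?(ltW a1)//; exact: ou_c_le.
Qed.

Lemma small_power A p e : 0 <= A -> 0 < p -> 0 < e ->
  exists d, 0 < d /\ forall r, 0 < r < d -> A * r `^ (1 + p) <= e * r.
Proof.
move=> A0 p0 e0; have A1 : 0 < A + 1 by rewrite ltr_wpDl.
have q0 : 0 < e / (A + 1) by rewrite divr_gt0.
exists ((e / (A + 1)) `^ p^-1); split=> [|r /andP[r0 rd]]; first exact: powR_gt0.
rewrite powRD ?(gt_eqF r0) ?implybT// powRr1 ?(ltW r0)// mulrCA [leRHS]mulrC ler_pM2l//.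
have := @powR_le R p _ _ (ltW p0) (ltW r0) (ltW rd).
rewrite -powRrM mulVf ?gt_eqF// powRr1 ?(ltW q0)// ler_pdivlMr// => h.
by apply: le_trans h; rewrite mulrC ler_wpM2l ?powR_ge0// lerDl.
Qed.

End TimeEstimates.

Section HolderEstimates.
Context {R : realType} {X : completeNormedModType R}.
Variable gamma : probability (@borelX R X) R.
Hypothesis hsep : @separable R X.
Hypothesis hgauss : centered_gaussian gamma.
Notation BX := (@borelX R X).
Notation OUg := (OU gamma).
Notation hn := (hnorm gamma).
Notation C := (@ou_C R).
Notation A := (ouD1 gamma).
Notation B := (ouD2 gamma).
Variables (al M K : R) (f : X -> R).
Hypothesis hal : 0 < al < 1.
Hypothesis hf : cbdd f M.
Hypothesis K0 : 0 <= K.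
Hypothesis hK : forall z k, inH gamma k -> `|f (z + k) - f z| <= K * hn k `^ al.
Implicit Types (t : R) (h k x g : X).

Let n0 h : 0 <= hn h. Proof. exact: hnorm_ge0. Qed.

Let ouD1_holder2 t h x : 0 < t -> inH gamma h ->
  `|A t h f x| <= 2 * K * hn h * (2 * t) `^ ((al - 1) / 2).
Proof.
move=> t0 hh; have [_ _ _ h4] := ouD1_spec hsep hgauss x t0 hh hf.
apply: le_trans (h4 _ _ hal K0 hK) _.
have -> : 2 * K * ou_s t `^ al * (ou_c t * hn h) = 2 * K * hn h * (ou_s t `^ al * ou_c t) by ring.
by apply: ler_wpM2l; [rewrite mulr_ge0// mulr_ge0|exact: ou_sc_le].
Qed.

Lemma ouD1_half_holder t h x : 0 < t -> inH gamma h ->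
  `|A (t / 2) h f x| <= 2 * K * hn h * t `^ ((al - 1) / 2).
Proof.
move=> t0 hh; have t2 : 0 < t / 2 by rewrite divr_gt0.
by have := ouD1_holder2 x t2 hh; rewrite mulrCA divff// mulr1.
Qed.

Lemma ouD1_holder t h x : 0 < t -> inH gamma h ->
  `|A t h f x| <= 2 * K * hn h * t `^ ((1 + al) / 2 - 1).
Proof.
move=> t0 hh; apply: le_trans (ouD1_holder2 x t0 hh) _.
apply: ler_wpM2l; first by rewrite mulr_ge0// mulr_ge0.
have -> : (1 + al) / 2 - 1 = - ((1 - al) / 2) by field.
have -> : (al - 1) / 2 = - ((1 - al) / 2) by field.
move: hal => /andP[_ a1]; apply: powRN_le => //; first by rewrite divr_ge0// subr_ge0 ltW.
by rewrite ler_peMl ?(ltW t0)// ler1n.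
Qed.

(** The exponent [1 + 1/2] gives the integrable singularity [t^(-3/4)]; only the bound [M] on [f]
    enters. *)
Lemma OU_remainder_holder t h x : 0 < t -> inH gamma h ->
  `|OUg t f (x + h) - OUg t f x - A t h f x|
    <= (C + 3) * M * hn h `^ (1 + 2^-1) * t `^ (4^-1 - 1).
Proof.
move=> t0 hh; have p12 : 1 <= 1 + (2^-1 : R) <= 2 by apply/andP; split; lra.
apply: le_trans (OU_remainder hsep hgauss x t0 hh hf p12) _.
have M0 := cbdd_ge0 hf; have C0 : 0 <= C by exact: le_trans ou_C_ge.
rewrite -[leRHS]mulrA; apply: ler_wpM2l; first by rewrite mulr_ge0// addr_ge0.
rewrite powRM ?(ltW (ou_c_gt0 t0))// mulrC ler_wpM2l ?powR_ge0//.
have le := @powR_le R (1 + 2^-1) _ _ _ (ltW (ou_c_gt0 t0)) (ou_c_le1 t0).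
apply: le_trans (le _) _; first by lra.
by rewrite -powRrM (_ : - 2^-1 * (1 + 2^-1) = 4^-1 - 1 :> R)//; field.
Qed.

(** Here the inner derivative already costs [t^((al-1)/2)], so the remainder exponent must stay
    between 1 and [1 + al]; the midpoint is taken. *)
Lemma ouD1_remainder_holder t h k x : 0 < t -> inH gamma h -> inH gamma k ->
  `|A t h f (x + k) - A t h f x - B t h k f x|
    <= (C + 3) * (2 * K) * hn h * hn k `^ (1 + al / 2) * t `^ (al / 4 - 1).
Proof.
move=> t0 hh hk; move: (hal) => /andP[a0 a1].
have p12 : 1 <= 1 + al / 2 <= 2 by apply/andP; split; lra.
have hN := fun y => ouD1_half_holder y t0 hh.
apply: le_trans (ouD1_remainder hsep hgauss x t0 hh hk hf hN p12) _.
have C0 : 0 <= C by exact: le_trans ou_C_ge.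
have c0 : 0 < ou_c (t / 2) by apply: ou_c_gt0; rewrite divr_gt0.
rewrite powRM ?(ltW c0)//.
have -> : (C + 3) * (2 * K) * hn h * hn k `^ (1 + al / 2) * t `^ (al / 4 - 1) =
  (C + 3) * (2 * K * hn h * t `^ ((al - 1) / 2)) *
   (((t `^ (- 2^-1)) `^ (1 + al / 2)) * hn k `^ (1 + al / 2)).
  have -> : t `^ (al / 4 - 1) = t `^ ((al - 1) / 2) * (t `^ (- 2^-1)) `^ (1 + al / 2).
    by rewrite -powRrM -powRD ?(gt_eqF t0) ?implybT//; congr (_ `^ _); field.
  ring.
have N0 : 0 <= 2 * K * hn h * t `^ ((al - 1) / 2).
  by rewrite mulr_ge0 ?powR_ge0// mulr_ge0// mulr_ge0.
apply: ler_wpM2l; first by apply: mulr_ge0 => //; exact: addr_ge0.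
rewrite ler_wpM2r ?powR_ge0//; apply: powR_le; rewrite ?(ltW c0)//; first by lra.
exact: ou_c_half_le.
Qed.

Lemma ouD2_holder t h k x : 0 < t -> inH gamma h -> inH gamma k ->
  `|B t h k f x| <= 2 * K * hn h * hn k * t `^ (al / 2 - 1).
Proof.
move=> t0 hh hk; have hN := fun y => ouD1_half_holder y t0 hh.
apply: le_trans (ouD2_le hsep hgauss x t0 hh hk hf hN) _.
have -> : 2 * K * hn h * hn k * t `^ (al / 2 - 1) =
  t `^ (- 2^-1) * hn k * (2 * K * hn h * t `^ ((al - 1) / 2)).
  have -> : t `^ (al / 2 - 1) = t `^ (- 2^-1) * t `^ ((al - 1) / 2).
    by rewrite -powRD ?(gt_eqF t0) ?implybT//; congr (_ `^ _); field.
  ring.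
apply: ler_wpM2r; first by rewrite mulr_ge0 ?powR_ge0// mulr_ge0// mulr_ge0.
by rewrite ler_wpM2r// ou_c_half_le.
Qed.

(** The first branch bounds the two terms separately. In the second, each [ou_c (t / 2 / 2)] brings
    a factor 2 and the inner derivative another, whence [8 * (C + 2)], which covers both
    branches. *)
Lemma ouD2_diff_min t h k g x : 0 < t -> inH gamma h -> inH gamma k -> inH gamma g ->
  `|B t h k f (x + g) - B t h k f x|
    <= 8 * (C + 2) * K * hn h * hn k * min_weight (al / 2) (hn g) t.
Proof.
move=> t0 hh hk hg; have C0 : 0 <= C by exact: le_trans ou_C_ge.
have c2 : 8 <= 8 * (C + 2) by have := @ou_C_ge R; lra.
have P0 : 0 <= K * hn h * hn k by rewrite mulr_ge0// mulr_ge0.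
rewrite /min_weight minEle; case: ifP => _.
  apply: le_trans (ler_normB _ _) _.
  apply: le_trans (lerD (ouD2_holder _ t0 hh hk) (ouD2_holder _ t0 hh hk)) _.
  rewrite -mulrDl; apply: ler_wpM2r; first exact: powR_ge0.
  have -> : 2 * K * hn h * hn k + 2 * K * hn h * hn k = 4 * (K * hn h * hn k) by ring.
  have -> : 8 * (C + 2) * K * hn h * hn k = 8 * (C + 2) * (K * hn h * hn k) by ring.
  by apply: ler_wpM2r => //; apply: le_trans c2; rewrite ler_nat.
have hN := fun y => ouD1_half_holder y t0 hh.
have q0 : 0 <= 2 * t `^ (- 2^-1) by apply: mulr_ge0 => //; exact: powR_ge0.
have c4 := ou_c_quarter_le t0.
have cp : 0 <= ou_c (t / 2 / 2) by apply: ltW; apply: ou_c_gt0; rewrite !divr_gt0.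
apply: le_trans (ouD2_lip hsep hgauss x t0 hh hk hg hf hN) _.
have -> : 8 * (C + 2) * K * hn h * hn k * (t `^ (al / 2 - 3 / 2) * hn g) =
  (C + 2) * (2 * t `^ (- 2^-1) * hn g) *
    (2 * t `^ (- 2^-1) * hn k * (2 * K * hn h * t `^ ((al - 1) / 2))).
  have -> : t `^ (al / 2 - 3 / 2) = t `^ (- 2^-1) * t `^ (- 2^-1) * t `^ ((al - 1) / 2).
    by rewrite -!powRD ?(gt_eqF t0) ?implybT//; congr (_ `^ _); field.
  ring.
have N0 : 0 <= 2 * K * hn h * t `^ ((al - 1) / 2).
  by rewrite mulr_ge0 ?powR_ge0// mulr_ge0// mulr_ge0.
apply: ler_pM.
- by apply: mulr_ge0; [exact: addr_ge0|exact: mulr_ge0].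
- by apply: mulr_ge0 => //; exact: mulr_ge0.
- by apply: ler_wpM2l; [exact: addr_ge0|apply: ler_wpM2r].
- by apply: ler_wpM2r => //; apply: ler_wpM2r.
Qed.

End HolderEstimates.

(** * Measurability and dominated convergence in time *)

Section TimeIntegrals.
Context {R : realType} {X : completeNormedModType R}.
Variable gamma : probability (@borelX R X) R.
Hypothesis hsep : @separable R X.
Hypothesis hgauss : centered_gaussian gamma.
Notation BX := (@borelX R X).
Notation OUg := (OU gamma).
Notation A := (ouD1 gamma).
Notation B := (ouD2 gamma).
Notation mu := (@lebesgue_measure R).
Notation D := (`]0%R, +oo[%classic : set R).
Implicit Types (t : R) (f : X -> R) (h k x y : X).

Lemma ou_flow_continuous x (z : X) : continuous (fun t : R => expR (- t) *: x + ou_s t *: z).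
Proof.
move=> t; apply: cvgD; apply: cvgZr_tmp.
  by apply: continuous_comp; [exact: continuousN|exact: continuous_expR].
apply: (@continuous_comp _ _ _ (fun t => 1 - expR (- (2 * t))) Num.sqrt); last exact: sqrt_continuous.
apply: cvgB; first exact: cvg_cst.
apply: (@continuous_comp _ _ _ (fun t => - (2 * t)) expR); last exact: continuous_expR.
by apply: cvgN; apply: cvgM; [exact: cvg_cst|exact: cvg_id].
Qed.

Lemma Rintegral_time_measurable (G : R -> X -> R) (M : R) (E : set R) :
  (forall t, continuous (G t)) -> (forall z, continuous (G^~ z)) ->
  (forall t z, `|G t z| <= M) ->
  measurable_fun E (fun t => \int[gamma]_(z in [set: BX]) G t z).
Proof.
move=> cG cz GM; apply: measurable_funTS; apply: continuous_measurable_fun => t.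
apply: (@seq_continuous R R^o) => y yt.
have [|||_ //] := @bounded_Rintegral_cvg _ _ _ gamma (fun n z => G (y n) z) (G t) M.
- by move=> n; exact: continuous_borel_measurable.
- by move=> n z.
- by move=> z; exact: (@cvg_continuous_seq R R^o (G^~ (z : X)) _ _ (cz z) yt).
Qed.

Lemma OU_time_measurable f M x (E : set R) : cbdd f M -> measurable_fun E (fun t => OUg t f x).
Proof.
move=> hf; have := @Rintegral_time_measurable (fun t z => f (expR (- t) *: x + ou_s t *: z)) M E.
apply=> [t|z t|t z]; last exact: hf.2.
  by have [] := cbdd_affine (expR (- t) *: x) (ou_s t) hf.
apply: (@continuous_comp _ _ _ (fun t => expR (- t) *: x + ou_s t *: z) f); last exact: hf.1.
exact: ou_flow_continuous.
Qed.

Lemma ou_modulus_time_measurable f M x y (E : set R) : cbdd f M ->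
  measurable_fun E (fun t => ou_modulus gamma t f x y).
Proof.
move=> hf; rewrite (_ : (fun t => _) = fun t => \int[gamma]_(z in [set: BX])
  (f (expR (- t) *: y + ou_s t *: (z : X)) - f (expR (- t) *: x + ou_s t *: (z : X))) ^+ 2); last first.
  by apply/funext => t; rewrite ou_modulusE.
have cf a z : continuous (fun t => f (expR (- t) *: a + ou_s t *: z)).
  move=> t; apply: (@continuous_comp _ _ _ (fun t => expR (- t) *: a + ou_s t *: z) f).
    exact: ou_flow_continuous.
  exact: hf.1.
apply: (@Rintegral_time_measurable (fun t z => (f (expR (- t) *: y + ou_s t *: z)
  - f (expR (- t) *: x + ou_s t *: z)) ^+ 2) ((M + M) ^+ 2)) => [t z|z t|t z].
- have [c1 _] := cbdd_affine (expR (- t) *: y) (ou_s t) hf.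
  have [c2 _] := cbdd_affine (expR (- t) *: x) (ou_s t) hf.
  by apply: cvgM; apply: cvgB; [exact: c1|exact: c2|exact: c1|exact: c2].
- by apply: cvgM; apply: cvgB; exact: cf.
- rewrite normrX ler_sqr ?nnegrE//; last by rewrite addr_ge0 ?(cbdd_ge0 hf).
  by apply: le_trans (ler_normB _ _) _; apply: lerD; exact: hf.2.
Qed.

(** Having a derivative defined as a sequential limit pays off: measurability in time passes from
    the difference quotients. *)
Lemma ouD1_time_measurable h f M x : inH gamma h -> cbdd f M ->
  measurable_fun D (fun t => A t h f x).
Proof.
move=> hh hf; apply: (measurable_fun_cvg
  (h := fun n t => n.+1%:R * (OUg t f (x + n.+1%:R^-1 *: h) - OUg t f x))) => [n|t].
  by apply: measurable_funM => //; apply: measurable_funB; exact: OU_time_measurable hf.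
rewrite /= in_itv/= andbT => t0.
by have [_ c _ _] := ouD1_spec hsep hgauss x t0 hh hf.
Qed.

Lemma ouD2_time_measurable h k f M x : inH gamma h -> inH gamma k -> cbdd f M ->
  measurable_fun D (fun t => B t h k f x).
Proof.
move=> hh hk hf; apply: (measurable_fun_cvg
  (h := fun n t => n.+1%:R * (A t h f (x + n.+1%:R^-1 *: k) - A t h f x))) => [n|t].
  by apply: measurable_funM => //; apply: measurable_funB; exact: ouD1_time_measurable hf.
rewrite /= in_itv/= andbT => t0.
by have [_ c] := ouD2_half hsep hgauss x t0 hh hk hf.
Qed.

Lemma Rintegral_D_le (F w : R -> R) : measurable_fun D F ->
  (forall t, 0 < t -> `|F t| <= w t) -> mu.-integrable D (EFin \o w) ->
  mu.-integrable D (EFin \o F) /\ `|\int[mu]_(t in D) F t| <= \int[mu]_(t in D) w t.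
Proof.
move=> mF Fw iw; have mD := @measurable_D R.
have iF : mu.-integrable D (EFin \o F).
  apply: le_integrable iw => //; first exact/measurable_EFinP.
  move=> t; rewrite /= in_itv/= andbT => t0.
  by rewrite lee_fin; apply: le_trans (Fw t t0) _; exact: ler_norm.
split=> //; apply: le_trans (le_normr_Rintegral mD iF) _.
apply: le_Rintegral => //; first by apply: integrable_norm.
by move=> t; rewrite /= in_itv/= andbT; exact: Fw.
Qed.

Lemma ou_modulus_ge0 t f x y : 0 <= ou_modulus gamma t f x y.
Proof. by rewrite ou_modulusE; apply: Rintegral_ge0 => z _; exact: sqr_ge0. Qed.

Lemma ou_modulus_cvg t f M x (y : nat -> X) : cbdd f M -> y n @[n --> \oo] --> x ->
  ou_modulus gamma t f x (y n) @[n --> \oo] --> (0 : R).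
Proof.
move=> hf yx; under eq_fun do rewrite ou_modulusE.
have [|||_ ] := @bounded_Rintegral_cvg _ _ _ gamma (fun n z =>
   (f (expR (- t) *: y n + ou_s t *: z) - f (expR (- t) *: x + ou_s t *: z)) ^+ 2) (cst 0) ((M + M) ^+ 2).
- move=> n; apply: continuous_borel_measurable => z.
  have [c1 _] := cbdd_affine (expR (- t) *: y n) (ou_s t) hf.
  have [c2 _] := cbdd_affine (expR (- t) *: x) (ou_s t) hf.
  by apply: cvgM; apply: cvgB; [exact: c1|exact: c2|exact: c1|exact: c2].
- move=> n z; rewrite normrX ler_sqr ?nnegrE//; last by rewrite addr_ge0 ?(cbdd_ge0 hf).
  by apply: le_trans (ler_normB _ _) _; apply: lerD; exact: hf.2.
- move=> z.
  have c : f (expR (- t) *: y n + ou_s t *: z) @[n --> \oo] --> f (expR (- t) *: x + ou_s t *: z).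
    apply: (cvg_continuous_seq hf.1); apply: cvgD; last exact: cvg_cst.
    by apply: cvgZl_tmp.
  have c0 : f (expR (- t) *: y n + ou_s t *: z) - f (expR (- t) *: x + ou_s t *: z) @[n --> \oo] --> (0 : R).
    by rewrite -(subrr (f (expR (- t) *: x + ou_s t *: z))); apply: cvgB => //; exact: cvg_cst.
  by have := cvgM c0 c0; rewrite mulr0; exact.
- by rewrite (Rintegral_prob_cst gamma).
Qed.

(** The radius [d] is chosen before [F], so one radius serves all directions of norm at most 1: this
    is continuity in operator norm. The minimum of [w] and [v * sqrt (modulus)] tends to 0 pointwise
    and is dominated by [w], so [v] may be as singular at 0 as [1/t]. *)
Lemma time_equicontinuity f M x (w v : R -> R) : cbdd f M ->
  measurable_fun D v -> mu.-integrable D (EFin \o w) ->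
  (forall t, 0 < t -> 0 <= w t /\ 0 <= v t) ->
  forall e, 0 < e -> exists d, 0 < d /\ forall y, `|y - x| < d ->
    forall F : R -> R, measurable_fun D F ->
      (forall t, 0 < t -> `|F t| <= w t /\ F t ^+ 2 <= v t ^+ 2 * ou_modulus gamma t f x y) ->
      `|\int[mu]_(t in D) F t| <= e.
Proof.
move=> hf mv iw wv e e0; have mD := @measurable_D R.
have mw : measurable_fun D w by have /integrableP[/measurable_EFinP] := iw.
pose Phi y t := Num.min (w t) (v t * Num.sqrt (ou_modulus gamma t f x y)).
have msq : measurable_fun setT (@Num.sqrt R) by apply: continuous_measurable_fun; exact: sqrt_continuous.
have mPhi y : measurable_fun D (Phi y).
  apply: measurable_minr => //; apply: measurable_funM => //.
  by apply: (measurableT_comp msq); exact: ou_modulus_time_measurable hf.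
have Phi0 y t : 0 < t -> 0 <= Phi y t.
  by move=> t0; have [w0 v0] := wv t t0; rewrite le_min w0 mulr_ge0 ?sqrtr_ge0.
have Phiw y t : 0 < t -> `|Phi y t| <= w t.
  by move=> t0; rewrite ger0_norm ?Phi0// ge_min lexx.
have [|d [d0 hd]] := @seq_eps_delta _ _ (fun y => \int[mu]_(t in D) Phi y t) x _ e e0.
  move=> y yx.
  have m0 : measurable_fun D (cst 0 : R -> R) by exact: measurable_cst.
  have [|||_] := @Rintegral_dominated_cvg _ _ _ mu D (fun n => Phi (y n)) (cst 0) w mD (fun n => mPhi _) m0.
  - apply: aeW => t; rewrite /= in_itv/= andbT => t0; have [w0 v0] := wv t t0.
    have c1 : Num.sqrt (ou_modulus gamma t f x (y n)) @[n --> \oo] --> (0 : R).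
      rewrite -(sqrtr0 R); apply: (@cvg_continuous_seq R R^o); first exact: sqrt_continuous.
      exact: (ou_modulus_cvg t hf yx).
    have c2 : v t * Num.sqrt (ou_modulus gamma t f x (y n)) @[n --> \oo] --> (0 : R).
      by rewrite -(mulr0 (v t)); apply: cvgM => //; exact: cvg_cst.
    apply: (@squeeze_cvgr _ _ _ _ (cst 0) (fun n => v t * Num.sqrt (ou_modulus gamma t f x (y n)))) => //.
      by apply: nearW => n; rewrite Phi0//= ge_min lexx orbT.
    exact: cvg_cst.
  - by move=> n t; rewrite /= in_itv/= andbT; exact: Phiw.
  - exact: iw.
  by rewrite Rintegral_cst ?mul0r.
exists d; split=> // y yd F mF hF.
have iPhi : mu.-integrable D (EFin \o Phi y) by have [] := Rintegral_D_le (mPhi y) (Phiw y) iw.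
have FPhi t : 0 < t -> `|F t| <= Phi y t.
  move=> t0; have [h1 h2] := hF t t0; have [w0 v0] := wv t t0; rewrite le_min h1/=.
  apply: normr_le_of_sqr; first by rewrite mulr_ge0 ?sqrtr_ge0.
  by rewrite exprMn sqr_sqrtr// ou_modulus_ge0.
have [_ le] := Rintegral_D_le mF FPhi iPhi.
by apply: le_trans le _; apply: le_trans (ler_norm _) _; exact: hd.
Qed.

End TimeIntegrals.

Section LaplaceTransform.
Context {R : realType}.
Variable la : R.
Hypothesis la0 : 0 < la.
Notation mu := (@lebesgue_measure R).
Notation D := (`]0%R, +oo[%classic : set R).
Notation E t := (expR (- (la * t))).
Implicit Types (F G : R -> R) (a b c t : R).

Definition laplace G : R := \int[mu]_(t in D) (E t * G t).
Definition laplace_integrable G := mu.-integrable D (EFin \o (fun t => E t * G t)).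
Definition laplace_weight a : R := laplace (fun t => t `^ (a - 1)).

Lemma measurable_laplace_kernel (S : set R) : measurable_fun S (fun t => E t).
Proof.
apply: measurable_funTS; apply: measurable_comp_expR.
by apply: measurableT_comp => //; exact: measurable_funM.
Qed.

Lemma laplace_kernel_le1 t : 0 < t -> E t <= 1.
Proof. by move=> t0; apply: expRN_le1; rewrite mulr_ge0 ?ltW. Qed.

Lemma laplace_weight_ge0 a : 0 <= laplace_weight a.
Proof. by apply: Rintegral_ge0 => t _; rewrite mulr_ge0 ?expR_ge0 ?powR_ge0. Qed.

Lemma laplace_lin a F G : laplace_integrable F -> laplace_integrable G ->
  laplace_integrable (fun t => a * F t + G t) /\
  laplace (fun t => a * F t + G t) = a * laplace F + laplace G.
Proof.
move=> iF iG; have mD := @measurable_D R; have iaF := integrable_mulR a mD iF.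
have e : (fun t => E t * (a * F t + G t)) = fun t => a * (E t * F t) + E t * G t.
  by apply/funext => t; rewrite mulrDr mulrCA.
rewrite /laplace_integrable /laplace e; split; first exact: integrable_addR.
by rewrite RintegralD// RintegralZl.
Qed.

Lemma laplaceB F G : laplace_integrable F -> laplace_integrable G ->
  laplace_integrable (fun t => F t - G t) /\
  laplace (fun t => F t - G t) = laplace F - laplace G.
Proof.
move=> iF iG; have := laplace_lin (-1) iG iF.
rewrite mulN1r [- _ + _]addrC.
rewrite (_ : (fun t => _) = fun t => F t - G t)//.
by apply/funext => t; rewrite mulN1r addrC.
Qed.

Lemma laplace_eq F G : (forall t, 0 < t -> F t = G t) -> laplace F = laplace G.
Proof.
move=> FG; apply: eq_Rintegral => t /set_mem; rewrite /= in_itv/= andbT => t0.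
by rewrite FG.
Qed.

Lemma laplace_le G c a : measurable_fun D G -> 0 < a <= 1 ->
  (forall t, 0 < t -> `|G t| <= c * t `^ (a - 1)) ->
  laplace_integrable G /\ `|laplace G| <= c * laplace_weight a.
Proof.
move=> mG ha Gc; have mD := @measurable_D R.
have i1 := exp_powR_integrable la0 ha.
rewrite /laplace_weight /laplace -RintegralZl//; apply: Rintegral_D_le.
- by apply: measurable_funM => //; exact: measurable_laplace_kernel.
- move=> t t0; rewrite normrM ger0_norm ?expR_ge0// mulrCA ler_wpM2l ?expR_ge0//; exact: Gc.
- exact: integrable_mulR.
Qed.

End LaplaceTransform.

Lemma sqr_mul_le {R : realDomainType} (a b c m : R) : b ^+ 2 <= c ^+ 2 * m ->
  (a * b) ^+ 2 <= (a * c) ^+ 2 * m.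
Proof. by move=> h; rewrite !exprMn -[leRHS]mulrA ler_wpM2l ?sqr_ge0. Qed.

Section OperatorNorms.
Context {R : realType} {X : completeNormedModType R}.
Variable gamma : probability (@borelX R X) R.
Hypothesis hgauss : centered_gaussian gamma.
Notation hn := (hnorm gamma).

Lemma opnorm1_le (A : X -> R) c : 0 <= c -> (forall k, inH gamma k -> `|A k| <= c * hn k) ->
  (opnorm1 gamma A <= c%:E)%E.
Proof.
move=> c0 h; apply: ge_ereal_sup => _ [k [hk k1] <-]; rewrite lee_fin.
by apply: le_trans (h k hk) _; rewrite ler_piMr.
Qed.

Lemma opnorm2_le (B : X -> X -> R) c : 0 <= c ->
  (forall h k, inH gamma h -> inH gamma k -> `|B h k| <= c * hn k * hn h) ->
  (opnorm2 gamma B <= c%:E)%E.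
Proof.
move=> c0 hB; apply: ge_ereal_sup => _ [h [k [hh h1 hk k1 ->]]]; rewrite lee_fin.
apply: le_trans (hB h k hh hk) _.
apply: le_trans (ler_piMr _ h1) _; first by rewrite mulr_ge0 ?(hnorm_ge0 hgauss).
by rewrite ler_piMr.
Qed.

End OperatorNorms.

(** * Schauder estimates for the resolvent *)

Section Resolvent.
Context {R : realType} {X : completeNormedModType R}.
Variable gamma : probability (@borelX R X) R.
Hypothesis hsep : @separable R X.
Hypothesis hgauss : centered_gaussian gamma.
Notation hn := (hnorm gamma).
Notation C := (@ou_C R).
Notation A := (ouD1 gamma).
Notation B := (ouD2 gamma).
Notation mu := (@lebesgue_measure R).
Notation D := (`]0%R, +oo[%classic : set R).
Variables (la al : R).
Hypothesis la0 : 0 < la.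
Hypothesis hal : 0 < al < 1.
Notation W := (laplace_weight la).
Notation E t := (expR (- (la * t))).
Implicit Types (t : R) (h k x g : X).

Definition resolvent_D1 (f : X -> R) x k : R := laplace la (fun t => A t k f x).
(** [D2 x h k] is the increment in the direction [h] of the derivative along [k], whence the swap. *)
Definition resolvent_D2 (f : X -> R) x h k : R := laplace la (fun t => B t k h f x).

Variables (M K : R) (f : X -> R).
Hypothesis hf : cbdd f M.
Hypothesis K0 : 0 <= K.
Hypothesis hK : forall z k, inH gamma k -> `|f (z + k) - f z| <= K * hn k `^ al.
Notation u := (OU_resolvent gamma la f).
Notation D1 := (resolvent_D1 f).
Notation D2 := (resolvent_D2 f).

Let al0 : 0 < al. Proof. by case/andP: hal. Qed.
Let al1 : al < 1. Proof. by case/andP: hal. Qed.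
Let M0 : 0 <= M. Proof. exact: cbdd_ge0 hf. Qed.
Let C0 : 0 <= C. Proof. exact: le_trans ou_C_ge. Qed.
Let n0 h : 0 <= hn h. Proof. exact: hnorm_ge0. Qed.
Let a1 : 0 < (1 : R) <= 1. Proof. by rewrite ltr01 lexx. Qed.
Let a4 : 0 < (4^-1 : R) <= 1. Proof. by apply/andP; split; lra. Qed.
Let aA : 0 < (1 + al) / 2 <= 1. Proof. by have := al0; have := al1; move=> ? ?; apply/andP; split; lra. Qed.
Let aB : 0 < al / 2 <= 1. Proof. by have := al0; have := al1; move=> ? ?; apply/andP; split; lra. Qed.
Let aR : 0 < al / 4 <= 1. Proof. by have := al0; have := al1; move=> ? ?; apply/andP; split; lra. Qed.

Let lapU x : laplace_integrable la (fun t => OU gamma t f x) /\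
  `|laplace la (fun t => OU gamma t f x)| <= M * W 1.
Proof.
apply: (laplace_le la0 _ a1) => [|t t0]; first exact: OU_time_measurable hf.
by rewrite subrr powRr0 mulr1; exact: OU_bound hf.
Qed.

(** The estimates hold for [t > 0], while the resolvent integrates from 0 included; a single point
    is negligible. *)
Lemma resolventE x : u x = laplace la (fun t => OU gamma t f x).
Proof. by rewrite /OU_resolvent -Rintegral_itv_obnd_cbnd//; exact: (lapU x).1. Qed.

Lemma resolvent_le x : `|u x| <= M * W 1.
Proof. by rewrite resolventE; exact: (lapU x).2. Qed.

Let lapA k x : inH gamma k -> laplace_integrable la (fun t => A t k f x) /\
  `|D1 x k| <= 2 * K * hn k * W ((1 + al) / 2).
Proof.
move=> hk; apply: (laplace_le la0 _ aA) => [|t t0].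
  exact: (ouD1_time_measurable hsep hgauss x hk hf).
exact: (ouD1_holder hsep hgauss hal hf).
Qed.

Lemma resolvent_D1_le x k : inH gamma k -> `|D1 x k| <= 2 * K * W ((1 + al) / 2) * hn k.
Proof. by move=> hk; rewrite mulrAC; exact: (lapA x hk).2. Qed.

Let lapB h k x : inH gamma h -> inH gamma k -> laplace_integrable la (fun t => B t k h f x) /\
  `|D2 x h k| <= 2 * K * hn k * hn h * W (al / 2).
Proof.
move=> hh hk; apply: (laplace_le la0 _ aB) => [|t t0].
  exact: (ouD2_time_measurable hsep hgauss x hk hh hf).
exact: (ouD2_holder hsep hgauss hal hf).
Qed.

Lemma resolvent_D2_le x h k : inH gamma h -> inH gamma k ->
  `|D2 x h k| <= 2 * K * W (al / 2) * hn k * hn h.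
Proof.
move=> hh hk; have -> : 2 * K * W (al / 2) * hn k * hn h = 2 * K * hn k * hn h * W (al / 2) by ring.
exact: (lapB x hh hk).2.
Qed.

Lemma resolvent_D1_linear x : linear_onH gamma (D1 x).
Proof.
move=> a h k hh hk; rewrite /resolvent_D1.
rewrite -(laplace_lin a (lapA x hh).1 (lapA x hk).1).2.
by apply: laplace_eq => t t0; exact: ouD1_linh hf.
Qed.

Lemma resolvent_D2_linearr x h : inH gamma h -> linear_onH gamma (D2 x h).
Proof.
move=> hh a k g hk hg; rewrite /resolvent_D2.
rewrite -(laplace_lin a (lapB x hh hk).1 (lapB x hh hg).1).2.
by apply: laplace_eq => t t0; exact: ouD2_linh hf.
Qed.

Lemma resolvent_D2_linearl x k : inH gamma k -> linear_onH gamma (fun h => D2 x h k).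
Proof.
move=> hk a h g hh hg; rewrite /resolvent_D2.
rewrite -(laplace_lin a (lapB x hh hk).1 (lapB x hg hk).1).2.
by apply: laplace_eq => t t0; exact: ouD2_link hf.
Qed.

Lemma resolvent_remainder x h : inH gamma h ->
  `|u (x + h) - u x - D1 x h| <= (C + 3) * M * W 4^-1 * hn h `^ (1 + 2^-1).
Proof.
move=> hh; rewrite !resolventE.
have [i1 <-] := laplaceB (lapU (x + h)).1 (lapU x).1.
have [i2 <-] := laplaceB i1 (lapA x hh).1.
have [] // := @laplace_le R la la0 (fun t => OU gamma t f (x + h) - OU gamma t f x - A t h f x)
   ((C + 3) * M * hn h `^ (1 + 2^-1)) _ _ a4.
- apply: measurable_funB; last exact: (ouD1_time_measurable hsep hgauss x hh hf).
  by apply: measurable_funB; exact: OU_time_measurable hf.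
- by move=> t t0; exact: (OU_remainder_holder hsep hgauss).
by rewrite mulrAC.
Qed.

Lemma resolvent_D1_remainder x h k : inH gamma h -> inH gamma k ->
  `|D1 (x + h) k - D1 x k - D2 x h k|
    <= (C + 3) * (2 * K) * W (al / 4) * hn h `^ (1 + al / 2) * hn k.
Proof.
move=> hh hk.
have [i1 <-] := laplaceB (lapA (x + h) hk).1 (lapA x hk).1.
have [i2 <-] := laplaceB i1 (lapB x hh hk).1.
have [] // := @laplace_le R la la0 (fun t => A t k f (x + h) - A t k f x - B t k h f x)
   ((C + 3) * (2 * K) * hn k * hn h `^ (1 + al / 2)) _ _ aR.
- apply: measurable_funB; last exact: (ouD2_time_measurable hsep hgauss x hk hh hf).
  by apply: measurable_funB; apply: (ouD1_time_measurable hsep hgauss _ hk hf).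
- by move=> t t0; exact: (ouD1_remainder_holder hsep hgauss hal hf K0 hK x t0 hk hh).
move=> _ /le_trans; apply; rewrite le_eqVlt; apply/orP; left; apply/eqP; ring.
Qed.

Lemma resolvent_D2_holder K1 x h k g : inH gamma h -> inH gamma k -> inH gamma g ->
  mu.-integrable D (EFin \o min_weight (al / 2) (hn g)) ->
  \int[mu]_(t in D) min_weight (al / 2) (hn g) t <= K1 * hn g `^ al ->
  `|D2 (x + g) h k - D2 x h k| <= 8 * (C + 2) * K * K1 * hn g `^ al * hn k * hn h.
Proof.
move=> hh hk hg iw lw; have mD := @measurable_D R.
have [i1 <-] := laplaceB (lapB (x + g) hh hk).1 (lapB x hh hk).1.
pose c := 8 * (C + 2) * K * hn k * hn h.
have c0 : 0 <= c by rewrite mulr_ge0// mulr_ge0// mulr_ge0// mulr_ge0// addr_ge0.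
have [] := @Rintegral_D_le R (fun t => E t * (B t k h f (x + g) - B t k h f x))
  (fun t => c * min_weight (al / 2) (hn g) t).
- apply: measurable_funM; first exact: measurable_laplace_kernel.
  by apply: measurable_funB; apply: (ouD2_time_measurable hsep hgauss _ hk hh hf).
- move=> t t0; rewrite normrM ger0_norm ?expR_ge0//.
  (* The exponential is discarded, [min_weight] being integrable up to infinity by itself. *)
  apply: le_trans (ler_piMl _ (laplace_kernel_le1 la0 t0)) _ => //.
  exact: (ouD2_diff_min hsep hgauss hal hf).
- exact: integrable_mulR.
move=> _ /le_trans; apply; rewrite RintegralZl//.
apply: le_trans (ler_wpM2l c0 lw) _.
by rewrite le_eqVlt; apply/orP; left; apply/eqP; rewrite /c; ring.
Qed.

Let mE : measurable_fun D (fun t => E t). Proof. exact: measurable_laplace_kernel. Qed.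

Lemma resolvent_continuous : continuous u.
Proof.
move=> x; apply/cvgrPdist_le => e e0; have mD := @measurable_D R.
have iw := integrable_mulR (2 * M) mD (exp_powR_integrable la0 a1).
have [|d [d0 hd]] := time_equicontinuity gamma x hf mE iw _ e0.
  by move=> t t0; rewrite !mulr_ge0 ?expR_ge0 ?powR_ge0.
near=> y.
have yd : `|y - x| < d by rewrite distrC; near: y; exact: cvgr_dist_lt.
rewrite distrC !resolventE.
have [i1 <-] := laplaceB (lapU y).1 (lapU x).1.
apply: (hd y yd).
  by apply: measurable_funM => //; apply: measurable_funB; exact: OU_time_measurable hf.
move=> t t0; split.
  rewrite normrM ger0_norm ?expR_ge0// subrr powRr0 mulr1 mulrC ler_wpM2r ?expR_ge0//.
  apply: le_trans (ler_normB _ _) _; have := OU_bound gamma t x hf; have := OU_bound gamma t y hf; lra.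
rewrite -{2}(mulr1 (E t)); apply: sqr_mul_le; rewrite expr1n mul1r; exact: OU_diff_sqr hf.
Unshelve. all: by end_near. Qed.

Lemma resolvent_D1_continuous x e : 0 < e -> exists d, 0 < d /\ forall y, `|y - x| < d ->
  forall k, inH gamma k -> hn k <= 1 -> `|D1 y k - D1 x k| <= e.
Proof.
move=> e0; have mD := @measurable_D R.
have iw := integrable_mulR (4 * K) mD (exp_powR_integrable la0 aA).
have mv : measurable_fun D (fun t => E t * t `^ (- 2^-1)).
  by apply: measurable_funM => //; exact: measurable_powR_fun.
have [|d [d0 hd]] := time_equicontinuity gamma x hf mv iw _ e0.
  by move=> t t0; rewrite !mulr_ge0 ?expR_ge0 ?powR_ge0.
exists d; split=> // y yd k hk k1.
have [i1 <-] := laplaceB (lapA y hk).1 (lapA x hk).1.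
apply: (hd y yd).
  by apply: measurable_funM => //; apply: measurable_funB; apply: (ouD1_time_measurable hsep hgauss _ hk hf).
move=> t t0; split.
  rewrite normrM ger0_norm ?expR_ge0// [leRHS]mulrCA ler_wpM2l ?expR_ge0//.
  have Kk : 2 * K * hn k <= 2 * K by rewrite ler_piMr// mulr_ge0.
  have b z : `|A t k f z| <= 2 * K * t `^ ((1 + al) / 2 - 1).
    by apply: le_trans (ouD1_holder hsep hgauss hal hf K0 hK _ t0 hk) _; rewrite ler_wpM2r ?powR_ge0.
  have -> : 4 * K * t `^ ((1 + al) / 2 - 1) = 2 * K * t `^ ((1 + al) / 2 - 1) + 2 * K * t `^ ((1 + al) / 2 - 1) by ring.
  exact: le_trans (ler_normB _ _) (lerD (b y) (b x)).
apply: sqr_mul_le.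
apply: le_trans (ouD1_diff_sqr hsep hgauss x y t0 hf hk) _.
rewrite ler_wpM2r ?ou_modulus_ge0// ler_sqr ?nnegrE ?powR_ge0 ?(chn_ge0 hgauss)//.
by apply: le_trans (ou_c_le1 t0); rewrite ler_piMr// ltW// ou_c_gt0.
Qed.

Lemma resolvent_D2_continuous x e : 0 < e -> exists d, 0 < d /\ forall y, `|y - x| < d ->
  forall h k, inH gamma h -> inH gamma k -> hn h <= 1 -> hn k <= 1 ->
  `|D2 y h k - D2 x h k| <= e.
Proof.
move=> e0; have mD := @measurable_D R.
have iw := integrable_mulR (4 * K) mD (exp_powR_integrable la0 aB).
have mv : measurable_fun D (fun t => E t * (t `^ (- 2^-1) * t `^ (- 2^-1))).
  by apply: measurable_funM => //; apply: measurable_funM; exact: measurable_powR_fun.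
have [|d [d0 hd]] := time_equicontinuity gamma x hf mv iw _ e0.
  by move=> t t0; rewrite !mulr_ge0 ?expR_ge0 ?powR_ge0.
exists d; split=> // y yd h k hh hk h1 k1.
have [i1 <-] := laplaceB (lapB y hh hk).1 (lapB x hh hk).1.
apply: (hd y yd).
  by apply: measurable_funM => //; apply: measurable_funB; apply: (ouD2_time_measurable hsep hgauss _ hk hh hf).
move=> t t0; split.
  rewrite normrM ger0_norm ?expR_ge0// [leRHS]mulrCA ler_wpM2l ?expR_ge0//.
  have Kk : 2 * K * hn k * hn h <= 2 * K.
    have k2 : 2 * K * hn k <= 2 * K by rewrite ler_piMr// mulr_ge0.
    by apply: le_trans k2; rewrite ler_piMr// mulr_ge0// mulr_ge0.
  have b z : `|B t k h f z| <= 2 * K * t `^ (al / 2 - 1).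
    by apply: le_trans (ouD2_holder hsep hgauss hal hf K0 hK _ t0 hk hh) _; rewrite ler_wpM2r ?powR_ge0.
  have -> : 4 * K * t `^ (al / 2 - 1) = 2 * K * t `^ (al / 2 - 1) + 2 * K * t `^ (al / 2 - 1) by ring.
  exact: le_trans (ler_normB _ _) (lerD (b y) (b x)).
apply: sqr_mul_le.
apply: le_trans (ouD2_diff_sqr hsep hgauss x y t0 hf hk hh) _.
have t2 : 0 < t / 2 by rewrite divr_gt0.
have le g : hn g <= 1 -> (ou_c (t / 2) * hn g) ^+ 2 <= (t `^ (- 2^-1)) ^+ 2.
  move=> g1; rewrite ler_sqr ?nnegrE ?powR_ge0 ?(chn_ge0 hgauss)//.
  by apply: le_trans (ou_c_half_le t0); rewrite ler_piMr// ltW// ou_c_gt0.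
by rewrite ler_wpM2r ?ou_modulus_ge0// ler_pM ?sqr_ge0// le.
Qed.

End Resolvent.

Section HolderFunctions.
Context {R : realType} {X : completeNormedModType R}.
Variable gamma : probability (@borelX R X) R.
Hypothesis hgauss : centered_gaussian gamma.
Notation hn := (hnorm gamma).
Variable al : R.
Implicit Types f : X -> R.

Lemma supnorm_ge0 f : (0 <= supnorm f)%E.
Proof.
apply: (@le_trans _ _ (`|f 0|)%:E); first by rewrite lee_fin.
by apply: ereal_sup_ubound; exists 0.
Qed.

Lemma in_CalphaH_cbdd f : in_CalphaH gamma al f -> cbdd f (fine (supnorm f)).
Proof.
move=> [cf [sf _]]; split=> // x; rewrite -lee_fin fineK; last by rewrite ge0_fin_numE// supnorm_ge0.
by apply: ereal_sup_ubound; exists x.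
Qed.

(** When [H] is trivial the Holder seminorms are suprema of the empty set, hence [-oo]. *)
Lemma holder_semi_trivial (d : X -> X -> \bar R) :
  (forall h, inH gamma h -> h = 0) -> holder_semi gamma al d = -oo%E.
Proof.
move=> H0; rewrite /holder_semi -(ereal_sup0 R); congr ereal_sup.
by apply/seteqP; split=> // r [x [h [hh /negP h0 _]]]; apply: h0; apply/eqP; exact: H0.
Qed.

Lemma hnorm_gt0 h : inH gamma h -> h != 0 -> 0 < hn h.
Proof.
move=> hh h0; rewrite lt_neqAle (hnorm_ge0 hgauss) andbT eq_sym.
by apply: contra_neq h0; exact: (hnorm_eq0 hgauss).
Qed.

Lemma holder_real_ge0 f h : inH gamma h -> h != 0 -> (0 <= holder_real gamma al f)%E.
Proof.
move=> hh h0; apply: (@le_trans _ _ ((`|f (0 + h) - f 0|)%:E * ((hn h `^ al)^-1)%:E)%E).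
  by rewrite -EFinM lee_fin mulr_ge0// invr_ge0 powR_ge0.
by apply: ereal_sup_ubound; exists 0, h.
Qed.

Lemma holder_real_le f x h : in_CalphaH gamma al f -> inH gamma h ->
  `|f (x + h) - f x| <= fine (holder_real gamma al f) * hn h `^ al.
Proof.
move=> [_ [_ fin]] hh; have [->|h0] := eqVneq h 0.
  rewrite addr0 subrr normr0 mulr_ge0 ?powR_ge0//.
  have [[k [hk k0]]|H0] := pselect (exists k, inH gamma k /\ k != 0).
    by apply: fine_ge0; exact: holder_real_ge0 hk k0.
  rewrite /holder_real holder_semi_trivial// => k hk; apply/eqP; apply/negP => /negP k0.
  by apply: H0; exists k.
have f0 := holder_real_ge0 f hh h0.
have hp : 0 < hn h `^ al by rewrite powR_gt0// hnorm_gt0.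
rewrite -ler_pdivrMr// -lee_fin fineK; last by rewrite ge0_fin_numE.
by rewrite EFinM; apply: ereal_sup_ubound; exists x, h.
Qed.

(** For trivial [H] the seminorm is [-oo], which [fine] sends to 0. *)
Lemma fine_holder_real_ge0 f : 0 <= fine (holder_real gamma al f).
Proof.
have [[k [hk k0]]|H0] := pselect (exists k, inH gamma k /\ k != 0).
  by apply: fine_ge0; exact: holder_real_ge0 hk k0.
rewrite /holder_real holder_semi_trivial// => k hk; apply/eqP; apply/negP => /negP k0.
by apply: H0; exists k.
Qed.

End HolderFunctions.

Lemma sum_le_mul_add {R : realDomainType} (M K w a b c : R) :
  0 <= M -> 0 <= K -> 0 <= w -> 0 <= a -> 0 <= b -> 0 <= c ->
  M * w + 2 * K * a + 2 * K * b + c * K <= (1 + w + 2 * a + 2 * b + c) * (M + K).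
Proof.
move=> M0 K0 w0 a0 b0 c0; rewrite -subr_ge0.
have -> : (1 + w + 2 * a + 2 * b + c) * (M + K) - (M * w + 2 * K * a + 2 * K * b + c * K) =
  M * (1 + 2 * a + 2 * b + c) + K * (1 + w) by ring.
by rewrite addr_ge0 ?mulr_ge0 ?addr_ge0 ?mulr_ge0.
Qed.

Theorem mainTheorem1 (R : realType) (X : completeNormedModType R)
  (gamma : probability (@borelX R X) R)
  (hsep : @separable R X) (hgauss : centered_gaussian gamma)
  (alpha lambda : R) (halpha : 0 < alpha < 1) (hlambda : 0 < lambda) :
  exists C : R, 0 < C /\
    forall f : X -> R, in_CalphaH gamma alpha f ->
      exists (D1 : X -> X -> R) (D2 : X -> X -> X -> R),
        C2alphaH_with gamma alpha (OU_resolvent gamma lambda f) D1 D2 /\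
        (C2alphaH_norm gamma alpha (OU_resolvent gamma lambda f) D1 D2
           <= C%:E * CalphaH_norm gamma alpha f)%E.
Proof.
have [al0 al1] := andP halpha.
(* The assumption [alpha < 1] makes the second branch of [min_weight] integrable at infinity. *)
have hd2 : 0 < alpha / 2 < 1 / 2 by apply/andP; split; lra.
have [K1 [K10 hK1]] := min_weight_integral hd2.
pose W := laplace_weight lambda; have W0 a : 0 <= W a := laplace_weight_ge0 lambda a.
pose cH := 8 * (@ou_C R + 2) * K1.
have oC : 0 <= @ou_C R by exact: le_trans (@ou_C_ge R).
have cH0 : 0 <= cH by rewrite mulr_ge0// mulr_ge0// addr_ge0.
(* One summand for each term of the norm of [u]; the leading 1 makes [C] positive. *)
pose C := 1 + W 1 + 2 * W ((1 + alpha) / 2) + 2 * W (alpha / 2) + cH.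
have oC3 : 0 <= @ou_C R + 3 by exact: addr_ge0.
have C1 : 1 <= C.
  by rewrite /C -!addrA lerDl; do ![apply: addr_ge0 => //]; exact: mulr_ge0.
exists C; split=> [|f hfa]; first exact: lt_le_trans C1.
pose M := fine (supnorm f); pose K := fine (holder_real gamma alpha f).
have hf : cbdd f M := in_CalphaH_cbdd hfa.
have M0 := cbdd_ge0 hf.
have K0 : 0 <= K by exact: fine_holder_real_ge0.
have hK z k : inH gamma k -> `|f (z + k) - f z| <= K * hnorm gamma k `^ alpha.
  by move=> hk; exact: holder_real_le.
have n0 h : 0 <= hnorm gamma h by exact: (hnorm_ge0 hgauss).
pose u := OU_resolvent gamma lambda f.
pose D1 := resolvent_D1 gamma lambda f; pose D2 := resolvent_D2 gamma lambda f.
exists D1, D2.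
have uM : (supnorm u <= (M * W 1)%:E)%E.
  by apply: ge_ereal_sup => _ [x _ <-]; rewrite lee_fin; exact: (resolvent_le gamma hlambda hf x).
have b1 : 0 <= 2 * K * W ((1 + alpha) / 2) by rewrite mulr_ge0// mulr_ge0.
have b2 : 0 <= 2 * K * W (alpha / 2) by rewrite mulr_ge0// mulr_ge0.
have D1M x : (opnorm1 gamma (D1 x) <= (2 * K * W ((1 + alpha) / 2))%:E)%E.
  apply: opnorm1_le => // k hk.
  exact: (resolvent_D1_le hsep hgauss hlambda halpha hf K0 hK x hk).
have D2M x : (opnorm2 gamma (D2 x) <= (2 * K * W (alpha / 2))%:E)%E.
  apply: opnorm2_le => // h k hh hk.
  exact: (resolvent_D2_le hsep hgauss hlambda halpha hf K0 hK x hh hk).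
have sD1 : (ereal_sup [set opnorm1 gamma (D1 x) | x in [set: X]]
    <= (2 * K * W ((1 + alpha) / 2))%:E)%E.
  by apply: ge_ereal_sup => _ [x _ <-]; exact: D1M.
have sD2 : (ereal_sup [set opnorm2 gamma (D2 x) | x in [set: X]]
    <= (2 * K * W (alpha / 2))%:E)%E.
  by apply: ge_ereal_sup => _ [x _ <-]; exact: D2M.
have hD2 : (holder_bilin gamma alpha D2 <= (cH * K)%:E)%E.
  apply: ge_ereal_sup => _ [x [g [hg g0 ->]]].
  have g1 := hnorm_gt0 hgauss hg g0; have gp : 0 < hnorm gamma g `^ alpha by exact: powR_gt0.
  have [iw lw] := hK1 _ g1; rewrite (_ : 2 * (alpha / 2) = alpha) in lw; last by field.
  rewrite lee_pdivrMr// -EFinM; apply: (opnorm2_le hgauss); first by rewrite mulr_ge0 ?(ltW gp)// mulr_ge0.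
  move=> h k hh hk.
  have := resolvent_D2_holder hsep hgauss hlambda halpha hf K0 hK x hh hk hg iw lw.
  rewrite (_ : cH * K = 8 * (@ou_C R + 2) * K * K1)//; by rewrite /cH mulrAC.
split.
  split; last exact: le_lt_trans hD2 (ltry _).
  split; first by move=> x; exact: (resolvent_continuous hlambda hf).
  split; first exact: le_lt_trans uM (ltry _).
  split; first last.
    split; first last.
      split; first exact: le_lt_trans sD1 (ltry _).
      split; first exact: le_lt_trans sD2 (ltry _).
      split=> x e e0.
        have [d [d0 hd]] := resolvent_D1_continuous hsep hgauss hlambda halpha hf K0 hK x e0.
        exists d; split=> // y yd; apply: ge_ereal_sup => _ [k [hk k1] <-].
        by rewrite lee_fin; exact: hd.
      have [d [d0 hd]] := resolvent_D2_continuous hsep hgauss hlambda halpha hf K0 hK x e0.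
      exists d; split=> // y yd; apply: ge_ereal_sup => _ [h [k [hh h1 hk k1 ->]]].
      by rewrite lee_fin; exact: hd.
    move=> x; split.
      split; first by move=> h hh; exact: (resolvent_D2_linearr hsep hgauss hlambda halpha hf K0 hK).
      split; last exact: le_lt_trans (D2M x) (ltry _).
      by move=> k hk; exact: (resolvent_D2_linearl hsep hgauss hlambda halpha hf K0 hK).
    move=> e e0.
    have c0 : 0 <= (@ou_C R + 3) * (2 * K) * W (alpha / 4).
      by apply: mulr_ge0 => //; apply: mulr_ge0 => //; exact: mulr_ge0.
    have [d [d0 hd]] := small_power c0 (divr_gt0 al0 (ltr0n R 2)) e0.
    exists d; split=> // h hh h1; apply: opnorm1_le => [|k hk]; first by rewrite mulr_ge0// ltW.
    apply: le_trans (resolvent_D1_remainder hsep hgauss hlambda halpha hf K0 hK x hh hk) _.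
    by rewrite ler_wpM2r// hd.
  move=> x; split.
    split; last exact: le_lt_trans (D1M x) (ltry _).
    exact: (resolvent_D1_linear hsep hgauss hlambda halpha hf K0 hK).
  move=> e e0.
  have c0 : 0 <= (@ou_C R + 3) * M * W 4^-1 by apply: mulr_ge0 => //; exact: mulr_ge0.
  have h2 : 0 < (2^-1 : R) by rewrite invr_gt0.
  have [d [d0 hd]] := small_power c0 h2 e0.
  exists d; split=> // h hh h1.
  by apply: le_trans (resolvent_remainder hsep hgauss hlambda halpha hf K0 hK x hh) _; exact: hd.
rewrite /C2alphaH_norm /CalphaH_norm.
(* For trivial [H] the left side contains the summand [-oo], which absorbs the others. *)
have [[k [hk k0]]|H0] := pselect (exists k, inH gamma k /\ k != 0); last first.
  rewrite /holder_bilin holder_semi_trivial ?addeNy ?leNye// => k hk; apply/eqP; apply/negP => /negP k0.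
  by apply: H0; exists k.
have [_ [sf hf2]] := hfa.
have -> : supnorm f = M%:E by rewrite fineK// ge0_fin_numE// supnorm_ge0.
have -> : holder_real gamma alpha f = K%:E.
  by rewrite fineK// ge0_fin_numE//; exact: holder_real_ge0 hk k0.
apply: le_trans (leeD (leeD (leeD uM sD1) sD2) hD2) _.
rewrite -!EFinD -EFinM lee_fin.
exact: sum_le_mul_add.
Qed.
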